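(* Let $X$ be an infinite-dimensional complex Banach space, let $v$ be a weight on $\mathbb{D}$ of the form $v=|\mu|$, where $\mu$ is an analytic function on $\mathbb{D}$ without any zeros, let $v'$ be a weight on $\mathbb{D}$, and let $2\le p<\infty$. Then there are positive constants $c_1,c_2$ such that for every analytic map $\varphi:\mathbb{D}\to\mathbb{D}$ and every analytic function $u:\mathbb{D}\to\mathbb{C}$, the weighted composition operator $uC_\varphi(f)(z)=u(z)f(\varphi(z))$ satisfies $$c_1\,\|uC_{\varphi}: wA_v^{p}(X) \longrightarrow A_{v'}^{p}(X)\| \;\le\; \left( \int_{\mathbb{D}} \frac{|u(z)|^p v'(z)}{(1-|\varphi(z)|^2)^{2}\, v(\varphi(z))} \, dA(z) \right)^{1/p} \;\le\; c_2\,\|uC_{\varphi}: wA_v^{p}(X) \longrightarrow A_{v'}^{p}(X)\|.$$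
   Context: $\mathbb{D}$ is the open unit disc of $\mathbb{C}$ and $dA$ is the normalized area measure on $\mathbb{D}$. A weight is a strictly positive bounded continuous function $v:\mathbb{D}\to\mathbb{R}^+$. For a complex Banach space $X$, $p\ge 1$ and a weight $v$: - $A_v^p(X)$ is the space of analytic $f:\mathbb{D}\to X$ with $\|f\|_{A_v^p(X)}=\left(\int_{\mathbb{D}}\|f(z)\|_X^p\, v(z)\,dA(z)\right)^{1/p}<\infty$, and $A_v^p=A_v^p(\mathbb{C})$. - The weak space $wA_v^p(X)$ consists of the analytic $f:\mathbb{D}\to X$ for which $\|f\|_{wA_v^p(X)}=\sup_{\|x^*\|\le 1}\|x^*\circ f\|_{A_v^p}$ is finite, where $x^*$ ranges over the closed unit ball of the dual space $X^*$. $\|uC_\varphi:wA_v^p(X)\to A_{v'}^p(X)\|$ denotes the operator norm $\sup\{\|uC_\varphi f\|_{A_{v'}^p(X)}:\ f\in wA_v^p(X),\ \|f\|_{wA_v^p(X)}\le 1\}\in[0,\infty]$, where $\|g\|_{A_{v'}^p(X)}$ is given by the defining integral and equals $\infty$ if $g\notin A_{v'}^p(X)$; the integral in the claim may also be $\infty$, so in particular one side is finite if and only if the other is. *)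

(* Defs.v *)
From HB Require Import structures.
From mathcomp Require Import all_boot all_order all_algebra.
From mathcomp Require Import complex.
From mathcomp Require Import all_classical all_reals all_analysis.
Import Order.TTheory GRing.Theory Num.Theory.
Import numFieldNormedType.Exports.

Set Implicit Arguments.
Unset Strict Implicit.
Unset Printing Implicit Defensive.

Local Open Scope classical_set_scope.
Local Open Scope ring_scope.
Local Open Scope complex_scope.

(* The scalar field is [R[i]], so norms take their values in [R[i]] (they are
   nonnegative reals there); [rnorm] is the same norm with values in [R]. *)
Definition rnorm (R : realType) (X : normedModType R[i]) (x : X) : R :=
  complex.Re `|x|.

Definition disc (R : realType) : set R[i] := [set z | `|z| < 1].

(* [1 / pi] times two-dimensional Lebesgue measure, with [R[i]] identified with
   [R * R]; the total mass of the disc is 1. *)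
Definition disc_integral (R : realType) (g : R[i] -> \bar R) : \bar R :=
  ((pi^-1)%:E *
   \int[(@lebesgue_measure R \x @lebesgue_measure R)%E]_(xy in
       [set xy : R * R | disc (xy.1 +i* xy.2)]) g (xy.1 +i* xy.2))%E.

(* Functions on the disc are represented by total functions on [R[i]] whose
   values outside the disc are irrelevant.  Over the field [R[i]], [derivable]
   in the direction [1] is complex differentiability in norm. *)
Definition analytic (R : realType) (X : normedModType R[i]) (f : R[i] -> X) : Prop :=
  forall z, disc z -> derivable (f : R[i]^o -> X) z 1.

Definition weight (R : realType) (v : R[i] -> R) : Prop :=
  [/\ forall z, disc z -> 0 < v z,
      exists M : R, forall z, disc z -> v z <= M
    & forall z : R[i]^o, disc z -> {for z, continuous (v : R[i]^o -> R)}].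

Definition A_norm (R : realType) (X : normedModType R[i]) (p : R)
    (v : R[i] -> R) (f : R[i] -> X) : \bar R :=
  (disc_integral (fun z => (rnorm (f z) `^ p * v z)%:E) `^ p^-1)%E.

Definition dual_norm (R : realType) (X : normedModType R[i])
    (xs : X -> R[i]^o) : \bar R :=
  ereal_sup [set (rnorm (xs x))%:E | x in [set x | rnorm x <= 1]].

Definition dual_ball (R : realType) (X : normedModType R[i]) :
    set {linear X -> R[i]^o} :=
  [set xs | continuous xs /\ (dual_norm xs <= 1)%E].

Definition wA_norm (R : realType) (X : normedModType R[i]) (p : R)
    (v : R[i] -> R) (f : R[i] -> X) : \bar R :=
  ereal_sup [set A_norm p v (xs \o f) | xs in @dual_ball R X].

Definition wA (R : realType) (X : normedModType R[i]) (p : R)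
    (v : R[i] -> R) : set (R[i] -> X) :=
  [set f | analytic f /\ (wA_norm p v f < +oo)%E].

Definition wcomp (R : realType) (X : normedModType R[i]) (u phi : R[i] -> R[i])
    (f : R[i] -> X) : R[i] -> X :=
  fun z => u z *: f (phi z).

(* The integral formula [A_norm] takes the value [+oo] on analytic functions
   that are not in [A_{v'}^p(X)]. *)
Definition wcomp_norm (R : realType) (X : normedModType R[i]) (p : R)
    (v v' : R[i] -> R) (u phi : R[i] -> R[i]) : \bar R :=
  ereal_sup [set A_norm p v' (wcomp u phi f) |
             f in [set f | @wA R X p v f /\ (wA_norm p v f <= 1)%E]].

Definition finite_dimensional (R : realType) (X : normedModType R[i]) : Prop :=
  exists (n : nat) (e : 'I_n -> X),
    forall x : X, exists a : 'I_n -> R[i], x = \sum_(i < n) a i *: e i.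

(* Main.v *)
(* Upper estimate for the operator norm. Since mu has no zeros, there is an analytic h with
   |h|^p = v. For f in the unit ball of wA_v^p(X) and |x*| <= 1, the sub-mean value property of
   |(x* o f) h|^p and the Hahn-Banach theorem give |f(w)|^p <= C / ((1 - |w|^2)^2 v(w)).
   Lower estimate. On the dyadic scales eta = 2^-m, m < M, place points w_j on a grid of step
   comparable to eta and put k_j(z) = eta^(6 - 2/p) / (1 - conj(w_j) z)^6. By a Schur test,
   sum |b_j|^p <= 1 implies that sum b_j k_j is bounded in A^p, while each w with
   1 - |w| > 2 2^-M has some j with |k_j(w)|^p >= c (1 - |w|^2)^-2. The Dvoretzky-Rogers lemma
   gives vectors x_j of norm >= 2/5 with sum |x*(x_j)|^2 <= 1 for |x*| <= 1; as p >= 2, all the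
   functions h^-1 sum (+-) k_j x_j lie in a fixed ball of wA_v^p(X). Averaging
   |u (f o phi)|^p over the signs keeps each single term k_j x_j, hence bounds the integral of
   |u|^p v' / ((1 - |phi|^2)^2 v(phi)) over 1 - |phi| > 2 2^-M by a multiple of the p-th power
   of the operator norm, uniformly in M. *)
Require Import Defs.
From HB Require Import structures.
From mathcomp Require Import all_boot all_order all_algebra.
From mathcomp Require Import perm complex ring lra.
From mathcomp Require Import all_classical all_reals all_analysis measurable_realfun.
Import Order.TTheory GRing.Theory Num.Theory.
Import numFieldNormedType.Exports.
Import Normc.
Set Implicit Arguments.
Unset Strict Implicit.
Unset Printing Implicit Defensive.
Local Open Scope classical_set_scope.
Local Open Scope ring_scope.
Local Open Scope complex_scope.

Local Notation area R := (@lebesgue_measure R \x @lebesgue_measure R)%E (only parsing).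
Local Notation plane R := (measurableTypeR R * measurableTypeR R)%type (only parsing).

(** For scalar functions the extremal function for evaluation at w depends on w, and no such lower
    bound can hold: the identity has norm 1 but an infinite integral. In infinite dimension one
    random function is nearly extremal at all w at once: vectors of norm at least 2/5 keep every
    kernel visible in norm, while a single functional sees them only as a square summable sequence,
    and p >= 2 turns this into the l^p coefficients that the kernel estimate allows. Hence every
    bound must be uniform in the number of kernels, which grows with M. The power 6 in the kernels
    is three squares: two become bumps in the two coordinates, summable over a grid and integrable
    by Fubini, and the third gives decay across scales. The Schur weights are tuned to leave the
    integrable boundary singularity (1 - |z|)^(-1/2); adding 2^-M to 1 - |z| keeps it continuous.
    Function theory is done with real integrals over sides of rectangles, through Im(f dz) alone. *)

Lemma normr_rnorm (R : realType) (X : normedModType R[i]) (x : X) :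
  `|x| = (rnorm x)%:C.
Proof. by rewrite /rnorm RRe_real ?normr_real. Qed.

Lemma rnorm_ge0 (R : realType) (X : normedModType R[i]) (x : X) : 0 <= rnorm x.
Proof. by rewrite -lecR -normr_rnorm normr_ge0. Qed.

Lemma rnorm0 (R : realType) (X : normedModType R[i]) : rnorm (0 : X) = 0.
Proof. by rewrite /rnorm normr0. Qed.

Lemma rnorm_eq0 (R : realType) (X : normedModType R[i]) (x : X) :
  (rnorm x == 0) = (x == 0).
Proof.
by rewrite -[x == 0]normr_eq0 normr_rnorm -(inj_eq (@complexI R)).
Qed.

Lemma rnormN (R : realType) (X : normedModType R[i]) (x : X) : rnorm (- x) = rnorm x.
Proof. by rewrite /rnorm normrN. Qed.

Lemma rnormD (R : realType) (X : normedModType R[i]) (x y : X) :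
  rnorm (x + y) <= rnorm x + rnorm y.
Proof. by rewrite -lecR rmorphD/= -!normr_rnorm ler_normD. Qed.

Lemma rnorm_sum (R : realType) (X : normedModType R[i]) (I : Type) (r : seq I)
    (P : pred I) (F : I -> X) :
  rnorm (\sum_(i <- r | P i) F i) <= \sum_(i <- r | P i) rnorm (F i).
Proof.
rewrite -lecR rmorph_sum/= -normr_rnorm (eq_bigr (fun i => `|F i|)).
  exact: ler_norm_sum.
by move=> i _; rewrite normr_rnorm.
Qed.

Lemma rnormB (R : realType) (X : normedModType R[i]) (x y : X) :
  rnorm (x - y) = rnorm (y - x).
Proof. by rewrite -rnormN opprB. Qed.

Lemma rnormc (R : realType) (z : R[i]) : rnorm (z : R[i]^o) = normc z.
Proof. by []. Qed.

Lemma rnormZ (R : realType) (X : normedModType R[i]) (a : R[i]) (x : X) :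
  rnorm (a *: x) = normc a * rnorm x.
Proof.
by apply: (@complexI R); rewrite rmorphM/= -!normr_rnorm normrZ.
Qed.

Lemma normrc (R : realType) (z : R[i]) : `|z| = (normc z)%:C.
Proof. by case: z. Qed.

Lemma normc_ge0 (R : realType) (z : R[i]) : 0 <= normc z.
Proof. by rewrite -rnormc rnorm_ge0. Qed.

Lemma normc_real (R : realType) (x : R) : normc x%:C = `|x|.
Proof. by rewrite /= expr0n addr0 sqrtr_sqr. Qed.

Lemma normc_Re (R : realType) (z : R[i]) : `|complex.Re z| <= normc z.
Proof. by rewrite -lecR -normrc normc_ge_Re. Qed.

Lemma normc_sqr (R : realType) (z : R[i]) :
  normc z ^+ 2 = complex.Re z ^+ 2 + complex.Im z ^+ 2.
Proof. by case: z => a b /=; rewrite sqr_sqrtr// addr_ge0// sqr_ge0. Qed.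

Lemma normc_Im (R : realType) (z : R[i]) : `|complex.Im z| <= normc z.
Proof.
rewrite -(@ler_pXn2r _ 2)// ?nnegrE ?normc_ge0// normc_sqr real_normK ?num_real//.
by rewrite lerDr sqr_ge0.
Qed.

Lemma normc_ReIm (R : realType) (z : R[i]) :
  normc z <= `|complex.Re z| + `|complex.Im z|.
Proof.
rewrite -(@ler_pXn2r _ 2)// ?nnegrE ?normc_ge0 ?addr_ge0// normc_sqr.
rewrite sqrrD !real_normK ?num_real// -addrA addrCA lerDr.
by rewrite mulrn_wge0// mulr_ge0.
Qed.

Lemma discE (R : realType) (z : R[i]) : disc z <-> normc z < 1.
Proof. by rewrite /disc/= normrc -(ltcR (normc z) 1). Qed.

Lemma normcX (R : realType) (x : R[i]) n : normc (x ^+ n) = normc x ^+ n.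
Proof. by elim: n => [|n IH]; rewrite ?expr0 ?normc1// !exprS normcM IH. Qed.

(** * Complex derivatives and measurability by real epsilons and deltas *)

Definition has_cderiv (R : realType) (X : normedModType R[i])
    (f : R[i] -> X) (z : R[i]) (d : X) : Prop :=
  forall e : R, 0 < e -> exists2 r : R, 0 < r &
    forall h : R[i], normc h < r -> rnorm (f (z + h) - f z - h *: d) <= e * normc h.

Lemma nbhs_normc (R : realType) (z : R[i]) (P : set R[i]) :
  nbhs (z : R[i]^o) P <-> exists2 r : R, 0 < r & forall h, normc h < r -> P (z + h).
Proof.
split.
  move/(@nbhs_ballP R[i] R[i]^o) => [e /= e0 H].
  have er : e = (complex.Re e)%:C by rewrite RRe_real// gtr0_real.
  exists (complex.Re e); first by move: e0; rewrite er ltcR.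
  move=> h hr; apply: H; rewrite -ball_normE/= opprD addrA subrr sub0r normrN.
  by rewrite normrc er ltcR.
move=> [r r0 H]; apply/(@nbhs_ballP R[i] R[i]^o); exists r%:C => /=; first by rewrite ltcR.
move=> w; rewrite -ball_normE/= normrc ltcR => wr.
by rewrite -(subrK z w) addrC; apply: H; rewrite -rnormc rnormB.
Qed.

Lemma has_cderivP (R : realType) (X : normedModType R[i]) (f : R[i] -> X) (z : R[i]) :
  derivable (f : R[i]^o -> X) z 1 <-> exists d, has_cderiv f z d.
Proof.
split.
  move=> /cvg_ex[d /cvgrPdist_le H]; exists d => e e0.
  have /H : 0 < e%:C :> R[i] by rewrite ltcR.
  rewrite near_withinE => /nbhs_normc[r r0 Hr]; exists r => // h hr.
  have [->|h0] := eqVneq h 0.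
    by rewrite addr0 subrr scale0r subr0 rnorm0 normc0 mulr0.
  have := Hr _ hr; rewrite add0r => /(_ h0).
  rewrite normr_rnorm lecR => le.
  rewrite -(scalerKV h0 (f (z + h) - f z)) -scalerBr rnormZ mulrC ler_wpM2r ?normc_ge0//.
  by move: le; rewrite rnormB -[h%:A]/(h * 1) mulr1 /= [h + z]addrC.
move=> [d H]; apply/cvg_ex; exists d; apply/cvgrPdist_le => e e0.
have er : e = (complex.Re e)%:C by rewrite RRe_real// gtr0_real.
have /H[r r0 Hr] : 0 < complex.Re e by move: e0; rewrite er ltcR.
rewrite near_withinE; apply/nbhs_normc; exists r => // h hr; rewrite add0r => h0.
rewrite er normr_rnorm lecR rnormB -[h%:A]/(h * 1) mulr1 /= [h + z]addrC.
rewrite -(@ler_pM2l _ (normc h)); last first.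
  by rewrite lt_def normc_ge0 andbT -rnormc rnorm_eq0.
by rewrite -rnormZ scalerBr scalerKV// mulrC Hr.
Qed.

(** Measurability is for the product sigma-algebra, so U is written as a countable union of boxes:
    at a point with room r, a rational radius d < r / 2 and a rational centre within d give a box
    that contains the point and lies in U. *)
Lemma open_box_measurable (R : realType) (U : set (R * R)) :
  (forall x, U x -> exists2 r : R, 0 < r &
     forall y, `|y.1 - x.1| < r -> `|y.2 - x.2| < r -> U y) ->
  measurable (U : set (plane R)).
Proof.
move=> HU.
pose box (q : rat * rat * rat) : set (R * R) :=
  `]ratr q.1.1 - ratr q.2, ratr q.1.1 + ratr q.2[%classic `*`
  `]ratr q.1.2 - ratr q.2, ratr q.1.2 + ratr q.2[%classic.
have -> : U = \bigcup_(q : rat * rat * rat) (if `[<box q `<=` U>] then box q else set0).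
  apply/seteqP; split=> [x Ux|x [q _]]; last by case: asboolP => // sub /sub.
  have [r r0 Hr] := HU _ Ux.
  have : 0 < r / 2 by rewrite divr_gt0.
  move=> /rat_in_itvoo[d /[!in_itv]/= /andP[d0 dr]].
  have near1 (t : R) : exists q : rat, `|t - ratr q| < ratr d.
    have : t - ratr d < t + ratr d by rewrite ltrD2l gtrN.
    move=> /rat_in_itvoo[q /[!in_itv]/= qt]; exists q.
    by rewrite distrC ltr_distl.
  have [q1 Hq1] := near1 x.1; have [q2 Hq2] := near1 x.2.
  exists (q1, q2, d) => //; case: asboolP => [_|[]].
    by split; rewrite /= in_itv/= -ltr_distl.
  move=> y [/=]; rewrite !in_itv/= -!ltr_distl => H1 H2.
  have tri (a b c : R) : `|a - b| < ratr d -> `|c - b| < ratr d -> `|a - c| < r.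
    move=> ab cb; rewrite (le_lt_trans (ler_distD b _ _))// [`|b - c|]distrC.
    by rewrite (splitr r) ltrD// (lt_trans _ dr).
  by apply: Hr; [exact: tri H1 Hq1|exact: tri H2 Hq2].
apply: countable_bigcupT_measurable => // q; case: ifP => _ //.
by apply: measurableX.
Qed.

Lemma continuous2_measurable (R : realType) (D : set (R * R)) (F : R * R -> R) :
  (forall x, D x -> exists2 r : R, 0 < r &
     forall y, `|y.1 - x.1| < r -> `|y.2 - x.2| < r -> D y) ->
  (forall x, D x -> forall e, 0 < e -> exists2 r : R, 0 < r &
     forall y, `|y.1 - x.1| < r -> `|y.2 - x.2| < r -> `|F y - F x| < e) ->
  measurable_fun (D : set (plane R)) F.
Proof.
move=> oD cF; apply: (measurability _ (RGenOInfty.measurableE R)).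
move=> _ [_ [a ->] <-]; apply: open_box_measurable => x [Dx].
rewrite /= in_itv/= andbT => ax.
have [r r0 Hr] := oD _ Dx.
have [|s s0 Hs] := cF _ Dx (F x - a); first by rewrite subr_gt0.
exists (Num.min r s); first by rewrite lt_min r0 s0.
move=> y; rewrite !lt_min => /andP[y1r y1s] /andP[y2r y2s]; split; first exact: Hr.
have := Hs _ y1s y2s; rewrite ltr_distl subKr => /andP[+ _].
by rewrite /= in_itv/= andbT.
Qed.

Lemma normc_pair (R : realType) (x y a b : R) :
  normc ((x +i* y) - (a +i* b)) <= `|x - a| + `|y - b|.
Proof. exact: normc_ReIm. Qed.

Definition discRR (R : realType) : set (plane R) :=
  [set xy | disc (xy.1 +i* xy.2)].

Lemma discRR_open (R : realType) (x : R * R) : discRR x ->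
  exists2 r : R, 0 < r & forall y, `|y.1 - x.1| < r -> `|y.2 - x.2| < r -> discRR y.
Proof.
move=> /discE Dx; set n := normc _ in Dx; exists ((1 - n) / 2).
  by rewrite divr_gt0// subr_gt0.
move=> y H1 H2; apply/discE.
rewrite -(subrK (x.1 +i* x.2) (y.1 +i* y.2)).
rewrite -rnormc (le_lt_trans (rnormD _ _))// !rnormc -/n -ltrBrDr.
by rewrite (le_lt_trans (normc_pair _ _ _ _))// [ltRHS]splitr ltrD.
Qed.

Lemma discRR_measurable (R : realType) : measurable (@discRR R).
Proof. by apply: open_box_measurable => x; exact: discRR_open. Qed.

Definition disc_continuous (R : realType) (F : R[i] -> R) : Prop :=
  forall z, disc z -> forall e, 0 < e -> exists2 r : R, 0 < r &
    forall h, normc h < r -> `|F (z + h) - F z| < e.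

Lemma disc_continuous_measurable (R : realType) (F : R[i] -> R) :
  disc_continuous F ->
  measurable_fun (@discRR R) (fun xy => F (xy.1 +i* xy.2)).
Proof.
move=> cF; apply: continuous2_measurable => [x|x Dx e e0]; first exact: discRR_open.
have [r r0 Hr] := cF _ Dx _ e0; exists (r / 2); first by rewrite divr_gt0.
move=> y H1 H2; have := Hr (y.1 +i* y.2 - (x.1 +i* x.2)).
rewrite [x.1 +i* x.2 + _]addrC subrK; apply.
by rewrite (le_lt_trans (normc_pair _ _ _ _))// (splitr r) ltrD.
Qed.

(** * Goursat's theorem for rectangles *)

Definition segint (R : realType) (f : R -> R) (a b : R) : R :=
  \int[lebesgue_measure]_(x in `[a, b]) f x.

Lemma segment_integrable (R : realType) (f : R -> R) (a b : R) :
  (forall x, a <= x <= b -> {for x, continuous f}) ->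
  (@lebesgue_measure R).-integrable `[a, b] (EFin \o f).
Proof.
move=> cf; apply: continuous_compact_integrable; first exact: segment_compact.
apply: continuous_in_subspaceT => x; rewrite inE/= in_itv/=; exact: cf.
Qed.

Lemma segint_cat (R : realType) (f : R -> R) (a m b : R) :
  a <= m <= b -> (forall x, a <= x <= b -> {for x, continuous f}) ->
  segint f a b = segint f a m + segint f m b.
Proof.
move=> /andP[am mb] cf; have fi := segment_integrable cf.
apply/eqP; rewrite /segint addrC -subr_eq; apply/eqP.
rewrite Rintegral_itvB ?bnd_simp// Rintegral_itv_obnd_cbnd//.
apply: integrableS fi => //; apply: subset_itvr; by rewrite bnd_simp.
Qed.

Lemma lebesgue_segment (R : realType) (a b : R) : a <= b ->
  fine (lebesgue_measure `[a, b]%classic) = b - a.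
Proof.
by move=> ab; rewrite lebesgue_measure_itv/= lte_fin; case: ltgtP ab => //= ->; rewrite subrr.
Qed.

Lemma segint_cst (R : realType) (k a b : R) : a <= b -> segint (cst k) a b = k * (b - a).
Proof. by move=> ab; rewrite /segint Rintegral_cst// lebesgue_segment. Qed.

Lemma le_segint (R : realType) (f g : R -> R) (a b : R) :
  (forall x, a <= x <= b -> {for x, continuous f}) ->
  (forall x, a <= x <= b -> {for x, continuous g}) ->
  (forall x, a <= x <= b -> f x <= g x) -> segint f a b <= segint g a b.
Proof.
move=> cf cg fg; by apply: le_Rintegral => //; exact: segment_integrable.
Qed.

Lemma segint_sub (R : realType) (f g : R -> R) (a b : R) :
  (forall x, a <= x <= b -> {for x, continuous f}) ->
  (forall x, a <= x <= b -> {for x, continuous g}) ->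
  segint (fun x => f x - g x) a b = segint f a b - segint g a b.
Proof. by move=> cf cg; rewrite /segint RintegralB//; exact: segment_integrable. Qed.

Lemma segint_diff_bound (R : realType) (f g : R -> R) (a b k e : R) : a <= b ->
  (forall x, a <= x <= b -> {for x, continuous f}) ->
  (forall x, a <= x <= b -> {for x, continuous g}) ->
  (forall x, a <= x <= b -> `|f x - g x - k| <= e) ->
  `|segint f a b - segint g a b - k * (b - a)| <= e * (b - a).
Proof.
move=> ab cf cg H; rewrite -segint_sub//.
have cfg x : a <= x <= b -> {for x, continuous (fun x => f x - g x)}.
  by move=> abx; apply: cvgB; [exact: cf|exact: cg].
have cc l x : a <= x <= b -> {for x, continuous (cst l : R -> R)}.
  by move=> _; exact: cvg_cst.
rewrite ler_distl -mulrBl -mulrDl -!segint_cst//; apply/andP; split.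
  apply: le_segint; [exact: cc|exact: cfg|move=> x /H].
  by rewrite ler_distl => /andP[].
apply: le_segint; [exact: cfg|exact: cc|move=> x /H].
by rewrite ler_distl => /andP[].
Qed.

(* [P dx + Q dy] integrated counterclockwise along the boundary of [a, b] x [c, d]. *)
Definition rectint (R : realType) (P Q : R -> R -> R) (a b c d : R) : R :=
  (segint (P^~ c) a b - segint (P^~ d) a b) + (segint (Q b) c d - segint (Q a) c d).

(* P and Q are differentiable at (x0, y0), with [P_y = Q_x]. *)
Definition closed_at (R : realType) (P Q : R -> R -> R) (x0 y0 : R) : Prop :=
  exists al be ga : R, forall e, 0 < e -> exists2 r, 0 < r & forall x y,
    `|x - x0| < r -> `|y - y0| < r ->
    `|P x y - P x0 y0 - (al * (x - x0) + ga * (y - y0))| <= e * (`|x - x0| + `|y - y0|) /\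
    `|Q x y - Q x0 y0 - (ga * (x - x0) + be * (y - y0))| <= e * (`|x - x0| + `|y - y0|).

Lemma lin_bound_continuous (R : realType) (f : R -> R) (x0 al : R) :
  (exists2 r, 0 < r & forall x, `|x - x0| < r ->
     `|f x - f x0 - al * (x - x0)| <= `|x - x0|) -> {for x0, continuous f}.
Proof.
move=> [r r0 H]; apply/cvgrPdist_lt => e e0.
have K0 : 0 < `|al| + 1 by rewrite ltr_wpDl.
near=> x.
have xr : `|x - x0| < r by rewrite distrC; near: x; exact: cvgr_dist_lt.
have : `|x - x0| < e / (`|al| + 1).
  by rewrite distrC; near: x; apply: cvgr_dist_lt => //; rewrite divr_gt0.
rewrite ltr_pdivlMr// mulrC mulrDl mul1r => He.
rewrite distrC -(subrK (al * (x - x0)) (f x - f x0)) (le_lt_trans (ler_normD _ _))//.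
by rewrite (le_lt_trans _ He)// addrC normrM lerD2l H.
Unshelve. all: by end_near. Qed.

Lemma closed_at_continuous (R : realType) (P Q : R -> R -> R) (x0 y0 : R) :
  closed_at P Q x0 y0 ->
  [/\ {for x0, continuous (P^~ y0)}, {for x0, continuous (Q^~ y0)},
      {for y0, continuous (P x0)} & {for y0, continuous (Q x0)}].
Proof.
move=> [al [be [ga]]] /(_ 1 ltr01)[r r0 H]; split.
- apply: (lin_bound_continuous (al := al)); exists r => // x xr.
  by have := H x y0 xr; rewrite subrr normr0 !mulr0 !addr0 mul1r => /(_ r0)[].
- apply: (lin_bound_continuous (al := ga)); exists r => // x xr.
  by have := H x y0 xr; rewrite subrr normr0 !mulr0 !addr0 mul1r => /(_ r0)[].
- apply: (lin_bound_continuous (al := ga)); exists r => // y yr.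
  by have := H x0 y; rewrite subrr normr0 !mulr0 !add0r mul1r => /(_ r0 yr)[].
- apply: (lin_bound_continuous (al := be)); exists r => // y yr.
  by have := H x0 y; rewrite subrr normr0 !mulr0 !add0r mul1r => /(_ r0 yr)[].
Qed.

Lemma segment_dist (R : realType) (a b r x y : R) :
  a <= x <= b -> a <= y <= b -> b - a <= r -> `|x - y| <= r.
Proof.
move=> /andP[ax xb] /andP[ay yb] abr; apply: (le_trans _ abr).
by rewrite ler_norml opprB !lerB.
Qed.

(** Opposite sides are subtracted pointwise: up to 2 e L they differ by the constant ga (c - d),
    respectively ga (b - a). Integrated over the sides these constants cancel, because the same ga
    is P_y and Q_x. *)
Lemma rectint_small (R : realType) (P Q : R -> R -> R) (a b c d x0 y0 al be ga e : R) :
  a <= b -> c <= d -> a <= x0 <= b -> c <= y0 <= d -> 0 <= e ->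
  (forall x y, a <= x <= b -> c <= y <= d -> closed_at P Q x y) ->
  (forall x y, a <= x <= b -> c <= y <= d ->
    `|P x y - P x0 y0 - (al * (x - x0) + ga * (y - y0))| <= e * (`|x - x0| + `|y - y0|) /\
    `|Q x y - Q x0 y0 - (ga * (x - x0) + be * (y - y0))| <= e * (`|x - x0| + `|y - y0|)) ->
  `|rectint P Q a b c d| <= 2 * e * ((b - a) + (d - c)) ^+ 2.
Proof.
move=> ab cd x0ab y0cd e0 cl H.
have [aI bI cI dI] : [/\ a <= a <= b, a <= b <= b, c <= c <= d & c <= d <= d].
  by rewrite !lexx ab cd.
set L := (b - a) + (d - c).
have bnd x y : a <= x <= b -> c <= y <= d -> `|x - x0| + `|y - y0| <= L.
  by move=> xI yI; apply: lerD; [exact: segment_dist xI x0ab _|exact: segment_dist yI y0cd _].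
have HP x : a <= x <= b -> `|P x c - P x d - ga * (c - d)| <= 2 * (e * L).
  move=> xI; have [H1 _] := H _ _ xI cI; have [H2 _] := H _ _ xI dI.
  have -> : P x c - P x d - ga * (c - d) =
    (P x c - P x0 y0 - (al * (x - x0) + ga * (c - y0))) -
    (P x d - P x0 y0 - (al * (x - x0) + ga * (d - y0))) by ring.
  rewrite (le_trans (ler_normB _ _))// mulr_natl mulr2n lerD//.
    by rewrite (le_trans H1)// ler_wpM2l// bnd.
  by rewrite (le_trans H2)// ler_wpM2l// bnd.
have HQ y : c <= y <= d -> `|Q b y - Q a y - ga * (b - a)| <= 2 * (e * L).
  move=> yI; have [_ H1] := H _ _ bI yI; have [_ H2] := H _ _ aI yI.
  have -> : Q b y - Q a y - ga * (b - a) =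
    (Q b y - Q x0 y0 - (ga * (b - x0) + be * (y - y0))) -
    (Q a y - Q x0 y0 - (ga * (a - x0) + be * (y - y0))) by ring.
  rewrite (le_trans (ler_normB _ _))// mulr_natl mulr2n lerD//.
    by rewrite (le_trans H1)// ler_wpM2l// bnd.
  by rewrite (le_trans H2)// ler_wpM2l// bnd.
have := segint_diff_bound ab _ _ HP; have := segint_diff_bound cd _ _ HQ.
move=> /(_ (fun y yI => let: And4 _ _ _ k := closed_at_continuous (cl b y bI yI) in k)).
move=> /(_ (fun y yI => let: And4 _ _ _ k := closed_at_continuous (cl a y aI yI) in k)) BQ.
move=> /(_ (fun x xI => let: And4 k _ _ _ := closed_at_continuous (cl x c xI cI) in k)).
move=> /(_ (fun x xI => let: And4 k _ _ _ := closed_at_continuous (cl x d xI dI) in k)) BP.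
have -> : rectint P Q a b c d =
  (segint (P^~ c) a b - segint (P^~ d) a b - ga * (c - d) * (b - a)) +
  (segint (Q b) c d - segint (Q a) c d - ga * (b - a) * (d - c)) by rewrite /rectint; ring.
rewrite (le_trans (ler_normD _ _))// (le_trans (lerD BP BQ))//.
by rewrite -mulrDr -/L expr2 !mulrA.
Qed.

Lemma rectint_catx (R : realType) (P Q : R -> R -> R) (a m b c d : R) :
  a <= m <= b -> (forall x, a <= x <= b -> {for x, continuous (P^~ c)}) ->
  (forall x, a <= x <= b -> {for x, continuous (P^~ d)}) ->
  rectint P Q a b c d = rectint P Q a m c d + rectint P Q m b c d.
Proof. by move=> mI cc cd; rewrite /rectint (segint_cat mI cc) (segint_cat mI cd); ring. Qed.

Lemma rectint_caty (R : realType) (P Q : R -> R -> R) (a b c m d : R) :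
  c <= m <= d -> (forall y, c <= y <= d -> {for y, continuous (Q a)}) ->
  (forall y, c <= y <= d -> {for y, continuous (Q b)}) ->
  rectint P Q a b c d = rectint P Q a b c m + rectint P Q a b m d.
Proof. by move=> mI cc cd; rewrite /rectint (segint_cat mI cc) (segint_cat mI cd); ring. Qed.

Lemma nested_intervals (R : realType) (u v : nat -> R) :
  (forall n, u n <= u n.+1) -> (forall n, v n.+1 <= v n) -> (forall n, u n <= v n) ->
  exists x, forall n, u n <= x <= v n.
Proof.
move=> uS vS uv.
have um m k : u m <= u (m + k)%N.
  by elim: k => [|k IH]; rewrite ?addn0// addnS (le_trans IH).
have vm m k : v (m + k)%N <= v m.
  by elim: k => [|k IH]; rewrite ?addn0// addnS (le_trans _ IH).
have umv m n : u m <= v n.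
  by rewrite (le_trans (um m n))// (le_trans (uv _))// addnC.
exists (sup (range u)) => n; apply/andP; split.
  by apply: ub_le_sup; [exists (v 0%N) => _ [m _ <-]; exact: umv|exists n].
by apply: ge_sup; [exists (u 0%N), 0%N|move=> _ [m _ <-]; exact: umv].
Qed.

Lemma exp2_unbounded (R : realType) (L r : R) : 0 < r -> exists n, L < r * 2 ^+ n.
Proof.
move=> r0; have [n Hn] : exists n, L / r < n%:R.
  by exists (Num.bound `|L / r|); rewrite (le_lt_trans (ler_norm _))// archi_boundP.
exists n; rewrite mulrC -ltr_pdivrMr// (lt_le_trans Hn)// -natrX ler_nat.
by rewrite ltnW// ltn_expl.
Qed.

Definition half (R : realType) (i : bool) (I : R * R) : R * R :=
  if i then ((I.1 + I.2) / 2, I.2) else (I.1, (I.1 + I.2) / 2).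

Lemma halfP (R : realType) (i : bool) (I : R * R) : I.1 <= I.2 ->
  [/\ I.1 <= (half i I).1, (half i I).1 <= (half i I).2, (half i I).2 <= I.2
    & (half i I).2 - (half i I).1 = (I.2 - I.1) / 2].
Proof. by case: i; case: I => a b /= ab; split; lra. Qed.

Lemma goursat (R : realType) (P Q : R -> R -> R) (a b c d : R) :
  a <= b -> c <= d ->
  (forall x y, a <= x <= b -> c <= y <= d -> closed_at P Q x y) ->
  rectint P Q a b c d = 0.
Proof.
move=> ab cd cl; apply: contrapT => /eqP ne0.
pose J (S : (R * R) * (R * R)) := `|rectint P Q S.1.1 S.1.2 S.2.1 S.2.2|.
pose quarter (ij : bool * bool) (S : (R * R) * (R * R)) := (half ij.1 S.1, half ij.2 S.2).
pose ok (S : (R * R) * (R * R)) :=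
  [/\ a <= S.1.1, S.1.1 <= S.1.2, S.1.2 <= b & [/\ c <= S.2.1, S.2.1 <= S.2.2 & S.2.2 <= d]].
(* The existential stands outside [ok S], so that [choice] gives a total selection of quarters. If
   all four quarters had less than a quarter of the integral, their sum would be too small. *)
have step S : exists ij, ok S -> J S <= 4 * J (quarter ij S).
  apply/not_existsP => H.
  have okS : ok S by apply: contrapT => nok; apply: (H (true, true)).
  have {}H ij : 4 * J (quarter ij S) < J S.
    by rewrite ltNge; apply/negP => le; apply: (H ij).
  case: okS => a1 a12 b2 [c1 c12 d2].
  have cl' x y : S.1.1 <= x <= S.1.2 -> S.2.1 <= y <= S.2.2 -> closed_at P Q x y.
    move=> /andP[? ?] /andP[? ?]; apply: cl; apply/andP; split.
    - exact: le_trans a1 _.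
    - exact: le_trans b2.
    - exact: le_trans c1 _.
    - exact: le_trans d2.
  move: S H a1 a12 b2 c1 c12 d2 cl' => [[a' b'] [c' d']] H /= a1 a12 b2 c1 c12 d2 cl'.
  set m := (a' + b') / 2; set k := (c' + d') / 2.
  have mI : a' <= m <= b' by apply/andP; rewrite /m; split; lra.
  have kI : c' <= k <= d' by apply/andP; rewrite /k; split; lra.
  have := H (true, true); have := H (true, false).
  have := H (false, true); have := H (false, false).
  rewrite /J/= -/m -/k.
  have E1 y : c' <= y <= d' -> forall x, a' <= x <= b' -> {for x, continuous (P^~ y)}.
    by move=> yI x xI; case: (closed_at_continuous (cl' x y xI yI)).
  have E2 x : a' <= x <= b' -> forall y, c' <= y <= d' -> {for y, continuous (Q x)}.
    by move=> xI y yI; case: (closed_at_continuous (cl' x y xI yI)).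
  have [aI bI cI dI] : [/\ a' <= a' <= b', a' <= b' <= b', c' <= c' <= d' & c' <= d' <= d'].
    by rewrite !lexx a12 c12.
  rewrite (rectint_catx Q mI (E1 _ cI) (E1 _ dI)).
  rewrite (rectint_caty P kI (E2 _ aI) (E2 _ mI)) (rectint_caty P kI (E2 _ mI) (E2 _ bI)).
  set w := rectint _ _ a' m c' k; set x := rectint _ _ a' m k d'.
  set y := rectint _ _ m b' c' k; set z := rectint _ _ m b' k d'.
  have : `|w + x + (y + z)| <= `|w| + `|x| + (`|y| + `|z|).
    by rewrite (le_trans (ler_normD _ _))// lerD// ler_normD.
  by lra.
have [s Hs] := choice step.
pose T n := iter n (fun S => quarter (s S) S) ((a, b), (c, d)).
have TS n : T n.+1 = quarter (s (T n)) (T n) by [].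
have okT n : ok (T n).
  elim: n => [|n [a1 a12 b2 [c1 c12 d2]]]; first by split.
  rewrite TS /quarter; have [h1 h2 h3 _] := halfP (s (T n)).1 a12.
  have [k1 k2 k3 _] := halfP (s (T n)).2 c12.
  split => //=; [exact: le_trans h1|exact: le_trans b2|split => //=].
    exact: le_trans k1.
  exact: le_trans d2.
have JT n : J (T 0%N) <= 4 ^+ n * J (T n).
  elim: n => [|n IH]; first by rewrite expr0 mul1r.
  rewrite (le_trans IH)// exprS [4 * _]mulrC -mulrA ler_wpM2l ?exprn_ge0//.
  exact: Hs.
have len n : (T n).1.2 - (T n).1.1 = (b - a) / 2 ^+ n /\ (T n).2.2 - (T n).2.1 = (d - c) / 2 ^+ n.
  elim: n => [|n [IH1 IH2]]; first by rewrite expr0 !divr1.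
  have [a1 a12 b2 [c1 c12 d2]] := okT n; rewrite TS /quarter.
  have [_ _ _ ->] := halfP (s (T n)).1 a12; have [_ _ _ ->] := halfP (s (T n)).2 c12.
  by rewrite IH1 IH2 exprSr !invfM !mulrA.
have [x0 Hx0] : exists x, forall n, (T n).1.1 <= x <= (T n).1.2.
  by apply: nested_intervals => n; have [a1 a12 b2 _] := okT n; rewrite ?TS //;
    have [] := halfP (s (T n)).1 a12.
have [y0 Hy0] : exists x, forall n, (T n).2.1 <= x <= (T n).2.2.
  by apply: nested_intervals => n; have [_ _ _ [a1 a12 b2]] := okT n; rewrite ?TS //;
    have [] := halfP (s (T n)).2 a12.
have [al [be [ga Hcl]]] := cl _ _ (Hx0 0%N) (Hy0 0%N).
set L := (b - a) + (d - c).
have L0 : 0 <= L by rewrite addr_ge0 ?subr_ge0.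
have J0 : 0 < J (T 0%N) by rewrite normr_gt0.
(* For this e, 4^n times the bound of [rectint_small] on the n-th rectangle is 2 e L^2 < J (T 0);
   the + 1 keeps the denominator positive when L = 0. *)
have e0 : 0 < J (T 0%N) / (4 * (L ^+ 2 + 1)).
  by rewrite divr_gt0// mulr_gt0// ltr_wpDl// sqr_ge0.
have [r r0 Hr] := Hcl _ e0.
have [n Hn] := exp2_unbounded L r0.
have n0 : 0 < 2 ^+ n :> R by rewrite exprn_gt0.
have [a1 a12 b2 [c1 c12 d2]] := okT n; have [l1 l2] := len n.
have Lr : L / 2 ^+ n < r by rewrite ltr_pdivrMr.
have lx : (b - a) / 2 ^+ n <= L / 2 ^+ n.
  by rewrite ler_pM2r ?invr_gt0// lerDl subr_ge0.
have ly : (d - c) / 2 ^+ n <= L / 2 ^+ n.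
  by rewrite ler_pM2r ?invr_gt0// lerDr subr_ge0.
have near1 (u v t t0 : R) : u <= t <= v -> u <= t0 <= v -> v - u <= L / 2 ^+ n -> `|t - t0| < r.
  by move=> tI t0I uv; exact: le_lt_trans (segment_dist tI t0I uv) Lr.
have clT x y : (T n).1.1 <= x <= (T n).1.2 -> (T n).2.1 <= y <= (T n).2.2 -> closed_at P Q x y.
  move=> /andP[? ?] /andP[? ?]; apply: cl; apply/andP; split.
  - exact: le_trans a1 _.
  - exact: le_trans b2.
  - exact: le_trans c1 _.
  - exact: le_trans d2.
have := @rectint_small _ P Q _ _ _ _ _ _ al be ga _ a12 c12 (Hx0 n) (Hy0 n) (ltW e0) clT.
rewrite -/(J _) l1 l2 -mulrDl -/L => JTn'.
have {JTn'}JTn : J (T n) <= 2 * (J (T 0%N) / (4 * (L ^+ 2 + 1))) * (L / 2 ^+ n) ^+ 2.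
  apply: JTn'.
  move=> x y xI yI; apply: Hr.
  - by apply: near1 xI (Hx0 n) _; rewrite l1.
  - by apply: near1 yI (Hy0 n) _; rewrite l2.
have := le_trans (JT n) (ler_wpM2l (exprn_ge0 n (ler0n _ 4)) JTn).
rewrite leNgt => /negP; apply.
have -> : 4 ^+ n * (2 * (J (T 0%N) / (4 * (L ^+ 2 + 1))) * (L / 2 ^+ n) ^+ 2) =
  J (T 0%N) * (L ^+ 2 / (2 * (L ^+ 2 + 1))).
  have -> : 4 ^+ n = (2 ^+ n) ^+ 2 :> R.
    by rewrite -exprM mulnC exprM; congr (_ ^+ _); rewrite -natrX.
  by field; rewrite (gt_eqF n0) andbT gt_eqF// ltr_wpDl// sqr_ge0.
rewrite gtr_pMr// ltr_pdivrMr ?mul1r; last by rewrite mulr_gt0// ltr_wpDl// sqr_ge0.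
by move: (sqr_ge0 L); clear; lra.
Qed.

(** Outside the inner rectangle lie a left, a right, a bottom and a top strip that avoid (x0, y0);
    Goursat's theorem removes each of them. *)
Lemma rectint_shrink (R : realType) (P Q : R -> R -> R) (a b c d x0 y0 x1 x2 y1 y2 : R) :
  a <= x1 -> x1 < x0 -> x0 < x2 -> x2 <= b -> c <= y1 -> y1 < y0 -> y0 < y2 -> y2 <= d ->
  (forall x y, a <= x <= b -> c <= y <= d -> (x, y) != (x0, y0) -> closed_at P Q x y) ->
  rectint P Q a b c d = rectint P Q x1 x2 y1 y2.
Proof.
move=> ax xl xr xb cy yl yr yd cl.
have ne1 x y : x != x0 -> (x, y) != (x0, y0) by apply: contra_neq => -[].
have ne2 x y : y != y0 -> (x, y) != (x0, y0) by apply: contra_neq => -[].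
have clx y : c <= y <= d -> y != y0 -> forall x, a <= x <= b -> {for x, continuous (P^~ y)}.
  by move=> yI ne x xI; case: (closed_at_continuous (cl x y xI yI (ne2 _ _ ne))).
have cly x : a <= x <= b -> x != x0 -> forall y, c <= y <= d -> {for y, continuous (Q x)}.
  by move=> xI ne y yI; case: (closed_at_continuous (cl x y xI yI (ne1 _ _ ne))).
have [x12 y12] : x1 < x2 /\ y1 < y2 by split; [exact: lt_trans xr|exact: lt_trans yr].
have [x1b y1d] : x1 <= b /\ y1 <= d.
  by split; [exact: le_trans (ltW x12) xb|exact: le_trans (ltW y12) yd].
have [ax2 cy2] : a <= x2 /\ c <= y2.
  by split; [exact: le_trans ax (ltW x12)|exact: le_trans cy (ltW y12)].
have [ab cd] : a <= b /\ c <= d by split; [exact: le_trans xb|exact: le_trans yd].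
have subx x : x1 <= x <= x2 -> a <= x <= b.
  by move=> /andP[h1 h2]; rewrite (le_trans ax h1) (le_trans h2 xb).
have suby y : y1 <= y <= y2 -> c <= y <= d.
  by move=> /andP[h1 h2]; rewrite (le_trans cy h1) (le_trans h2 yd).
have ltx x y : x <= x1 -> (x, y) != (x0, y0) by move=> h; rewrite ne1 ?lt_eqF// (le_lt_trans h).
have gtx x y : x2 <= x -> (x, y) != (x0, y0) by move=> h; rewrite ne1 ?gt_eqF// (lt_le_trans xr).
have lty x y : y <= y1 -> (x, y) != (x0, y0) by move=> h; rewrite ne2 ?lt_eqF// (le_lt_trans h).
have gty x y : y2 <= y -> (x, y) != (x0, y0) by move=> h; rewrite ne2 ?gt_eqF// (lt_le_trans yr).
have cN : c != y0 by rewrite lt_eqF// (le_lt_trans cy).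
have dN : d != y0 by rewrite gt_eqF// (lt_le_trans yr).
have cI : c <= c <= d by rewrite lexx.
have dI : c <= d <= d by rewrite lexx cd.
have x1I : a <= x1 <= b by rewrite ax.
have x2I : a <= x2 <= b by rewrite ax2.
have clc := clx c cI cN; have cld := clx d dI dN.
have cl1 := cly x1 x1I (negbT (lt_eqF xl)); have cl2 := cly x2 x2I (negbT (gt_eqF xr)).
have tail x : x1 <= x <= b -> a <= x <= b by move=> /andP[h1 ->]; rewrite (le_trans ax h1).
have taily y : y1 <= y <= d -> c <= y <= d by move=> /andP[h1 ->]; rewrite (le_trans cy h1).
rewrite (rectint_catx Q x1I clc cld) goursat //; last first.
  move=> x y /andP[h1 h2] yI; apply: cl => //; last exact: ltx.
  by rewrite h1 (le_trans h2).
rewrite add0r (@rectint_catx _ P Q x1 x2 b); first last.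
- by move=> x /tail; exact: cld.
- by move=> x /tail; exact: clc.
- by rewrite ltW.
rewrite [X in _ + X]goursat //; last first.
  move=> x y /andP[h1 h2] yI; apply: cl => //; last exact: gtx.
  by rewrite h2 (le_trans ax2).
rewrite addr0 (@rectint_caty _ P Q x1 x2 c y1 d _ cl1 cl2); last by rewrite cy.
rewrite (@goursat _ P Q x1 x2 c y1 (ltW x12) cy); last first.
  move=> x y xI /andP[h1 h2]; apply: cl; [exact: subx| |exact: lty].
  by rewrite h1 (le_trans h2).
rewrite add0r (@rectint_caty _ P Q x1 x2 y1 y2 d); first last.
- by move=> y /taily; exact: cl2.
- by move=> y /taily; exact: cl1.
- by rewrite ltW.
rewrite (@goursat _ P Q x1 x2 y2 d (ltW x12) yd) ?addr0// => x y xI /andP[h1 h2].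
by apply: cl; [exact: subx|rewrite h2 (le_trans cy2)|exact: gty].
Qed.

(** A bounded singularity is harmless: after shrinking to a square of half-side s, the boundary has
    length 8 s and the integral is at most 8 s M. This serves for the difference quotient in
    [cauchy_rect], known only to be bounded near w. *)
Lemma goursat_punctured (R : realType) (P Q : R -> R -> R) (a b c d x0 y0 : R) :
  a < x0 < b -> c < y0 < d ->
  (forall x y, a <= x <= b -> c <= y <= d -> (x, y) != (x0, y0) -> closed_at P Q x y) ->
  (exists2 r, 0 < r & exists M, forall x y, `|x - x0| < r -> `|y - y0| < r ->
     (x, y) != (x0, y0) -> `|P x y| <= M /\ `|Q x y| <= M) ->
  rectint P Q a b c d = 0.
Proof.
move=> /andP[ax xb] /andP[cy yd] cl [r r0 [M HM]].
have ne1 x y : x != x0 -> (x, y) != (x0, y0) by apply: contra_neq => -[].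
have ne2 x y : y != y0 -> (x, y) != (x0, y0) by apply: contra_neq => -[].
have M0 : 0 <= M.
  have h1 : `|x0 + r / 2 - x0| < r.
    by rewrite addrAC subrr add0r gtr0_norm ?divr_gt0// ltr_pdivrMr// mulr_natr mulr2n ltrDl.
  have h2 : `|y0 - y0| < r by rewrite subrr normr0.
  have h3 : (x0 + r / 2, y0) != (x0, y0).
    by apply: ne1; rewrite -subr_eq0 addrAC subrr add0r gt_eqF ?divr_gt0.
  by have [/(le_trans (normr_ge0 _))] := HM _ _ h1 h2 h3.
apply/eqP; rewrite -normr_eq0 eq_le normr_ge0 andbT; apply/ler_addgt0Pl => e e0.
rewrite addr0.
pose s := Num.min (Num.min (Num.min (x0 - a) (b - x0)) (Num.min (y0 - c) (d - y0)))
  (Num.min (r / 2) (e / (8 * (M + 1)))).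
have [s0 [sa sb sc sd] [sr se]] : [/\ 0 < s, [/\ s <= x0 - a, s <= b - x0, s <= y0 - c & s <= d - y0]
    & s <= r / 2 /\ s <= e / (8 * (M + 1))].
  split; last by rewrite /s !ge_min !lexx !orbT.
    by rewrite /s !lt_min !subr_gt0 ax xb cy yd !divr_gt0// mulr_gt0// ltr_wpDl.
  by rewrite /s !ge_min !lexx !orbT.
move: s s0 sa sb sc sd sr se => s s0 sa sb sc sd sr se.
have {}sr : s < r by apply: (le_lt_trans sr); rewrite ltr_pdivrMr// mulr_natr mulr2n ltrDl.
have [xl xr] : x0 - s < x0 /\ x0 < x0 + s by rewrite gtrBl ltrDl.
have [yl yr] : y0 - s < y0 /\ y0 < y0 + s by rewrite gtrBl ltrDl.
have [{}sa {}sb] : a <= x0 - s /\ x0 + s <= b by rewrite lerBrDr -lerBrDl -lerBrDl.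
have [{}sc {}sd] : c <= y0 - s /\ y0 + s <= d by rewrite lerBrDr -lerBrDl -lerBrDl.
rewrite (rectint_shrink sa xl xr sb sc yl yr sd cl) /rectint.
have xlr := ltW (lt_trans xl xr); have ylr := ltW (lt_trans yl yr).
have subx x : x0 - s <= x <= x0 + s -> a <= x <= b.
  by move=> /andP[h1 h2]; rewrite (le_trans sa h1) (le_trans h2 sb).
have suby y : y0 - s <= y <= y0 + s -> c <= y <= d.
  by move=> /andP[h1 h2]; rewrite (le_trans sc h1) (le_trans h2 sd).
have sxI x : x0 - s <= x <= x0 + s -> `|x - x0| < r.
  by rewrite -ler_distl => /le_lt_trans; exact.
have syI y : y0 - s <= y <= y0 + s -> `|y - y0| < r.
  by rewrite -ler_distl => /le_lt_trans; exact.
have x1I : x0 - s <= x0 - s <= x0 + s by rewrite lexx.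
have x2I : x0 - s <= x0 + s <= x0 + s by rewrite lexx andbT.
have y1I : y0 - s <= y0 - s <= y0 + s by rewrite lexx.
have y2I : y0 - s <= y0 + s <= y0 + s by rewrite lexx andbT.
have x1N := negbT (lt_eqF xl); have x2N := negbT (gt_eqF xr).
have y1N := negbT (lt_eqF yl); have y2N := negbT (gt_eqF yr).
have cx y : y0 - s <= y <= y0 + s -> y != y0 ->
    forall x, x0 - s <= x <= x0 + s -> {for x, continuous (P^~ y)}.
  move=> /suby yI ne x /subx xI.
  by case: (closed_at_continuous (cl x y xI yI (ne2 _ _ ne))).
have cyy x : x0 - s <= x <= x0 + s -> x != x0 ->
    forall y, y0 - s <= y <= y0 + s -> {for y, continuous (Q x)}.
  move=> /subx xI ne y /suby yI.
  by case: (closed_at_continuous (cl x y xI yI (ne1 _ _ ne))).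
have BP : `|segint (P^~ (y0 - s)) (x0 - s) (x0 + s) - segint (P^~ (y0 + s)) (x0 - s) (x0 + s)
    - 0 * (x0 + s - (x0 - s))| <= 2 * M * (x0 + s - (x0 - s)).
  apply: (segint_diff_bound xlr (cx _ y1I y1N) (cx _ y2I y2N)) => x /sxI xI.
  rewrite subr0 (le_trans (ler_normB _ _))// mulr_natl mulr2n lerD//.
    by have [] := HM x (y0 - s) xI (syI _ y1I) (ne2 _ _ y1N).
  by have [] := HM x (y0 + s) xI (syI _ y2I) (ne2 _ _ y2N).
have BQ : `|segint (Q (x0 + s)) (y0 - s) (y0 + s) - segint (Q (x0 - s)) (y0 - s) (y0 + s)
    - 0 * (y0 + s - (y0 - s))| <= 2 * M * (y0 + s - (y0 - s)).
  apply: (segint_diff_bound ylr (cyy _ x2I x2N) (cyy _ x1I x1N)) => y /syI yI.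
  rewrite subr0 (le_trans (ler_normB _ _))// mulr_natl mulr2n lerD//.
    by have [] := HM (x0 + s) y (sxI _ x2I) yI (ne1 _ _ x2N).
  by have [] := HM (x0 - s) y (sxI _ x1I) yI (ne1 _ _ x1N).
move: BP BQ; rewrite !mul0r !subr0 => BP BQ.
rewrite (le_trans (ler_normD _ _))// (le_trans (lerD BP BQ))//.
move: se; rewrite ler_pdivlMr ?mulr_gt0 ?ltr_wpDl//.
by clear -s0 M0 => se; lra.
Qed.

(** * Complex differentiable functions and a Cauchy estimate on rectangles *)

Definition cdiff (R : realType) (f : R[i] -> R[i]) (z : R[i]) : Prop :=
  derivable (f : R[i]^o -> R[i]^o) z 1.

Lemma cdiffP (R : realType) (f : R[i] -> R[i]) (z : R[i]) :
  cdiff f z <-> exists d : R[i], forall e : R, 0 < e -> exists2 r : R, 0 < r &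
    forall h : R[i], normc h < r -> normc (f (z + h) - f z - h * d) <= e * normc h.
Proof. exact: (@has_cderivP R R[i]^o). Qed.

Lemma cdiff_cst (R : realType) (k z : R[i]) : cdiff (cst k) z.
Proof. exact: (@derivable_cst R[i] R[i]^o R[i]^o). Qed.

Lemma cdiff_id (R : realType) (z : R[i]) : cdiff id z.
Proof. exact: (@derivable_id R[i] R[i]^o). Qed.

Lemma cdiffD (R : realType) (f g : R[i] -> R[i]) (z : R[i]) :
  cdiff f z -> cdiff g z -> cdiff (fun x => f x + g x) z.
Proof. exact: (@derivableD R[i] R[i]^o R[i]^o f g z 1). Qed.

Lemma cdiffB (R : realType) (f g : R[i] -> R[i]) (z : R[i]) :
  cdiff f z -> cdiff g z -> cdiff (fun x => f x - g x) z.
Proof. exact: (@derivableB R[i] R[i]^o R[i]^o f g z 1). Qed.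

Lemma cdiffM (R : realType) (f g : R[i] -> R[i]) (z : R[i]) :
  cdiff f z -> cdiff g z -> cdiff (fun x => f x * g x) z.
Proof. exact: (@derivableM R[i] R[i]^o f g z 1). Qed.

Lemma cdiffV (R : realType) (f : R[i] -> R[i]) (z : R[i]) :
  f z != 0 -> cdiff f z -> cdiff (fun x => (f x)^-1) z.
Proof. exact: (@derivableV R[i] R[i]^o f z 1). Qed.

Lemma has_cderiv_cont (R : realType) (X : normedModType R[i]) (f : R[i] -> X) (z : R[i]) (d : X) :
  has_cderiv f z d ->
  forall e : R, 0 < e -> exists2 r : R, 0 < r &
    forall h, normc h < r -> rnorm (f (z + h) - f z) < e.
Proof.
move=> H e e0; have [r r0 Hr] := H _ (@ltr01 R).
have K0 : 0 < rnorm d + 1 by rewrite ltr_wpDl// rnorm_ge0.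
exists (Num.min r (e / (rnorm d + 1))); first by rewrite lt_min r0 divr_gt0.
move=> h; rewrite lt_min ltr_pdivlMr// => /andP[hr he].
rewrite -(subrK (h *: d) (f (z + h) - f z)) (le_lt_trans (rnormD _ _))//.
rewrite (le_lt_trans _ he)// mulrDr mulr1 addrC lerD ?rnormZ//.
by rewrite (le_trans (Hr _ hr))// mul1r.
Qed.

Lemma derivable_cont (R : realType) (X : normedModType R[i]) (f : R[i] -> X) (z : R[i]) :
  derivable (f : R[i]^o -> X) z 1 ->
  forall e : R, 0 < e -> exists2 r : R, 0 < r &
    forall h, normc h < r -> rnorm (f (z + h) - f z) < e.
Proof. by move=> /has_cderivP[d /has_cderiv_cont]. Qed.

Lemma rnorm_lip (R : realType) (X : normedModType R[i]) (x y : X) :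
  `|rnorm x - rnorm y| <= rnorm (x - y).
Proof.
have H (a b : X) : rnorm a - rnorm b <= rnorm (a - b).
  by rewrite lerBlDr -{1}(subrK b a) rnormD.
by rewrite ler_norml H andbT lerNl opprB rnormB H.
Qed.

Lemma addcE (R : realType) (a b c d : R) : (a +i* b) + (c +i* d) = (a + c) +i* (b + d).
Proof. by []. Qed.

Lemma slice_continuous (R : realType) (F : R[i] -> R) (x0 y0 : R) :
  (forall e, 0 < e -> exists2 r : R, 0 < r &
    forall h, normc h < r -> `|F (x0 +i* y0 + h) - F (x0 +i* y0)| < e) ->
  {for x0, continuous (fun x => F (x +i* y0))} /\ {for y0, continuous (fun y => F (x0 +i* y))}.
Proof.
move=> H; split; apply/cvgrPdist_lt => e e0; have [r r0 Hr] := H _ e0.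
  near=> x; rewrite distrC.
  have := Hr ((x - x0) +i* 0).
  rewrite addcE addr0 [x0 + _]addrC subrK; apply.
  by rewrite -/((x - x0)%:C) normc_real distrC; near: x; exact: cvgr_dist_lt.
near=> y; rewrite distrC.
have := Hr (0 +i* (y - y0)).
rewrite addcE addr0 [y0 + _]addrC subrK; apply.
rewrite (le_lt_trans (normc_ReIm _))//= normr0 add0r distrC.
by near: y; exact: cvgr_dist_lt.
Unshelve. all: by end_near. Qed.

(** The form is Im(f dz). With f' = p + i q, the Cauchy-Riemann equations make P_y and Q_x both
    equal to p. *)
Lemma cdiff_closed_at (R : realType) (f : R[i] -> R[i]) (x0 y0 : R) :
  cdiff f (x0 +i* y0) ->
  closed_at (fun x y => complex.Im (f (x +i* y))) (fun x y => complex.Re (f (x +i* y))) x0 y0.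
Proof.
move=> /cdiffP[[p q] H]; exists q, (- q), p => e e0.
have [r r0 Hr] := H _ e0; exists (r / 2); first by rewrite divr_gt0.
move=> x y xr yr.
have hr : normc ((x - x0) +i* (y - y0)) <= `|x - x0| + `|y - y0| by exact: normc_ReIm.
have := Hr ((x - x0) +i* (y - y0)).
rewrite addcE [x0 + _]addrC [y0 + _]addrC !subrK.
move=> Hh.
have {Hh}: normc (f (x +i* y) - f (x0 +i* y0) - ((x - x0) +i* (y - y0)) * (p +i* q)) <=
  e * (`|x - x0| + `|y - y0|).
  apply: le_trans (ler_wpM2l (ltW e0) hr); apply: Hh.
  by rewrite (le_lt_trans hr)// (splitr r) ltrD.
case: (f (x +i* y)) => a b; case: (f (x0 +i* y0)) => c d /= Hh.
split; apply: le_trans Hh.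
  apply: (le_trans _ (normc_Im (Complex _ _))) => /=.
  by rewrite le_eqVlt; apply/orP; left; apply/eqP; congr `| _ |; ring.
apply: (le_trans _ (normc_Re (Complex _ _))) => /=.
by rewrite le_eqVlt; apply/orP; left; apply/eqP; congr `| _ |; ring.
Qed.

(** The four cases are the right, left, top and bottom side of a rectangle around 0, signed for
    counterclockwise orientation. There |z| >= r / 2 bounds |G / z| by 2 / r |G|, and s / (s^2 +
    t^2) >= (r / 2) / (2 r^2) = 1 / (4 r) bounds the contribution of A from below. *)
Lemma kernel_side (R : realType) (G z : R[i]) (A r : R) : 0 < r -> 0 <= A ->
  `|complex.Re z| <= r -> `|complex.Im z| <= r ->
  let h := (G - A%:C) / z in let B := 2 / r * normc G - A / (4 * r) in
  [/\ r / 2 <= complex.Re z -> complex.Re h <= B,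
      complex.Re z <= - (r / 2) -> - complex.Re h <= B,
      r / 2 <= complex.Im z -> - complex.Im h <= B
    & complex.Im z <= - (r / 2) -> complex.Im h <= B].
Proof.
move=> r0 A0 zr1 zr2 h B.
have -> : h = G / z - A%:C / z by rewrite /h mulrBl.
have GB : r / 2 <= normc z -> normc (G / z) <= 2 / r * normc G.
  move=> rz; rewrite normcM normcV mulrC ler_wpM2r ?normc_ge0//.
  rewrite -[2 / r]invf_div lef_pV2 ?posrE ?divr_gt0//.
  by rewrite (lt_le_trans _ rz) ?divr_gt0.
have key s t : `|s| <= r -> `|t| <= r -> r / 2 <= s -> A / (4 * r) <= A * s / (s ^+ 2 + t ^+ 2).
  move=> sr tr rs; have s0 : 0 < s by rewrite (lt_le_trans _ rs) ?divr_gt0.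
  rewrite -mulrA ler_wpM2l// ler_pdivlMr ?ltr_wpDr ?sqr_ge0 ?exprn_gt0//.
  have s2 : s ^+ 2 <= r ^+ 2 by rewrite -(real_normK (num_real s)) ler_pXn2r ?nnegrE ?normr_ge0 ?(ltW r0).
  have t2 : t ^+ 2 <= r ^+ 2 by rewrite -(real_normK (num_real t)) ler_pXn2r ?nnegrE ?normr_ge0 ?(ltW r0).
  rewrite mulrC ler_pdivrMr ?mulr_gt0//.
  by have : r ^+ 2 / 2 <= s * r; [rewrite expr2 mulrAC ler_wpM2r// ltW|]; nra.
have ReB : r / 2 <= normc z -> `|complex.Re (G / z)| <= 2 / r * normc G.
  by move=> /GB; apply: le_trans; exact: normc_Re.
have ImB : r / 2 <= normc z -> `|complex.Im (G / z)| <= 2 / r * normc G.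
  by move=> /GB; apply: le_trans; exact: normc_Im.
have [zR zI] : complex.Re (A%:C / z) = A * complex.Re z / (complex.Re z ^+ 2 + complex.Im z ^+ 2) /\
  complex.Im (A%:C / z) = - (A * complex.Im z / (complex.Re z ^+ 2 + complex.Im z ^+ 2)).
  by case: z {h zr1 zr2 GB ReB ImB} => s t /=; split; ring.
have [nR nI] := (normc_Re z, normc_Im z).
have nR' : `|- complex.Re z| <= normc z by rewrite normrN.
have nI' : `|- complex.Im z| <= normc z by rewrite normrN.
rewrite !raddfB/= zR zI /B; set X := complex.Re (G / z) in ReB *; set Y := complex.Im (G / z) in ImB *.
have XY : r / 2 <= normc z -> [/\ X <= 2 / r * normc G, - X <= 2 / r * normc G,
   Y <= 2 / r * normc G & - Y <= 2 / r * normc G].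
  move=> rz; split.
  - exact: le_trans (ler_norm _) (ReB rz).
  - by rewrite (le_trans _ (ReB rz))// -normrN ler_norm.
  - exact: le_trans (ler_norm _) (ImB rz).
  - by rewrite (le_trans _ (ImB rz))// -normrN ler_norm.
split => H.
- have [H1 _ _ _] := XY (le_trans H (le_trans (ler_norm _) nR)).
  by rewrite lerB// key.
- have H' : r / 2 <= - complex.Re z by rewrite lerNr.
  have [_ H1 _ _] := XY (le_trans H' (le_trans (ler_norm _) nR')).
  rewrite opprK lerD//.
  have := key (- complex.Re z) (complex.Im z); rewrite normrN sqrrN => /(_ zr1 zr2 H').
  by rewrite mulrN mulNr; lra.
- have [_ _ _ H1] := XY (le_trans H (le_trans (ler_norm _) nI)).
  rewrite opprK lerD//.
  by have := key _ _ zr2 zr1 H; rewrite [_ ^+ 2 + _]addrC; lra.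
- have H' : r / 2 <= - complex.Im z by rewrite lerNr.
  have [_ _ H1 _] := XY (le_trans H' (le_trans (ler_norm _) nI')).
  rewrite opprK lerD//.
  have := key (- complex.Im z) (complex.Re z); rewrite normrN sqrrN [_ ^+ 2 + _]addrC => /(_ zr2 zr1 H').
  by rewrite mulrN mulNr; lra.
Qed.

Lemma normc_eq0 (R : realType) (z : R[i]) : (normc z == 0) = (z == 0).
Proof. exact: (@rnorm_eq0 R R[i]^o). Qed.

Lemma normc_gt0 (R : realType) (z : R[i]) : (0 < normc z) = (z != 0).
Proof. by rewrite lt_def normc_ge0 andbT normc_eq0. Qed.

(* With [|u| = 1] and [u g(w) > 0], [(u g(z) - |g(w)|) / (z - w)] has zero integral along the
   boundary, and [Im (dz / (z - w))] is positive on each side. *)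
Lemma cauchy_rect (R : realType) (g : R[i] -> R[i]) (w1 w2 a b c d r : R) : 0 < r ->
  w1 - r <= a <= w1 - r / 2 -> w1 + r / 2 <= b <= w1 + r ->
  w2 - r <= c <= w2 - r / 2 -> w2 + r / 2 <= d <= w2 + r ->
  (forall x y, a <= x <= b -> c <= y <= d -> cdiff g (x +i* y)) ->
  normc (g (w1 +i* w2)) <=
    segint (fun x => 2 / r * normc (g (x +i* c))) a b +
    segint (fun x => 2 / r * normc (g (x +i* d))) a b +
    (segint (fun y => 2 / r * normc (g (a +i* y))) c d +
     segint (fun y => 2 / r * normc (g (b +i* y))) c d).
Proof.
move=> r0 /andP[a1 a2] /andP[b1 b2] /andP[c1 c2] /andP[d1 d2] dg0.
set w := w1 +i* w2; set A := normc (g w).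
have [gw0|gw0] := eqVneq (g w) 0.
  rewrite /A gw0 normc0 !addr_ge0// /segint Rintegral_ge0// => x _.
  - by rewrite mulr_ge0 ?normc_ge0// ltW// divr_gt0.
  - by rewrite mulr_ge0 ?normc_ge0// ltW// divr_gt0.
  - by rewrite mulr_ge0 ?normc_ge0// ltW// divr_gt0.
  - by rewrite mulr_ge0 ?normc_ge0// ltW// divr_gt0.
have A0 : 0 < A by rewrite normc_gt0.
pose u := A%:C / g w.
have nu : normc u = 1 by rewrite normcM normcV normc_real gtr0_norm// divff// gt_eqF.
pose G z := u * g z.
have nG z : normc (G z) = normc (g z) by rewrite normcM nu mul1r.
have Gw : G w = A%:C by rewrite /G /u divfK.
have dG x y : a <= x <= b -> c <= y <= d -> cdiff G (x +i* y).
  by move=> xI yI; apply: cdiffM; [exact: cdiff_cst|exact: dg0].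
pose h z := (G z - A%:C) / (z - w).
have [aw wb cw wd] : [/\ a < w1, w1 < b, c < w2 & w2 < d].
  by clear -r0 a2 b1 c2 d1; split; lra.
have ab : a <= w1 <= b by rewrite !ltW.
have cd : c <= w2 <= d by rewrite !ltW.
have ab' : a <= b by exact: ltW (lt_trans aw wb).
have cd' : c <= d by exact: ltW (lt_trans cw wd).
have zw x y : (x, y) != (w1, w2) -> (x +i* y) - w != 0.
  by rewrite subr_eq0; apply: contra_neq => -[-> ->].
have dh x y : a <= x <= b -> c <= y <= d -> (x, y) != (w1, w2) -> cdiff h (x +i* y).
  move=> xI yI ne; apply: cdiffM.
    by apply: cdiffB; [exact: dG|exact: cdiff_cst].
  apply: cdiffV; first exact: zw.
  by apply: cdiffB; [exact: cdiff_id|exact: cdiff_cst].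
pose P x y := complex.Im (h (x +i* y)); pose Q x y := complex.Re (h (x +i* y)).
have PQ x y : a <= x <= b -> c <= y <= d -> (x, y) != (w1, w2) -> closed_at P Q x y.
  by move=> xI yI ne; apply: cdiff_closed_at; exact: dh.
have [aI bI cI dI] : [/\ a <= a <= b, a <= b <= b, c <= c <= d & c <= d <= d].
  by rewrite !lexx ab' cd'.
have nex x y : x != w1 -> (x, y) != (w1, w2) by apply: contra_neq => -[].
have ney x y : y != w2 -> (x, y) != (w1, w2) by apply: contra_neq => -[].
have I0 : rectint P Q a b c d = 0.
  apply: (@goursat_punctured _ P Q a b c d w1 w2) => //.
  - by rewrite aw.
  - by rewrite cw.
  (* Differentiability of G at w bounds the quotient by |G'(w)| + 1 nearby. *)
  have /cdiffP[D HD] := dG _ _ ab cd; have [s s0 Hs] := HD _ (@ltr01 R).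
  exists (s / 2); first by rewrite divr_gt0.
  exists (normc D + 1) => x y xs ys ne.
  have nh : normc (h (x +i* y)) <= normc D + 1.
    rewrite /h normcM normcV ler_pdivrMr; last first.
      by rewrite normc_gt0 zw.
    set k := x +i* y - w; have -> : x +i* y = w + k by rewrite addrC subrK.
    have : normc k < s by rewrite (le_lt_trans (normc_pair _ _ _ _))// (splitr s) ltrD.
    move=> /Hs; rewrite -/w Gw mul1r => Hk.
    rewrite -(subrK (k * D) (G (w + k) - A%:C)) -rnormc (le_trans (rnormD _ _))//.
    by rewrite !rnormc [leRHS]mulrDl mul1r [leRHS]addrC lerD// normcM mulrC.
  by split; apply: le_trans nh; [exact: normc_Im|exact: normc_Re].
have cP y : c <= y <= d -> y != w2 -> forall x, a <= x <= b -> {for x, continuous (P^~ y)}.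
  by move=> yI ne x xI; case: (closed_at_continuous (PQ x y xI yI (ney _ _ ne))).
have cQ x : a <= x <= b -> x != w1 -> forall y, c <= y <= d -> {for y, continuous (Q x)}.
  by move=> xI ne y yI; case: (closed_at_continuous (PQ x y xI yI (nex _ _ ne))).
have cg x y : a <= x <= b -> c <= y <= d ->
    {for x, continuous (fun x => 2 / r * normc (g (x +i* y)))} /\
    {for y, continuous (fun y => 2 / r * normc (g (x +i* y)))}.
  move=> xI yI.
  have [] := @slice_continuous R (fun z => normc (g z)) x y.
    move=> e e0; have [s s0 Hs] := @derivable_cont R R[i]^o g _ (dg0 _ _ xI yI) _ e0.
    exists s => // k /Hs; apply: le_lt_trans; exact: (@rnorm_lip R R[i]^o).
  by move=> H1 H2; split; apply: cvgM => //; exact: cvg_cst.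
set B := A / (4 * r).
have cB x : {for x, continuous (cst B : R -> R)} by exact: cvg_cst.
have side x y := @kernel_side R (G (x +i* y)) (x +i* y - w) A r r0 (ltW A0).
have bx x : a <= x <= b -> `|x - w1| <= r.
  by move=> /andP[h1 h2]; rewrite ler_distl (le_trans a1 h1) (le_trans h2 b2).
have bY y : c <= y <= d -> `|y - w2| <= r.
  by move=> /andP[h1 h2]; rewrite ler_distl (le_trans c1 h1) (le_trans h2 d2).
have cN (f : R -> R) x : {for x, continuous f} -> {for x, continuous (fun x => 0 - f x)}.
  by move=> cf; apply: cvgB => //; exact: cvg_cst.
have cBg (f : R -> R) x : {for x, continuous f} -> {for x, continuous (fun x => f x - cst B x)}.
  by move=> cf; apply: cvgB => //; exact: cB.
have c0 x : {for x, continuous (cst 0 : R -> R)} by exact: cvg_cst.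
have S1 : segint (P^~ c) a b <= segint (fun x => 2 / r * normc (g (x +i* c))) a b - B * (b - a).
  rewrite -segint_cst// -segint_sub//; last by move=> x xI; case: (cg x c xI cI).
  apply: le_segint; first by apply: cP => //; rewrite lt_eqF.
    by move=> x xI; apply: cBg; case: (cg x c xI cI).
  move=> x xI; have [_ _ _] := side x c (bx _ xI) (bY _ cI).
  by rewrite nG; apply; rewrite /=; clear -c2; lra.
have S2 : - segint (P^~ d) a b <= segint (fun x => 2 / r * normc (g (x +i* d))) a b - B * (b - a).
  rewrite -segint_cst// -segint_sub//; last by move=> x xI; case: (cg x d xI dI).
  have cPd : forall x, a <= x <= b -> {for x, continuous (P^~ d)}.
    by apply: cP => //; rewrite gt_eqF.
  rewrite -[leLHS]add0r -[X in X - _](mul0r (b - a)) -segint_cst// -segint_sub//.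
  apply: le_segint; first by move=> x xI; apply: cN; exact: cPd.
    by move=> x xI; apply: cBg; case: (cg x d xI dI).
  move=> x xI; have [_ _ + _] := side x d (bx _ xI) (bY _ dI).
  by rewrite nG sub0r; apply; rewrite /=; clear -d1; lra.
have S3 : segint (Q b) c d <= segint (fun y => 2 / r * normc (g (b +i* y))) c d - B * (d - c).
  rewrite -segint_cst// -segint_sub//; last by move=> y yI; case: (cg b y bI yI).
  apply: le_segint; first by apply: cQ => //; rewrite gt_eqF.
    by move=> y yI; apply: cBg; case: (cg b y bI yI).
  move=> y yI; have [+ _ _ _] := side b y (bx _ bI) (bY _ yI).
  by rewrite nG; apply; rewrite /=; clear -b1; lra.
have S4 : - segint (Q a) c d <= segint (fun y => 2 / r * normc (g (a +i* y))) c d - B * (d - c).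
  rewrite -segint_cst// -segint_sub//; last by move=> y yI; case: (cg a y aI yI).
  have cQa : forall y, c <= y <= d -> {for y, continuous (Q a)}.
    by apply: cQ => //; rewrite lt_eqF.
  rewrite -[leLHS]add0r -[X in X - _](mul0r (d - c)) -segint_cst// -segint_sub//.
  apply: le_segint; first by move=> y yI; apply: cN; exact: cQa.
    by move=> y yI; apply: cBg; case: (cg a y aI yI).
  move=> y yI; have [_ + _ _] := side a y (bx _ aI) (bY _ yI).
  by rewrite nG sub0r; apply; rewrite /=; clear -a2; lra.
(* Each side has length at least r and B r = A / 4, so the four lower bounds add up to at least
   A. *)
have BA : A <= B * (b - a) + B * (b - a) + (B * (d - c) + B * (d - c)).
  have B0 : 0 <= B by rewrite divr_ge0 ?mulr_ge0// ltW.
  have -> : A = 4 * (B * r) by rewrite /B; field; rewrite gt_eqF.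
  have b1' : B * r <= B * (b - a) by apply: ler_wpM2l => //; clear -a2 b1; lra.
  have b2' : B * r <= B * (d - c) by apply: ler_wpM2l => //; clear -c2 d1; lra.
  by clear -b1' b2'; lra.
by move: I0; rewrite /rectint; clear -S1 S2 S3 S4 BA; lra.
Qed.

(** * The sub-mean value property *)

Lemma segint_EFin (R : realType) (f : R -> R) (a b : R) :
  (forall x, a <= x <= b -> {for x, continuous f}) ->
  (segint f a b)%:E = (\int[lebesgue_measure]_(x in `[a, b]) (f x)%:E)%E.
Proof. by move=> cf; rewrite /segint /Rintegral fineK// integrable_fin_num// segment_integrable. Qed.

(** If F exceeded 2 B / (b - a) on the whole interval, its integral would be at least 2 B. The
    factor 2 makes the contradiction strict. *)
Lemma exists_small_slice (R : realType) (F : R -> \bar R) (a b B : R) :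
  a < b -> 0 < B -> measurable_fun setT F -> (forall x, 0 <= F x)%E ->
  (\int[@lebesgue_measure R]_x F x <= B%:E)%E ->
  exists2 x, a <= x <= b & (F x <= (2 * B / (b - a))%:E)%E.
Proof.
move=> ab B0 mF F0 FB; apply/not_exists2P => H.
have {}H x : a <= x <= b -> ((2 * B / (b - a))%:E <= F x)%E.
  by move=> xI; have [//|/negP] := H x; rewrite -ltNge => /ltW.
have : ((2 * B)%:E <= B%:E)%E.
  apply: le_trans FB.
  apply: (@le_trans _ _ (\int[@lebesgue_measure R]_(x in `[a, b]) F x)%E); last first.
    by apply: ge0_subset_integral => //.
  apply: (@le_trans _ _ (\int[@lebesgue_measure R]_(x in `[a, b]) (2 * B / (b - a))%:E)%E); last first.
    apply: ge0_le_integral => //.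
    - by move=> x _; rewrite lee_fin divr_ge0// ?mulr_ge0 ?subr_ge0// ltW.
    - exact: measurable_funS mF.
  rewrite integral_cst//= lebesgue_measure_itv/= lte_fin ab -EFinB -EFinM lee_fin.
  by rewrite divfK// gt_eqF// subr_gt0.
by rewrite lee_fin; lra.
Qed.

Lemma segint_le_slice (R : realType) (f : R -> R) (a b a' b' K k : R) :
  a' <= a -> b <= b' -> 0 <= k ->
  (forall x, a' <= x <= b' -> {for x, continuous f}) ->
  (forall x, 0 <= f x) ->
  (\int[@lebesgue_measure R]_(x in `[a', b']) (f x)%:E <= K%:E)%E ->
  segint (fun x => k * f x) a b <= k * K.
Proof.
move=> a'a bb' k0 cf f0 HK.
have cf' x : a <= x <= b -> {for x, continuous f}.
  by move=> /andP[? ?]; apply: cf; apply/andP; split; [exact: le_trans a'a _|exact: le_trans bb'].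
have -> : segint (fun x => k * f x) a b = k * segint f a b.
  by rewrite /segint RintegralZl//; exact: segment_integrable.
rewrite ler_wpM2l// -lee_fin segint_EFin// (le_trans _ HK)//.
apply: ge0_subset_integral => //.
- by apply/measurable_EFinP; have /integrableP[/measurable_EFinP] := segment_integrable cf.
- by move=> x _; rewrite lee_fin.
- by apply: subset_itv; rewrite bnd_simp.
Qed.

Definition square (R : realType) (w1 w2 r : R) : set (plane R) :=
  `[w1 - r, w1 + r]%classic `*` `[w2 - r, w2 + r]%classic.

Lemma square_measurable (R : realType) (w1 w2 r : R) : measurable (@square R w1 w2 r).
Proof. exact: measurableX. Qed.

Lemma cdiff_normc_continuous (R : realType) (g : R[i] -> R[i]) :
  (forall z, disc z -> cdiff g z) -> disc_continuous (fun z => normc (g z)).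
Proof.
move=> dg z Dz e e0; have [s s0 Hs] := @derivable_cont R R[i]^o g _ (dg _ Dz) _ e0.
by exists s => // k /Hs; apply: le_lt_trans; exact: (@rnorm_lip R R[i]^o).
Qed.

(* [cauchy_rect] is applied to a rectangle on whose sides the integral of |g| is at most
   twice its average over parallel sides. *)
Lemma submean_L1 (R : realType) (g : R[i] -> R[i]) (w1 w2 r B : R) : 0 < r -> 0 < B ->
  (forall z, disc z -> cdiff g z) -> square w1 w2 r `<=` @discRR R ->
  (\int[(area R)]_(xy in square w1 w2 r)
     (normc (g (xy.1 +i* xy.2)))%:E <= B%:E)%E ->
  normc (g (w1 +i* w2)) <= 32 * B / r ^+ 2.
Proof.
move=> r0 B0 dg QD HB.
pose f := (fun xy : plane R => (normc (g (xy.1 +i* xy.2)))%:E)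
  \_ (square w1 w2 r).
have mQ := square_measurable w1 w2 r.
have mf : measurable_fun setT f.
  apply/(measurable_restrictT _ _).1 => //; apply/measurable_EFinP.
  apply: (measurable_funS _ QD); first exact: discRR_measurable.
  exact: (disc_continuous_measurable (cdiff_normc_continuous dg)).
have f0 xy : (0 <= f xy)%E.
  by rewrite /f patchE; case: ifP => // _; rewrite lee_fin normc_ge0.
move: HB; rewrite integral_mkcond -/f => HB.
pose FF : R -> \bar R := fubini_F (@lebesgue_measure R) f.
pose GG : R -> \bar R := fubini_G (@lebesgue_measure R) f.
have HB1 : (\int[lebesgue_measure]_x FF x <= B%:E)%E.
  by rewrite -fubini_tonelli1.
have HB2 : (\int[lebesgue_measure]_y GG y <= B%:E)%E.
  by rewrite -fubini_tonelli.
have mF : measurable_fun setT (FF).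
  exact: measurable_fun_fubini_tonelli_F.
have mG : measurable_fun setT (GG).
  exact: measurable_fun_fubini_tonelli_G.
have F0 x : (0 <= FF x)%E by exact: integral_ge0.
have G0 y : (0 <= GG y)%E by exact: integral_ge0.
have FE x : w1 - r <= x <= w1 + r -> FF x =
    (\int[lebesgue_measure]_(y in `[(w2 - r)%R, (w2 + r)%R]) (normc (g (x +i* y)))%:E)%E.
  move=> xI; rewrite /FF /fubini_F [RHS]integral_mkcond; apply: eq_integral => y _.
  rewrite /f !patchE; congr (if _ then _ else _).
  apply/idP/idP; rewrite !inE; first by case.
  by move=> yI; split => //=; rewrite in_itv.
have GE y : w2 - r <= y <= w2 + r -> GG y =
    (\int[lebesgue_measure]_(x in `[(w1 - r)%R, (w1 + r)%R]) (normc (g (x +i* y)))%:E)%E.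
  move=> yI; rewrite /GG /fubini_G [RHS]integral_mkcond; apply: eq_integral => x _.
  rewrite /f !patchE; congr (if _ then _ else _).
  apply/idP/idP; rewrite !inE; first by case.
  by move=> xI; split => //=; rewrite in_itv.
have r2 : 0 < r / 2 by rewrite divr_gt0.
have slice (H : R -> \bar R) a b : measurable_fun setT H -> (forall x, 0 <= H x)%E ->
    (\int[@lebesgue_measure R]_x H x <= B%:E)%E -> b - a = r / 2 ->
    exists2 x, a <= x <= b & (H x <= (4 * B / r)%:E)%E.
  move=> mH H0 HH ba; have ab : a < b by rewrite -subr_gt0 ba.
  have [x xI Hx] := exists_small_slice ab B0 mH H0 HH; exists x => //.
  rewrite (le_trans Hx)// ba lee_fin le_eqVlt; apply/orP; left; apply/eqP.
  by field; rewrite gt_eqF.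
(* Each side is chosen in a strip of width r / 2, at distance between r / 2 and r from the centre as
   [cauchy_rect] asks; the strip gives 2 B / (r / 2) = 4 B / r. *)
have [a aI Ha] : exists2 x, w1 - r <= x <= w1 - r / 2 & (FF x <= (4 * B / r)%:E)%E.
  by apply: slice => //; lra.
have [b bI Hb] : exists2 x, w1 + r / 2 <= x <= w1 + r & (FF x <= (4 * B / r)%:E)%E.
  by apply: slice => //; lra.
have [c cI Hc] : exists2 x, w2 - r <= x <= w2 - r / 2 & (GG x <= (4 * B / r)%:E)%E.
  by apply: slice => //; lra.
have [d dI Hd] : exists2 x, w2 + r / 2 <= x <= w2 + r & (GG x <= (4 * B / r)%:E)%E.
  by apply: slice => //; lra.
have cdg x y : w1 - r <= x <= w1 + r -> w2 - r <= y <= w2 + r -> cdiff g (x +i* y).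
  by move=> xI yI; apply: dg; apply: (QD (x, y)); split; rewrite /= in_itv.
have cg x y : w1 - r <= x <= w1 + r -> w2 - r <= y <= w2 + r ->
    {for x, continuous (fun x => normc (g (x +i* y)))} /\
    {for y, continuous (fun y => normc (g (x +i* y)))}.
  move=> xI yI; apply: (@slice_continuous R (fun z => normc (g z))).
  move=> e e0; have [s s0 Hs] := @derivable_cont R R[i]^o g _ (cdg _ _ xI yI) _ e0.
  by exists s => // k /Hs; apply: le_lt_trans; exact: (@rnorm_lip R R[i]^o).
move/andP: (aI) => [a1 a2]; move/andP: (bI) => [b1 b2].
move/andP: (cI) => [c1 c2]; move/andP: (dI) => [d1 d2].
have [aI' bI' cI' dI'] : [/\ w1 - r <= a <= w1 + r, w1 - r <= b <= w1 + r,
   w2 - r <= c <= w2 + r & w2 - r <= d <= w2 + r].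
  by clear -r0 a1 a2 b1 b2 c1 c2 d1 d2; split; apply/andP; split; lra.
rewrite FE// in Ha; rewrite FE// in Hb; rewrite GE// in Hc; rewrite GE// in Hd.
have k0 : 0 <= 2 / r by rewrite divr_ge0// ltW.
have Sc : segint (fun x => 2 / r * normc (g (x +i* c))) a b <= 2 / r * (4 * B / r).
  by apply: (segint_le_slice a1 b2) => // [x xI|x]; [case: (cg x c xI cI')|exact: normc_ge0].
have Sd : segint (fun x => 2 / r * normc (g (x +i* d))) a b <= 2 / r * (4 * B / r).
  by apply: (segint_le_slice a1 b2) => // [x xI|x]; [case: (cg x d xI dI')|exact: normc_ge0].
have Sa : segint (fun y => 2 / r * normc (g (a +i* y))) c d <= 2 / r * (4 * B / r).
  by apply: (segint_le_slice c1 d2) => // [x xI|x]; [case: (cg a x aI' xI)|exact: normc_ge0].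
have Sb : segint (fun y => 2 / r * normc (g (b +i* y))) c d <= 2 / r * (4 * B / r).
  by apply: (segint_le_slice c1 d2) => // [x xI|x]; [case: (cg b x bI' xI)|exact: normc_ge0].
have -> : 32 * B / r ^+ 2 = 2 / r * (4 * B / r) + 2 / r * (4 * B / r) +
  (2 / r * (4 * B / r) + 2 / r * (4 * B / r)) by field; rewrite gt_eqF.
apply: le_trans (lerD (lerD Sc Sd) (lerD Sa Sb)).
apply: cauchy_rect => // x y /andP[xa xb] /andP[yc yd].
by apply: cdg; apply/andP; split; clear -a1 b2 c1 d2 xa xb yc yd; lra.
Qed.

Lemma square_measure (R : realType) (w1 w2 r : R) : 0 < r ->
  ((area R) (square w1 w2 r) = (4 * r ^+ 2)%:E)%E.
Proof.
move=> r0; rewrite product_measure1E//= !lebesgue_measure_itv/= !lte_fin.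
have lt2 w : w - r < w + r by lra.
by rewrite !lt2 -!EFinB -EFinM; congr (_%:E); ring.
Qed.

(** Either t <= l, or (t / l)^(p - 1) >= 1. Summed or integrated, with l chosen as a p-th mean, it
    acts as Hoelder's inequality at the cost of a constant. *)
Lemma le_powR_young (R : realType) (p l t : R) : 1 <= p -> 0 < l -> 0 <= t ->
  t <= l + l `^ (1 - p) * t `^ p.
Proof.
move=> p1 l0 t0; have [tl|lt] := leP t l.
  by rewrite (le_trans tl)// lerDl mulr_ge0// powR_ge0.
have t0' : 0 < t by rewrite (lt_trans l0).
apply: (@le_trans _ _ (l `^ (1 - p) * t `^ p)); last by rewrite lerDr ltW.
have -> : l `^ (1 - p) = (l `^ (p - 1))^-1 by rewrite -powRN opprB.
rewrite mulrC ler_pdivlMr ?powR_gt0//.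
have -> : t `^ p = t * t `^ (p - 1).
  rewrite -{2}(powRr1 t0) -powRD; last by rewrite (gt_eqF t0') implybT.
  by rewrite addrC subrK.
rewrite ler_wpM2l//; apply: ge0_ler_powR; rewrite ?nnegrE ?subr_ge0//.
- exact: ltW.
- exact: ltW.
Qed.

Lemma submean_Lp (R : realType) (g : R[i] -> R[i]) (w1 w2 r p B : R) :
  0 < r -> 0 < B -> 1 <= p ->
  (forall z, disc z -> cdiff g z) -> square w1 w2 r `<=` @discRR R ->
  (\int[(area R)]_(xy in square w1 w2 r)
     (normc (g (xy.1 +i* xy.2)) `^ p)%:E <= B%:E)%E ->
  normc (g (w1 +i* w2)) `^ p <= 160 `^ p * (B / r ^+ 2).
Proof.
move=> r0 B0 p1 dg QD HB; have p0 : 0 < p by rewrite (lt_le_trans ltr01).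
have Br : 0 < B / r ^+ 2 by rewrite divr_gt0// exprn_gt0.
(* With l^p = B / r^2 the two Young terms integrate to at most 4 r^2 l, where 4 r^2 is the area, and
   r^2 l. Their sum 5 r^2 l, put into [submean_L1], gives 32 times 5 = 160. *)
pose l := (B / r ^+ 2) `^ p^-1.
have l0 : 0 < l by rewrite powR_gt0.
have lp : l `^ p = B / r ^+ 2 by rewrite -powRrM mulVf ?gt_eqF// powRr1// ltW.
have mg : measurable_fun (square w1 w2 r) (fun xy => normc (g (xy.1 +i* xy.2))).
  apply: (measurable_funS _ QD); first exact: discRR_measurable.
  exact: (disc_continuous_measurable (cdiff_normc_continuous dg)).
have mgp : measurable_fun (square w1 w2 r) (fun xy => normc (g (xy.1 +i* xy.2)) `^ p).
  exact: (measurableT_comp (measurable_powR p) mg).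
have lp0 : 0 <= l `^ (1 - p) by rewrite powR_ge0.
have mQ := square_measurable w1 w2 r.
have L1 : (\int[(area R)]_(xy in square w1 w2 r)
     (normc (g (xy.1 +i* xy.2)))%:E <= (5 * r ^+ 2 * l)%:E)%E.
  apply: (@le_trans _ _ (\int[(area R)]_(xy in square w1 w2 r)
     (l%:E + (l `^ (1 - p))%:E * (normc (g (xy.1 +i* xy.2)) `^ p)%:E))%E).
    apply: ge0_le_integral => //.
    - by move=> x _; rewrite lee_fin normc_ge0.
    - exact/measurable_EFinP.
    - apply/measurable_EFinP; apply: measurable_funD => //.
      exact: measurable_funM.
    - by move=> x _; rewrite -EFinM -EFinD lee_fin le_powR_young// normc_ge0.
  rewrite ge0_integralD//; last 3 first.
  - by move=> x _; rewrite lee_fin ltW.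
  - by move=> x _; rewrite -EFinM lee_fin mulr_ge0// powR_ge0.
  - by apply/measurable_EFinP; exact: measurable_funM.
  rewrite ge0_integralZl_EFin//; last 2 first.
  - by move=> x _; rewrite lee_fin powR_ge0.
  - exact/measurable_EFinP.
  rewrite integral_cst// [X in (_ * X + _)%E](_ : _ = (4 * r ^+ 2)%:E); last exact: square_measure.
  apply: (le_trans (leeD2l _ (lee_wpmul2l _ HB))); first by rewrite lee_fin.
  rewrite -!EFinM -EFinD lee_fin.
  have -> : l `^ (1 - p) * B = r ^+ 2 * l.
    rewrite powRB; last by rewrite (gt_eqF l0) implybT.
    rewrite powRr1 ?(ltW l0)//.
    by rewrite lp; field; rewrite (gt_eqF B0) (gt_eqF r0).
  by rewrite le_eqVlt; apply/orP; left; apply/eqP; ring.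
have := submean_L1 r0 _ dg QD L1.
rewrite !mulr_gt0 ?exprn_gt0// => /(_ isT) gw.
have -> : 160 `^ p * (B / r ^+ 2) = (160 * l) `^ p by rewrite powRM ?lp// ltW.
apply: ge0_ler_powR; rewrite ?nnegrE ?normc_ge0 ?mulr_ge0 ?(ltW p0) ?(ltW l0)//.
rewrite (le_trans gw)// le_eqVlt; apply/orP; left; apply/eqP.
by field; rewrite gt_eqF.
Qed.

(** * Complex roots of non-vanishing functions *)

Lemma real_small_o (R : realType) (f : R -> R) (l : R) : is_derive (0 : R) (1 : R) f l ->
  forall e, 0 < e -> exists2 r, 0 < r & forall x, `|x| < r -> `|f x - f 0 - x * l| <= e * `|x|.
Proof.
move=> [df fl] e e0; move/cvg_ex: (df) => -[l' Hl'].
have {Hl'} : h^-1 *: ((f \o shift 0) (h *: 1) - f 0) @[h --> 0^'] --> l by rewrite -fl.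
move=> /cvgrPdist_le /(_ e e0); rewrite near_withinE => -[r /= r0 Hr].
exists r => // x xr; have [->|x0] := eqVneq x 0.
  by rewrite subrr mul0r subr0 normr0 mulr0.
have := Hr x; rewrite /= sub0r normrN => /(_ xr x0).
rewrite addr0 -[x *: 1]/(x * 1) mulr1 -[x^-1 *: _]/(x^-1 * _) => H.
have -> : f x - f 0 - x * l = - (x * (l - x^-1 * (f x - f 0))) by field.
by rewrite normrN normrM mulrC ler_wpM2r.
Qed.

Definition cexp (R : realType) (z : R[i]) : R[i] :=
  (expR (complex.Re z) * cos (complex.Im z)) +i* (expR (complex.Re z) * sin (complex.Im z)).

Lemma cexpD (R : realType) (z w : R[i]) : cexp (z + w) = cexp z * cexp w.
Proof.
case: z => a b; case: w => c d; rewrite /cexp /= expRD cosD sinD.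
by apply/eqP; rewrite eq_complex /=; apply/andP; split; apply/eqP; ring.
Qed.

Lemma cexp0 (R : realType) : cexp 0 = 1 :> R[i].
Proof. by rewrite /cexp /= expR0 cos0 sin0 mulr1 mulr0. Qed.

Lemma normc_cexp (R : realType) (z : R[i]) : normc (cexp z) = expR (complex.Re z).
Proof.
by rewrite /cexp /= !exprMn -mulrDr cos2Dsin2 mulr1 sqrtr_sqr ger0_norm ?expR_ge0.
Qed.

Lemma cexp_has_cderiv0 (R : realType) : @has_cderiv R R[i]^o (@cexp R) 0 1.
Proof.
(* The errors below add up to (1 + 3 + 3 + 2) d n = 9 d n, where one 3 in each product bounds expR
   x. *)
move=> e e0; pose d := Num.min 1 (e / 9).
have d0 : 0 < d by rewrite lt_min ltr01 divr_gt0.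
have [d1 de] : d <= 1 /\ d <= e / 9 by rewrite !ge_min !lexx orbT.
have [r1 r10 H1] := real_small_o (is_derive_expR 0) d0.
have [r2 r20 H2] := real_small_o (is_derive_sin 0) d0.
have [r3 r30 H3] := real_small_o (is_derive_cos 0) d0.
exists (Num.min d (Num.min r1 (Num.min r2 r3))); first by rewrite lt_min d0 lt_min r10 lt_min r20.
case=> x y; set n := normc _; rewrite lt_min => /andP[hd]; rewrite lt_min => /andP[h1]; rewrite lt_min => /andP[h2 h3].
have [xn yn] : `|x| <= n /\ `|y| <= n.
  by split; [exact: (normc_Re (x +i* y))|exact: (normc_Im (x +i* y))].
have n0 : 0 <= n by exact: normc_ge0.
have := H1 x (le_lt_trans xn h1); have := H2 y (le_lt_trans yn h2).
have := H3 y (le_lt_trans yn h3).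
rewrite expR0 sin0 cos0 oppr0 !mulr0 mulr1 !subr0 mulr1 add0r addr0.
set E := expR x; set S := sin y; set C := cos y => HC HS HE.
rewrite rnormc cexp0 -[(x +i* y)%:A]/((x +i* y) * 1) mulr1.
apply: (le_trans (normc_ReIm _)); rewrite /cexp /= -/E -/S -/C.
have E0 : 0 < E by exact: expR_gt0.
have HCn : `|C - 1| <= d * n by rewrite (le_trans HC)// ler_wpM2l// ltW.
have HSn : `|S - y| <= d * n by rewrite (le_trans HS)// ler_wpM2l// ltW.
have HEn : `|E - 1 - x| <= d * n by rewrite (le_trans HE)// ler_wpM2l// ltW.
have nd : d * n <= d by rewrite -[leRHS]mulr1 ler_wpM2l// ?(ltW d0)// (le_trans (ltW hd)).
have E1 : `|E - 1| <= 2 * d.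
  rewrite -(subrK x (E - 1)) (le_trans (ler_normD _ _))// mulrDl mul1r lerD//.
    exact: le_trans HEn nd.
  exact: le_trans xn (ltW hd).
have E3 : E <= 3.
  by have := le_trans (ler_norm _) E1; move: d1; lra.
have -> : E * C - 1 - x = (E - 1 - x) + E * (C - 1) by ring.
have -> : E * S - 0 - y = E * (S - y) + (E - 1) * y by ring.
have B1 : `|E * (C - 1)| <= 3 * (d * n).
  by rewrite normrM gtr0_norm// ler_pM// ltW.
have B2 : `|E * (S - y)| <= 3 * (d * n).
  by rewrite normrM gtr0_norm// ler_pM// ltW.
have B3 : `|(E - 1) * y| <= 2 * d * n by rewrite normrM ler_pM.
apply: (@le_trans _ _ (d * n + 3 * (d * n) + (3 * (d * n) + 2 * d * n))).
  by apply: lerD; apply: le_trans (ler_normD _ _) _; exact: lerD.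
have -> : d * n + 3 * (d * n) + (3 * (d * n) + 2 * d * n) = 9 * d * n by ring.
by rewrite ler_wpM2r// mulrC -ler_pdivlMr.
Qed.

Lemma cexp_has_cderiv (R : realType) (z : R[i]) : @has_cderiv R R[i]^o (@cexp R) z (cexp z).
Proof.
move=> e e0; have N0 : 0 < normc (cexp z) by rewrite normc_cexp expR_gt0.
have [r r0 Hr] := @cexp_has_cderiv0 R _ (divr_gt0 e0 N0).
exists r => // h /Hr; rewrite add0r cexp0 !rnormc cexpD => H.
have -> : cexp z * cexp h - cexp z - h *: (cexp z : R[i]^o) = cexp z * (cexp h - 1 - h * 1).
  by rewrite -[h *: _]/(h * cexp z); ring.
by rewrite normcM mulrC -ler_pdivlMr// mulrAC.
Qed.

Lemma cdiff_cexp (R : realType) (z : R[i]) : cdiff (@cexp R) z.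
Proof. by apply/(@has_cderivP R R[i]^o); exists (cexp z); exact: cexp_has_cderiv. Qed.

Lemma cdiff_comp (R : realType) (f g : R[i] -> R[i]) (z : R[i]) :
  cdiff f z -> cdiff g (f z) -> cdiff (g \o f) z.
Proof.
move=> /cdiffP[a Ha] /cdiffP[b Hb]; apply/cdiffP; exists (a * b) => e e0.
pose K := normc a + 1; pose M := normc b + 1.
have K0 : 0 < K by rewrite ltr_wpDl// normc_ge0.
have M0 : 0 < M by rewrite ltr_wpDl// normc_ge0.
have [r r0 Hr] := Hb _ (divr_gt0 e0 (mulr_gt0 (ltr0n _ 2) K0)).
have e1 : 0 < Num.min 1 (e / (2 * M)) by rewrite lt_min ltr01 divr_gt0// mulr_gt0.
have [s s0 Hs] := Ha _ e1.
exists (Num.min s (r / K)); first by rewrite lt_min s0 divr_gt0.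
move=> h; rewrite lt_min => /andP[/Hs + hr]; set k := f (z + h) - f z => Hk.
have kK : normc k <= K * normc h.
  rewrite -(subrK (h * a) k) (le_trans (@rnormD _ R[i]^o _ _))// !rnormc mulrDl mul1r addrC lerD//.
    by rewrite normcM mulrC.
  by rewrite (le_trans Hk)// ler_piMl ?normc_ge0// ge_min lexx.
have kr : normc k < r by rewrite (le_lt_trans kK)// mulrC -ltr_pdivlMr.
have -> : (g \o f) (z + h) = g (f z + k) by rewrite /= [f z + k]addrC subrK.
have -> : g (f z + k) - (g \o f) z - h * (a * b) =
  (g (f z + k) - g (f z) - k * b) + (k - h * a) * b by rewrite /=; ring.
rewrite (le_trans (@rnormD _ R[i]^o _ _))// !rnormc [e]splitr [leRHS]mulrDl lerD//.
  rewrite (le_trans (Hr _ kr))// invfM !mulrA -[leLHS]mulrA ler_wpM2l ?divr_ge0 ?(ltW e0)//.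
  by rewrite mulrC ler_pdivrMr// mulrC.
rewrite normcM; apply: (@le_trans _ _ (e / (2 * M) * normc h * M)).
  rewrite ler_pM ?normc_ge0//; last by rewrite lerDl.
  by rewrite (le_trans Hk)// ler_wpM2r ?normc_ge0// ge_min lexx orbT.
by rewrite le_eqVlt; apply/orP; left; apply/eqP; field; rewrite gt_eqF.
Qed.

(** This formula is the principal logarithm only where the real part is positive. *)
Definition clog (R : realType) (z : R[i]) : R[i] :=
  ln (normc z) +i* atan (complex.Im z / complex.Re z).

Lemma cexp_clog (R : realType) (z : R[i]) : 0 < complex.Re z -> cexp (clog z) = z.
Proof.
case: z => a b /= a0; set t := b / a.
have n0 : 0 < Num.sqrt (a ^+ 2 + b ^+ 2).
  by rewrite sqrtr_gt0 ltr_wpDr ?sqr_ge0// exprn_gt0.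
rewrite /cexp /= lnK//.
have -> : sin (atan t) = t * cos (atan t).
  rewrite -[X in _ = X * _](atanK t) /tan divfK// gt_eqF// cos_gt0_pihalf//.
  by rewrite atan_gtNpi2 atan_ltpi2.
rewrite cos_atan -/t.
have -> : Num.sqrt (a ^+ 2 + b ^+ 2) = a * Num.sqrt (1 + t ^+ 2).
  rewrite -[X in X * _](ger0_norm (ltW a0)) -sqrtr_sqr -sqrtrM ?sqr_ge0//.
  by congr Num.sqrt; rewrite /t; field; rewrite gt_eqF.
have s0 : Num.sqrt (1 + t ^+ 2) != 0 by rewrite gt_eqF// sqrtr_gt0 ltr_pwDl// sqr_ge0.
by rewrite mulfK// mulrCA mulfK// /t divfK// gt_eqF.
Qed.

Lemma continuous_normc_e (R : realType) (F : R[i] -> R) (z : R[i]) :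
  (forall e, 0 < e -> exists2 r : R, 0 < r & forall h, normc h < r -> `|F (z + h) - F z| < e) <->
  {for (z : R[i]^o), continuous (F : R[i]^o -> R)}.
Proof.
have FF : Filter (nbhs (z : R[i]^o)) by exact: nbhs_filter.
split=> [H|H].
  apply/cvgrPdist_lt => e /H[r r0 Hr]; apply/nbhs_normc; exists r => // h /Hr.
  by rewrite distrC.
move=> e e0; move/cvgrPdist_lt: H => /(_ _ e0)/nbhs_normc[r r0 Hr]; exists r => // h /Hr.
by rewrite distrC.
Qed.

Lemma continuous_Re (R : realType) (z : R[i]) :
  {for (z : R[i]^o), continuous (@complex.Re R : R[i]^o -> R)}.
Proof.
apply/continuous_normc_e => e e0; exists e => // h; apply: le_lt_trans.
by rewrite -raddfB/= addrAC subrr add0r normc_Re.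
Qed.

Lemma continuous_Im (R : realType) (z : R[i]) :
  {for (z : R[i]^o), continuous (@complex.Im R : R[i]^o -> R)}.
Proof.
apply/continuous_normc_e => e e0; exists e => // h; apply: le_lt_trans.
by rewrite -raddfB/= addrAC subrr add0r normc_Im.
Qed.

Lemma continuous_normc (R : realType) (z : R[i]) :
  {for (z : R[i]^o), continuous (@normc R : R[i]^o -> R)}.
Proof.
apply/continuous_normc_e => e e0; exists e => // h; apply: le_lt_trans.
by rewrite (le_trans (@rnorm_lip R R[i]^o _ _))// rnormc addrAC subrr add0r.
Qed.

Lemma clog_cont (R : realType) (z : R[i]) : 0 < complex.Re z ->
  forall e, 0 < e -> exists2 r : R, 0 < r &
    forall h, normc h < r -> normc (clog (z + h) - clog z) < e.
Proof.
move=> z0 e e0; have nz0 : 0 < normc z.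
  by rewrite (lt_le_trans z0)// (le_trans (ler_norm _))// normc_Re.
have e2 : 0 < e / 2 by rewrite divr_gt0.
have /continuous_normc_e/(_ _ e2)[r r0 Hr] :
    {for (z : R[i]^o), continuous ((fun z => ln (normc z)) : R[i]^o -> R)}.
  by apply: (@continuous_comp _ _ _ (@normc R : R[i]^o -> R)); [exact: continuous_normc|exact: continuous_ln].
have /continuous_normc_e/(_ _ e2)[s s0 Hs] :
    {for (z : R[i]^o), continuous ((fun z => atan (complex.Im z / complex.Re z)) : R[i]^o -> R)}.
  apply: (@continuous_comp _ _ _ ((fun z => complex.Im z / complex.Re z) : R[i]^o -> R)); last exact: continuous_atan.
  have FF : Filter (nbhs (z : R[i]^o)) by exact: nbhs_filter.
  apply: cvgM; first exact: (@continuous_Im R z).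
  by apply: cvgV; [rewrite gt_eqF|exact: (@continuous_Re R z)].
exists (Num.min r s); first by rewrite lt_min r0.
move=> h; rewrite lt_min => /andP[/Hr h1 /Hs h2].
rewrite (le_lt_trans (normc_ReIm _))// [e]splitr.
exact: ltrD.
Qed.

(** Differentiation of an inverse: if h is the increment of the logarithm, the exponential at clog z
    has increment k, so k - h z is small compared with h. The entry |z| / 2 of the minimum yields
    |h| <= 2 |k| / |z|, the other entry the required e. *)
Lemma cdiff_clog (R : realType) (z : R[i]) : 0 < complex.Re z -> cdiff (@clog R) z.
Proof.
move=> z0; have nz0 : 0 < normc z.
  by rewrite (lt_le_trans z0)// (le_trans (ler_norm _))// normc_Re.
have zne : z != 0 by rewrite -normc_gt0.
apply/cdiffP; exists z^-1 => e e0.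
have d0 : 0 < Num.min (normc z / 2) (e * normc z ^+ 2 / 2).
  by rewrite lt_min !divr_gt0// mulr_gt0// exprn_gt0.
have [r r0 Hr] := @cexp_has_cderiv R (clog z) _ d0.
have [s s0 Hs] := clog_cont z0 r0.
have /continuous_normc_e/(_ _ z0)[q q0 Hq] := @continuous_Re R z.
exists (Num.min s q); first by rewrite lt_min s0.
move=> k; rewrite lt_min => /andP[/Hs ks /Hq kq].
have zk0 : 0 < complex.Re (z + k).
  by move: kq; rewrite ltr_distl subrr => /andP[].
set h := clog (z + k) - clog z in ks *.
have := Hr h ks; rewrite rnormc.
have -> : clog z + h = clog (z + k) by rewrite addrC subrK.
rewrite !cexp_clog// -[h *: _]/(h * z) [z + k]addrC addrK => H.
have H1 : normc (k - h * z) <= normc z / 2 * normc h.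
  by rewrite (le_trans H)// ler_wpM2r ?normc_ge0// ge_min lexx.
have H2 : normc (k - h * z) <= e * normc z ^+ 2 / 2 * normc h.
  by rewrite (le_trans H)// ler_wpM2r ?normc_ge0// ge_min lexx orbT.
have hk : normc h <= 2 * normc k / normc z.
  rewrite ler_pdivlMr// -normcM.
  have : normc (h * z) <= normc k + normc (k - h * z).
    rewrite -{1}(subKr k (h * z)) -rnormc (le_trans (@rnormD R R[i]^o _ _))// lerD2l.
    by rewrite (@rnormN R R[i]^o).
  by move: H1; rewrite normcM; lra.
have -> : h - k * z^-1 = - ((k - h * z) * z^-1) by field.
rewrite -rnormc (@rnormN R R[i]^o) rnormc normcM normcV ler_pdivrMr//.
rewrite (le_trans H2)//; apply: (@le_trans _ _ (e * normc z ^+ 2 / 2 * (2 * normc k / normc z))).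
  by rewrite ler_wpM2l// divr_ge0// mulr_ge0 ?exprn_ge0 ?normc_ge0// ltW.
by rewrite le_eqVlt; apply/orP; left; apply/eqP; field; rewrite gt_eqF.
Qed.

Definition croot (R : realType) (p : R) (z : R[i]) : R[i] := cexp (clog z * (p^-1)%:C).

Lemma cdiff_croot (R : realType) (p : R) (z : R[i]) : 0 < complex.Re z -> cdiff (croot p) z.
Proof.
move=> z0; apply: (@cdiff_comp R (fun z => clog z * (p^-1)%:C) (@cexp R)); last exact: cdiff_cexp.
by apply: cdiffM; [exact: cdiff_clog|exact: cdiff_cst].
Qed.

Lemma normc_croot (R : realType) (p : R) (z : R[i]) : 0 < complex.Re z ->
  normc (croot p z) = normc z `^ p^-1.
Proof.
move=> z0; have nz0 : 0 < normc z.
  by rewrite (lt_le_trans z0)// (le_trans (ler_norm _))// normc_Re.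
have ReM (w : R[i]) (c : R) : complex.Re (w * c%:C) = c * complex.Re w.
  by case: w => a b /=; rewrite mulr0 subr0 mulrC.
by rewrite normc_cexp ReM /powR gt_eqF.
Qed.

Lemma croot1 (R : realType) (p : R) : croot p 1 = 1.
Proof.
rewrite /croot /clog normc1 ln1 /= mul0r atan0.
by rewrite [X in cexp X](_ : _ = 0) ?cexp0//; apply/eqP; rewrite eq_complex /= !mul0r subr0 addr0 eqxx.
Qed.

Lemma cdiff_local (R : realType) (f g : R[i] -> R[i]) (z : R[i]) :
  (exists2 r : R, 0 < r & forall k, normc k < r -> f (z + k) = g (z + k)) ->
  cdiff f z -> cdiff g z.
Proof.
move=> [r r0 H] /cdiffP[d Hd]; apply/cdiffP; exists d => e /Hd[s s0 Hs].
exists (Num.min r s); first by rewrite lt_min r0.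
move=> k; rewrite lt_min => /andP[kr /Hs]; rewrite H//.
by have := H 0; rewrite normc0 addr0 => /(_ r0) ->.
Qed.

Lemma cdiff_prod (R : realType) (n : nat) (f : nat -> R[i] -> R[i]) (z : R[i]) :
  (forall k, (k < n)%N -> cdiff (f k) z) -> cdiff (fun x => \prod_(k < n) f k x) z.
Proof.
elim: n => [|n IH] H.
  by rewrite (_ : (fun x => _) = cst 1); [exact: cdiff_cst|apply/funext => x; rewrite big_ord0].
rewrite (_ : (fun x => _) = (fun x => (\prod_(k < n) f k x) * f n x)); last first.
  by apply/funext => x; rewrite big_ord_recr.
by apply: cdiffM; [apply: IH => k kn; apply: H; exact: ltnW|exact: H].
Qed.

Lemma zero_derivative_eq (R : realType) (f : R -> R) :
  (forall t, 0 <= t <= 1 -> forall e, 0 < e -> exists2 r, 0 < r &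
     forall s, `|s| < r -> `|f (t + s) - f t| <= e * `|s|) -> f 1 = f 0.
Proof.
move=> H.
have df t : 0 <= t <= 1 -> is_derive (t : R) (1 : R) f 0.
  move=> tI.
  have cv : h^-1 *: ((f \o shift t) (h *: (1 : R)) - f t) @[h --> 0^'] --> (0 : R).
    apply/cvgrPdist_le => e e0; have [r r0 Hr] := H t tI e e0.
    rewrite near_withinE; exists r => //= s /=; rewrite sub0r normrN => sr s0.
    rewrite sub0r normrN -[s *: 1]/(s * 1) mulr1 -[_ *: _]/(s^-1 * _) normrM normfV.
    by rewrite ler_pdivrMl ?normr_gt0// mulrC /= [s + t]addrC Hr.
  by split; [apply/cvg_ex; exists 0|exact: cvg_lim].
have [||t tI] := @MVT R f (fun=> 0) 0 1 ltr01.
- by move=> x /[!in_itv]/= /andP[? ?]; apply: df; rewrite !ltW.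
- apply: continuous_in_subspaceT => x; rewrite inE/= in_itv/= => xI.
  by apply/differentiable_continuous/derivable1_diffP; case: (df x xI).
by rewrite mul0r => /eqP; rewrite subr_eq0 => /eqP.
Qed.

(** If q had derivative d <> 0 at w, a step of length t / |d| in the direction q w / d would move
    |q| to about 1 + t, against |q| = 1. With zero derivative, q is constant along every ray from
    0. *)
Lemma unimodular_cst (R : realType) (q : R[i] -> R[i]) (rho : R) :
  (forall z, normc z < rho -> cdiff q z) -> (forall z, normc z < rho -> normc (q z) = 1) ->
  q 0 = 1 -> forall z, normc z < rho -> q z = 1.
Proof.
move=> dq nq q0 z zr.
have d0 w : normc w < rho -> forall e, 0 < e -> exists2 r : R, 0 < r &
    forall h : R[i], normc h < r -> normc (q (w + h) - q w) <= e * normc h.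
  move=> wr; have /cdiffP[d Hd] := dq w wr.
  suff d0 : d = 0.
    by move=> e /Hd[r r0 Hr]; exists r => // h /Hr; rewrite d0 mulr0 subr0.
  apply: contrapT => /eqP dn0; have dp : 0 < normc d by rewrite normc_gt0.
  have [r r0 Hr] := Hd _ (divr_gt0 dp (ltr0n _ 2)).
  pose t := Num.min r (rho - normc w) * normc d / 2.
  have m0 : 0 < Num.min r (rho - normc w) by rewrite lt_min r0 subr_gt0.
  have t0 : 0 < t by rewrite divr_gt0// mulr_gt0.
  pose h := t%:C * (q w / d).
  have nh : normc h = t / normc d.
    by rewrite normcM normc_real gtr0_norm// normcM normcV nq// mul1r.
  have th : t / normc d < Num.min r (rho - normc w).
    by rewrite ltr_pdivrMr// /t ltr_pdivrMr// ltr_pMr ?ltr1n// mulr_gt0.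
  move: (th); rewrite lt_min => /andP[hr hw].
  have := Hr h; rewrite nh => /(_ hr).
  have -> : q (w + h) - q w - h * d = q (w + h) - q w * (1 + t%:C).
    by rewrite /h; field.
  move=> Hh.
  have n1 : normc (q w * (1 + t%:C)) = 1 + t.
    rewrite normcM nq// mul1r (_ : 1 + t%:C = (1 + t)%:C); last by rewrite rmorphD.
    by rewrite normc_real ger0_norm// addr_ge0// ltW.
  have n2 : normc (q (w + h)) = 1.
    by rewrite nq// (le_lt_trans (@rnormD R R[i]^o _ _))// !rnormc nh addrC -ltrBrDr.
  have := @rnorm_lip R R[i]^o (q (w + h)) (q w * (1 + t%:C)).
  rewrite !rnormc n1 n2 => /le_trans/(_ Hh).
  have -> : normc d / 2 * (t / normc d) = t / 2 by field; rewrite gt_eqF.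
  by rewrite opprD addrA subrr sub0r normrN gtr0_norm//; lra.
have ray (u : R[i] -> R) : (forall a b, u a - u b = u (a - b)) -> (forall a, `|u a| <= normc a) ->
    u (q z) = u (q 0).
  move=> uB ub; pose f (t : R) := u (q (t%:C * z)).
  have : f 1 = f 0; last by rewrite /f mul1r mul0r.
  apply: zero_derivative_eq => t /andP[t0 t1] e e0.
  have tz : normc (t%:C * z) < rho.
    rewrite normcM normc_real ger0_norm//.
    by rewrite (le_lt_trans _ zr)// ler_piMl// normc_ge0.
  have z1 : 0 < normc z + 1 by rewrite ltr_wpDl// normc_ge0.
  have [r r0 Hr] := d0 _ tz _ (divr_gt0 e0 z1).
  exists (r / (normc z + 1)); first by rewrite divr_gt0.
  move=> s; rewrite ltr_pdivlMr// => sr; rewrite /f uB (le_trans (ub _))//.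
  rewrite rmorphD/= mulrDl.
  have ns : normc (s%:C * z) <= `|s| * (normc z + 1).
    by rewrite normcM normc_real ler_wpM2l// lerDl.
  rewrite (le_trans (Hr _ (le_lt_trans ns sr)))//.
  apply: (@le_trans _ _ (e / (normc z + 1) * (`|s| * (normc z + 1)))).
    by rewrite ler_wpM2l// divr_ge0 ?ltW.
  by rewrite le_eqVlt; apply/orP; left; apply/eqP; field; rewrite gt_eqF.
have := ray (@complex.Re R) (fun a b => esym (raddfB _ a b)) (@normc_Re R).
have := ray (@complex.Im R) (fun a b => esym (raddfB _ a b)) (@normc_Im R).
by rewrite q0 => ? ?; apply/eqP; rewrite eq_complex; apply/andP; split; apply/eqP.
Qed.

(** The inequality puts mu w / mu z in the disc of radius 1 about 1, hence in the right half-plane,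
    with one step length for the whole disc of radius rho. *)
Lemma uniform_ratio (R : realType) (mu : R[i] -> R[i]) (rho : R) : rho < 1 ->
  (forall z, disc z -> cdiff mu z) -> (forall z, disc z -> mu z != 0) ->
  exists N : nat, forall z w : R[i], normc z <= rho -> normc (w - z) < N.+1%:R^-1 ->
    normc (mu w - mu z) < normc (mu z).
Proof.
move=> rho1 dmu mu0.
pose P (N : nat) (x y : R) := normc (x +i* y) <= rho -> forall w, normc (w - (x +i* y)) < N.+1%:R^-1 ->
    normc (mu w - mu (x +i* y)) < normc (mu (x +i* y)).
(* A local version at every point of the plane, vacuous beyond radius rho. Inside, both values are
   within a quarter of |mu| at the centre, so they differ by less than half of it while |mu z|
   exceeds three quarters of it. *)
have loc x0 y0 : exists2 r, 0 < r & forall N x y, `|x - x0| < r -> `|y - y0| < r ->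
    N.+1%:R^-1 < r -> P N x y.
  have [zr|zr] := leP (normc (x0 +i* y0)) rho; last first.
    exists ((normc (x0 +i* y0) - rho) / 2); first by rewrite divr_gt0// subr_gt0.
    move=> N x y xr yr _; rewrite /P leNgt => /negP[].
    have := @rnorm_lip R R[i]^o (x +i* y) (x0 +i* y0).
    rewrite ler_distl !rnormc => /andP[+ _]; apply: lt_le_trans.
    have := normc_pair x y x0 y0; move: xr yr.
    by set a := normc (_ - _); set b := normc _; set c := `| _ |; set d := `| _ |; lra.
  have D0 : disc (x0 +i* y0) by apply/discE; exact: le_lt_trans zr rho1.
  have m0 : 0 < normc (mu (x0 +i* y0)) by rewrite normc_gt0 mu0.
  have [r r0 Hr] := @derivable_cont R R[i]^o mu _ (dmu _ D0) _ (divr_gt0 m0 (ltr0n _ 4)).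
  exists (r / 3); first by rewrite divr_gt0.
  move=> N x y xr yr Nr _ w wN.
  have zz : normc ((x +i* y) - (x0 +i* y0)) < 2 * (r / 3).
    by rewrite (le_lt_trans (normc_pair _ _ _ _))// mulrDl mul1r ltrD.
  have H1 := Hr ((x +i* y) - (x0 +i* y0)).
  have H2 := Hr (w - (x0 +i* y0)).
  rewrite [_ + (_ - _)]addrC subrK rnormc in H1.
  rewrite [_ + (_ - _)]addrC subrK rnormc in H2.
  have {}H1 := H1 (lt_trans zz _).
  have {}H1 : normc (mu (x +i* y) - mu (x0 +i* y0)) < normc (mu (x0 +i* y0)) / 4.
    by apply: H1; lra.
  have {}H2 : normc (mu w - mu (x0 +i* y0)) < normc (mu (x0 +i* y0)) / 4.
    apply: H2; rewrite -(subrK (x +i* y) w) -addrA (le_lt_trans (@rnormD R R[i]^o _ _))// !rnormc.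
    have := lt_trans wN Nr; move: zz.
    by set a := normc (_ - _); set b := normc (_ - _); lra.
  have H3 := @rnorm_lip R R[i]^o (mu (x +i* y)) (mu (x0 +i* y0)).
  rewrite ler_distl !rnormc in H3; move/andP: H3 => [H3 _].
  rewrite -(subrK (mu (x0 +i* y0)) (mu w)) -addrA (le_lt_trans (@rnormD R R[i]^o _ _))// !rnormc.
  rewrite -[X in _ + X](@rnormN R R[i]^o) opprB rnormc.
  move: H1 H2 H3 m0; set a := normc _; set b := normc _; set c := normc _; set d := normc _.
  by lra.
have small r : 0 < r -> \forall N \near \oo, (N.+1%:R^-1 : R) < r.
  by move=> r0; exact: near_infty_natSinv_lt (PosNum r0).
(* Compactness is used one coordinate at a time: first in y, with x and N as parameters, then in
   x. *)
have CY (x0 : R) : \forall x \near x0 & N \near \oo, forall y : R, y \in `[-1, 1]%classic -> P N x y.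
  pose PP (i : R * nat) (y : R) := P i.2 i.1 y.
  have /compact_near_coveringP/(_ _ (filter_prod (nbhs x0) \oo) PP) := @segment_compact R (-1) 1.
  have : forall y : R, `[-1, 1]%classic y -> \forall y' \near y & i \near filter_prod (nbhs x0) \oo, PP i y'.
    move=> y0 _; have [r r0 Hr] := loc x0 y0.
    exists ([set y | `|y - y0| < r], [set i : R * nat | `|i.1 - x0| < r /\ i.2.+1%:R^-1 < r]) => /=.
      split; first by exists r => //= y /=; rewrite distrC.
      exists ([set x | `|x - x0| < r], [set N : nat | N.+1%:R^-1 < r]) => //=.
      split; [by exists r => //= y /=; rewrite distrC|exact: small].
    by move=> [y [x N]] /= [yr [xr Nr]]; exact: Hr.
  move=> /[swap] /[apply]; apply: filterS => -[x N] H y /set_mem yI; exact: (H y yI).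
have : \forall N \near \oo, `[-1, 1]%classic `<=` (fun x : R => forall y : R, y \in `[-1, 1]%classic -> P N x y).
  have /compact_near_coveringP := @segment_compact R (-1) 1.
  by apply => x0 _; exact: CY.
move=> [N _ HN]; exists N => -[x y] w zr.
apply: (HN N (leqnn N) x _ y _ zr).
  rewrite /= in_itv/= -ler_norml (le_trans (normc_Re (x +i* y)))//.
  by rewrite (le_trans zr)// ltW.
rewrite inE/= in_itv/= -ler_norml (le_trans (normc_Im (x +i* y)))//.
by rewrite (le_trans zr)// ltW.
Qed.

(** Continuation of a p-th root along the segment from 0 to z in n steps, each by the principal root
    of a ratio of consecutive values. The moduli telescope. The first factor uses |mu 0|, so this is
    a root of mu only up to a unimodular constant, and it is positive at 0. *)
Definition ray_root (R : realType) (mu : R[i] -> R[i]) (p : R) (n : nat) (z : R[i]) : R[i] :=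
  (normc (mu 0) `^ p^-1)%:C *
  \prod_(k < n) croot p (mu ((k.+1%:R / n%:R)%:C * z) / mu ((k%:R / n%:R)%:C * z)).

Lemma ray_rootP (R : realType) (mu : R[i] -> R[i]) (p rho : R) : 0 < p -> rho < 1 ->
  (forall z, disc z -> cdiff mu z) -> (forall z, disc z -> mu z != 0) ->
  exists n, [/\ forall z, normc z < rho -> cdiff (ray_root mu p n) z,
    forall z, normc z < rho -> normc (ray_root mu p n z) = normc (mu z) `^ p^-1
    & ray_root mu p n 0 = (normc (mu 0) `^ p^-1)%:C].
Proof.
move=> p0 rho1 dmu mu0; have [N HN] := uniform_ratio rho1 dmu mu0; exists N.+1.
have n0 : 0 < N.+1%:R :> R by rewrite ltr0n.
pose s (k : nat) : R := k%:R / N.+1%:R.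
have s0 k : 0 <= s k by rewrite divr_ge0.
have sz k z : (k <= N.+1)%N -> normc ((s k)%:C * z) <= normc z.
  move=> kn; rewrite normcM normc_real ger0_norm// ler_piMl ?normc_ge0//.
  by rewrite ler_pdivrMr// mul1r ler_nat.
have Dsz k z : (k <= N.+1)%N -> normc z < rho -> disc ((s k)%:C * z).
  by move=> kn zr; apply/discE; rewrite (le_lt_trans (sz _ _ kn))// (lt_trans zr).
have D0 : disc (0 : R[i]) by apply/discE; rewrite normc0.
have mu00 : 0 < normc (mu 0) by rewrite normc_gt0 mu0.
have good k z : (k < N.+1)%N -> normc z < rho ->
    0 < complex.Re (mu ((s k.+1)%:C * z) / mu ((s k)%:C * z)).
  move=> kn zr; have Dk := Dsz k z (ltnW kn) zr; have mk := mu0 _ Dk.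
  have mk0 : 0 < normc (mu ((s k)%:C * z)) by rewrite normc_gt0.
  have : normc (mu ((s k.+1)%:C * z) - mu ((s k)%:C * z)) < normc (mu ((s k)%:C * z)).
    apply: HN; first by rewrite (le_trans (sz _ _ (ltnW kn)))// ltW.
    rewrite -mulrBl -rmorphB normcM normc_real.
    have -> : s k.+1 - s k = N.+1%:R^-1 by rewrite /s -mulrBl -natrB// subSnn mul1r.
    rewrite ger0_norm ?invr_ge0// gtr_pMr ?invr_gt0//.
    exact: lt_trans zr rho1.
  set a := mu _; set b := mu _ in mk mk0 *.
  have -> : a / b = 1 + (a - b) / b by field.
  move=> ab; have ab1 : normc ((a - b) / b) < 1.
    by rewrite normcM normcV ltr_pdivrMr// mul1r.
  rewrite raddfD/= -ltrBlDl sub0r.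
  by have := le_lt_trans (normc_Re _) ab1; rewrite ltr_norml => /andP[].
split.
- move=> z zr; apply: cdiffM; first exact: cdiff_cst.
  apply: (@cdiff_prod R N.+1 (fun k z => croot p (mu ((s k.+1)%:C * z) / mu ((s k)%:C * z)))).
  move=> k kn.
  have dmus m : (m <= N.+1)%N -> cdiff (fun x => mu ((s m)%:C * x)) z.
    move=> mn; apply: (@cdiff_comp R (fun x => (s m)%:C * x) mu).
      by apply: cdiffM; [exact: cdiff_cst|exact: cdiff_id].
    by apply: dmu; exact: Dsz.
  apply: (@cdiff_comp R (fun x => mu ((s k.+1)%:C * x) / mu ((s k)%:C * x)) (croot p)).
    apply: cdiffM; first exact: dmus.
    by apply: cdiffV; [apply: mu0; apply: Dsz => //; exact: ltnW|apply: dmus; exact: ltnW].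
  by apply: cdiff_croot; exact: good.
- move=> z zr; rewrite normcM normc_real ger0_norm ?powR_ge0//.
  have H m : (m <= N.+1)%N -> normc (mu 0) `^ p^-1 *
      normc (\prod_(k < m) croot p (mu ((s k.+1)%:C * z) / mu ((s k)%:C * z))) =
      normc (mu ((s m)%:C * z)) `^ p^-1.
    elim: m => [_|m IH mn]; first by rewrite big_ord0 normc1 mulr1 /s mul0r mul0r.
    rewrite big_ord_recr /= normcM mulrA IH; last exact: ltnW.
    have mk := mu0 _ (Dsz m z (ltnW mn) zr).
    rewrite normc_croot; last exact: good.
    rewrite -powRM ?normc_ge0// -normcM; congr (normc _ `^ _).
    by field.
  by rewrite H// /s divff ?mul1r// gt_eqF.
rewrite /ray_root big1 ?mulr1// => k _; rewrite !mulr0 divff ?croot1//.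
exact: mu0.
Qed.

(** The number of steps in [ray_root] depends on the radius. Two of these functions agree on their
    common disc, since their quotient is unimodular and equals 1 at 0, so they glue to one
    function. *)
Lemma analytic_root (R : realType) (mu : R[i] -> R[i]) (p : R) : 0 < p ->
  (forall z, disc z -> cdiff mu z) -> (forall z, disc z -> mu z != 0) ->
  exists h : R[i] -> R[i], (forall z, disc z -> cdiff h z) /\
    (forall z, disc z -> normc (h z) `^ p = normc (mu z)).
Proof.
move=> p0 dmu mu0.
have D0 : disc (0 : R[i]) by apply/discE; rewrite normc0.
pose rho (k : nat) : R := 1 - k.+1%:R^-1.
have rho1 k : rho k < 1 by rewrite gtrBl invr_gt0.
have [n Hn] := choice (fun k => @ray_rootP R mu p (rho k) p0 (rho1 k) dmu mu0).
pose H k := ray_root mu p (n k).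
have nH0 k z : normc z < rho k -> H k z != 0.
  move=> zr; have [_ nz _] := Hn k; rewrite -normc_gt0 nz//.
  rewrite powR_gt0// normc_gt0 mu0//; apply/discE.
  exact: lt_trans zr (rho1 k).
have HH k l z : normc z < rho k -> normc z < rho l -> H k z = H l z.
  move=> zk zl; have [dk nk k0] := Hn k; have [dl nl l0] := Hn l.
  have := @unimodular_cst R (fun z => H k z / H l z) (Num.min (rho k) (rho l)).
  move=> U; have {U} : H k z / H l z = 1.
    apply: U; last by rewrite lt_min zk.
    - move=> w; rewrite lt_min => /andP[wk wl]; apply: cdiffM; first exact: dk.
      by apply: cdiffV; [exact: nH0|exact: dl].
    - move=> w; rewrite lt_min => /andP[wk wl]; rewrite normcM normcV.
      rewrite -[RHS](@divff _ (normc (H l w))) ?normc_eq0 ?nH0//.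
      by congr (_ / _); rewrite /H nk// nl.
    - rewrite /H k0 l0 divff// fmorph_eq0 powR_eq0 normc_eq0 negb_and.
      by rewrite mu0.
  by move/divr1_eq.
have ex z : exists k, disc z -> normc z < rho k.
  have [/discE zD|] := pselect (disc z); last by exists 0%N.
  have : 0 < 1 - normc z by rewrite subr_gt0.
  move=> e0; have [k _ Hk] := near_infty_natSinv_lt (PosNum e0).
  exists k => _; have := Hk k (leqnn k).
  by rewrite /rho /= ltrBrDl -ltrBrDr.
have [K HK] := choice ex.
exists (fun z => H (K z) z); split => z Dz; last first.
  have [_ nk _] := Hn (K z); rewrite /H nk ?HK// -powRrM mulVf ?gt_eqF// powRr1//.
  exact: normc_ge0.
apply: (@cdiff_local R (H (K z))); last by have [dk _ _] := Hn (K z); exact/dk/HK.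
have zK := HK z Dz; exists (rho (K z) - normc z); first by rewrite subr_gt0.
move=> k; rewrite ltrBrDl => zk.
have zk' : normc (z + k) < rho (K z) by exact: le_lt_trans (@rnormD R R[i]^o _ _) zk.
by apply: HH => //; apply: HK; apply/discE; exact: lt_trans zk' (rho1 _).
Qed.

(** * The Hahn-Banach theorem *)

(* Partial functionals are represented by their graphs; the norm bound makes these single-valued. *)
Definition normed_graph (R : realType) (X : normedModType R[i]) (G : set (X * R)) : Prop :=
  (forall (r : R) u w, G u -> G w -> G (r%:C *: u.1 + w.1, r * u.2 + w.2)) /\
  (forall u, G u -> u.2 <= rnorm u.1).

(** The value c at x1 must lie between all numbers u.2 - |u.1 - x1| and all numbers |w.1 + x1| -
    w.2; the triangle inequality separates the two sets. Positive and negative multiples of x1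
    reduce to these by scaling. *)
Lemma normed_graph_extend (R : realType) (X : normedModType R[i]) (G : set (X * R)) (x1 : X) :
  normed_graph G -> G (0, 0) ->
  exists G', [/\ normed_graph G', G `<=` G' & exists c, G' (x1, c)].
Proof.
move=> [Glin Gle] G0.
pose S := [set b | exists2 u, G u & b = u.2 - rnorm (u.1 - x1)].
have SU u w : G u -> G w -> u.2 - rnorm (u.1 - x1) <= rnorm (w.1 + x1) - w.2.
  move=> Gu Gw; have := Gle _ (Glin 1 u w Gu Gw).
  rewrite /= scale1r mul1r lerBlDr addrAC lerBrDr => /le_trans; apply.
  rewrite (_ : u.1 + w.1 = (w.1 + x1) + (u.1 - x1)) ?rnormD//.
  by rewrite addrACA subrr addr0 addrC.
have Sub : has_sup S.
  split; first by exists (0 - rnorm (0 - x1)), (0, 0).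
  by exists (rnorm (0 + x1) - 0) => _ [u Gu ->]; exact: (SU u (0, 0)).
pose c := sup S.
have cl u : G u -> u.2 - rnorm (u.1 - x1) <= c.
  by move=> Gu; apply: ub_le_sup; [case: Sub|exists u].
have cr w : G w -> c <= rnorm (w.1 + x1) - w.2.
  move=> Gw; apply: ge_sup; first by case: Sub.
  by move=> _ [u Gu ->]; exact: SU.
have Gs r u : G u -> G (r%:C *: u.1, r * u.2).
  by move=> Gu; have := Glin r u _ Gu G0; rewrite /= !addr0.
exists [set u | exists w r, G w /\ u = (w.1 + r%:C *: x1, w.2 + r * c)]; split.
- split=> [r _ _ [u [s [Gu ->]]] [w [t [Gw ->]]]|_ [w [r [Gw ->]]]] /=.
    exists (r%:C *: u.1 + w.1, r * u.2 + w.2), (r * s + t); split; first exact: Glin.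
    rewrite /=; congr (_, _); last by ring.
    by rewrite scalerDr scalerA -rmorphM/= rmorphD/= scalerDl addrACA.
  have [r0|r0|<-] := ltgtP 0 r; last by rewrite mul0r addr0 scale0r addr0 Gle.
    have r0' : r != 0 by rewrite gt_eqF.
    have := cr _ (Gs r^-1 w Gw); rewrite /= lerBrDr -(ler_pM2l r0) mulrDr mulrA divff// mul1r.
    rewrite addrC => /le_trans; apply.
    rewrite -{1}(gtr0_norm r0) -normc_real -rnormZ scalerDr scalerA -rmorphM/= divff//.
    by rewrite scale1r.
  have s0 : 0 < - r by rewrite oppr_gt0.
  have s0' : - r != 0 by rewrite gt_eqF.
  have := cl _ (Gs (- r)^-1 w Gw); rewrite /= lerBlDr -(ler_pM2l s0) mulrDr mulrA divff// mul1r.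
  rewrite mulNr addrC -lerBlDr opprK => /le_trans; apply.
  rewrite -{1}(gtr0_norm s0) -normc_real -rnormZ scalerBr scalerA -rmorphM/= divff//.
  by rewrite scale1r rmorphN/= scaleNr opprK.
- by move=> u Gu; exists u, 0; split=> //; rewrite scale0r mul0r !addr0; case: u Gu.
- by exists c, (0, 0), 1; split=> //; rewrite /= !add0r scale1r mul1r.
Qed.

Lemma real_hahn_banach (R : realType) (X : normedModType R[i]) (x0 : X) :
  exists f : X -> R, [/\ forall r x y, f (r%:C *: x + y) = r * f x + f y,
    forall x, f x <= rnorm x & f x0 = rnorm x0].
Proof.
pose G0 : set (X * R) := [set u | exists r : R, u = (r%:C *: x0, r * rnorm x0)].
have G0g : normed_graph G0.
  split=> [r _ _ [s ->] [t ->]|_ [r ->]] /=.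
    exists (r * s + t); rewrite scalerA -rmorphM rmorphD/= scalerDl.
    by congr (_, _); ring.
  by rewrite rnormZ normc_real ler_wpM2r ?rnorm_ge0// ler_norm.
pose P (G : set (X * R)) := G = set0 \/ (normed_graph G /\ G0 `<=` G).
have [A [PA Amax]] : exists A, P A /\ forall B, A `<` B -> ~ P B.
  apply: Zorn_bigcup => F FP Ftot.
  have [[G [FG [u0 Gu0]]]|none] := pselect (exists G, F G /\ G !=set0); last first.
    left; apply/seteqP; split=> // u [G FG Gu]; apply: none; exists G; split => //.
    by exists u.
  right.
  have good H : F H -> forall u, H u -> normed_graph H /\ G0 `<=` H.
    by move=> FH u Hu; case: (FP _ FH) => // H0; move: Hu; rewrite H0.
  split; last first.
    by move=> u G0u; exists G => //; have [_] := good _ FG _ Gu0; exact.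
  split=> [r u w [H FH Hu] [K FK Kw]|u [H FH Hu]]; last by have [[_ +] _] := good _ FH _ Hu; exact.
  have [HK|KH] := Ftot _ _ FH FK.
    by exists K => //; have [[+ _] _] := good _ FK _ Kw; apply => //; exact: HK.
  by exists H => //; have [[+ _] _] := good _ FH _ Hu; apply => //; exact: KH.
have {PA}[Ag G0A] : normed_graph A /\ G0 `<=` A.
  case: PA => // A0; exfalso; apply: (Amax G0); last by right; split.
  rewrite A0; split=> // /(_ (0, 0)); apply; exists 0.
  by rewrite scale0r mul0r.
have A00 : A (0, 0) by apply: G0A; exists 0; rewrite scale0r mul0r.
have tot x : exists a, A (x, a).
  apply: contrapT => nA; have [G' [G'g AG' [c G'c]]] := normed_graph_extend x Ag A00.
  apply: (Amax G'); last by right; split=> //; exact: subset_trans AG'.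
  by split=> // /(_ _ G'c) Axc; apply: nA; exists c.
have [f Hf] := choice tot; have [Alin Ale] := Ag.
have fun_A x a b : A (x, a) -> A (x, b) -> a = b.
  move=> Aa Ab; have H c d : A (x, c) -> A (x, d) -> d <= c.
    move=> Ac Ad; have := Ale _ (Alin (- 1) _ _ Ac Ad).
    by rewrite /= rmorphN scaleN1r addNr rnorm0 mulN1r addrC subr_le0.
  by apply/le_anti; rewrite !H.
exists f; split=> [r x y|x|].
- apply: (fun_A (r%:C *: x + y)) => //.
  exact: (Alin r (x, f x) (y, f y)).
- exact: (Ale (x, f x)).
- by apply: (fun_A x0) => //; apply: G0A; exists 1; rewrite scale1r mul1r.
Qed.

(** The complex functional is f(x) - i f(i x). Its modulus at x is the value of f at a rotation of
    x, so the real bound carries over. *)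
Lemma hahn_banach (R : realType) (X : normedModType R[i]) (x0 : X) :
  exists2 xs : {linear X -> R[i]^o}, forall x, normc (xs x) <= rnorm x
    & normc (xs x0) = rnorm x0.
Proof.
have [f [flin fle fx0]] := real_hahn_banach x0.
have f0 : f 0 = 0.
  by have := flin 1 0 0; rewrite scaler0 addr0 mul1r; lra.
have fD x y : f (x + y) = f x + f y by have := flin 1 x y; rewrite scale1r mul1r.
have fZ (r : R) x : f (r%:C *: x) = r * f x by rewrite -[_ *: x]addr0 flin f0 addr0.
have fN x : f (- x) = - f x by rewrite -scaleN1r -(rmorphN1 (real_complex R)) fZ mulN1r.
pose F (x : X) : R[i]^o := f x +i* (- f ('i%C *: x)).
have FD x y : F (x + y) = F x + F y.
  by rewrite /F fD scalerDr fD opprD.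
have FZ (a : R[i]) x : F (a *: x) = a * F x.
  have fa b : f (a *: b) = complex.Re a * f b + complex.Im a * f ('i%C *: b).
    by rewrite {1}[a]complexE scalerDl fD fZ [_ * (complex.Im a)%:C]mulrC -scalerA fZ.
  rewrite /F scalerA [_ * a]mulrC -scalerA !fa scalerA.
  have -> : 'i%C * 'i%C = (- 1)%:C :> R[i].
    by apply/eqP; rewrite eq_complex /= !mulr0 !mul0r mulr1 sub0r addr0 !eqxx.
  rewrite fZ; case: a {fa} => a b /=.
  by apply/eqP; rewrite eq_complex /=; apply/andP; split; apply/eqP; ring.
have Flin : linear F by move=> a x y; rewrite FD FZ.
pose Fl := GRing.isLinear.Build _ _ _ _ F Flin.
pose xs : {linear X -> R[i]^o} := HB.pack F Fl.
have xsF x : xs x = F x by [].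
have le x : normc (F x) <= rnorm x.
  have [->|Fx0] := eqVneq (F x) 0; first by rewrite normc0 rnorm_ge0.
  pose u := (normc (F x))%:C / F x.
  have nu : normc u = 1.
    by rewrite normcM normcV normc_real ger0_norm ?normc_ge0// divff// normc_eq0.
  have : F (u *: x) = (normc (F x))%:C by rewrite FZ /u divfK.
  move/(congr1 (@complex.Re R)) => /= <-.
  by rewrite (le_trans (fle _))// rnormZ nu mul1r.
exists xs => // ; apply/eqP; rewrite eq_le le/= -fx0.
by rewrite (le_trans (ler_norm _))// (normc_Re (F x0)).
Qed.

(** * The Dvoretzky-Rogers lemma *)

(** Forward substitution: e_N is killed by all earlier f_i, so the last coefficient can correct f_N
    without spoiling the earlier equations. *)
Lemma biorthogonal_elim (R : realType) (X : normedModType R[i]) (N : nat)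
    (e : nat -> X) (f : nat -> {linear X -> R[i]^o}) :
  (forall i, (i < N)%N -> f i (e i) != 0) ->
  (forall i j, (i < j < N)%N -> f i (e j) = 0) ->
  forall x, exists a : nat -> R[i], forall i, (i < N)%N -> f i (x - \sum_(j < N) a j *: e j) = 0.
Proof.
elim: N => [|N IH] fe fe0 x; first by exists (fun=> 0).
have [i iN|i j /andP[ij jN]|a Ha] := IH _ _ x.
- by apply: fe; exact: ltnW.
- by apply: fe0; rewrite ij ltnW.
pose y := x - \sum_(j < N) a j *: e j.
exists (fun j => if j == N then f N y / f N (e N) else a j) => i iN.
rewrite big_ord_recr /= eqxx opprD addrA.
rewrite (eq_bigr (fun j : 'I_N => a j *: e j)); last by move=> j _; rewrite ltn_eqF.
rewrite -/y linearB linearZ /=; move: iN; rewrite ltnS leq_eqVlt => /predU1P[->|iN].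
  by rewrite -[_ *: _]/(_ * _) divfK ?subrr// fe.
by rewrite Ha// (fe0 i N) ?iN ?ltnSn// scaler0 subrr.
Qed.

(** Infinite dimension enters here: if no nonzero vector were killed by f_0, ..., f_(N-1), then e_0,
    ..., e_(N-1) would span X. The next functional norms such a vector. The triangular matrix
    f_i(e_j) gives [contraction_maximizer] a nonzero determinant. *)
Lemma biorthogonal_exists (R : realType) (X : normedModType R[i]) :
  ~ finite_dimensional X -> forall N, exists (e : nat -> X) (f : nat -> {linear X -> R[i]^o}),
  [/\ forall i, (i < N)%N -> f i (e i) != 0, forall i j, (i < j < N)%N -> f i (e j) = 0
    & forall i x, (i < N)%N -> normc (f i x) <= rnorm x].
Proof.
move=> hX; elim=> [|N [e [f [fe fe0 fle]]]].
  by exists (fun=> 0), (fun=> \0%R); split => // i j; rewrite ltn0 andbF.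
have [y y0 fy] : exists2 y : X, y != 0 & forall i, (i < N)%N -> f i y = 0.
  apply: contrapT => H; apply: hX; exists N, (fun i => e i) => x.
  have [a Ha] := biorthogonal_elim fe fe0 x; exists (fun i => a i).
  apply/eqP; rewrite -subr_eq0; apply/negPn/negP => y0; apply: H.
  by exists (x - \sum_(i < N) a i *: e i).
have [g gle gy] := hahn_banach y.
exists (fun k => if k == N then y else e k), (fun k => if k == N then g else f k); split.
- move=> i; rewrite ltnS leq_eqVlt => /predU1P[->|iN].
    by rewrite eqxx -normc_eq0 gy rnorm_eq0.
  by rewrite ltn_eqF// fe.
- move=> i j /andP[ij]; rewrite ltnS leq_eqVlt => /predU1P[jN|jN].
    by rewrite jN eqxx ltn_eqF ?fy//; rewrite -jN.
  by rewrite !ltn_eqF//; [rewrite fe0// ij|exact: ltn_trans jN].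
- move=> i x; rewrite ltnS leq_eqVlt => /predU1P[->|iN]; first by rewrite eqxx.
  by rewrite ltn_eqF// fle.
Qed.

Definition cdot (R : realType) (N : nat) (a b : 'rV[R[i]]_N) : R[i] :=
  \sum_j a 0 j * conjc (b 0 j).

Definition nrm2 (R : realType) (N : nat) (a : 'rV[R[i]]_N) : R := \sum_j normc (a 0 j) ^+ 2.

Lemma nrm2_ge0 (R : realType) (N : nat) (a : 'rV[R[i]]_N) : 0 <= nrm2 a.
Proof. by apply: sumr_ge0 => j _; exact: sqr_ge0. Qed.

Lemma mulcJ (R : realType) (z : R[i]) : z * conjc z = (normc z ^+ 2)%:C.
Proof.
by rewrite normc_sqr; case: z => a b; apply/eqP; rewrite eq_complex /=; apply/andP; split; apply/eqP; ring.
Qed.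

Lemma cdot_nrm2 (R : realType) (N : nat) (a : 'rV[R[i]]_N) : cdot a a = (nrm2 a)%:C.
Proof. by rewrite /nrm2 rmorph_sum /=; apply: eq_bigr => j _; rewrite mulcJ. Qed.

Lemma nrm2_eq0 (R : realType) (N : nat) (a : 'rV[R[i]]_N) : nrm2 a = 0 -> a = 0.
Proof.
move=> /eqP; rewrite psumr_eq0; last by move=> j _; exact: sqr_ge0.
move=> /allP H; apply/rowP => j; rewrite mxE.
have := H j (mem_index_enum _); rewrite /= sqrf_eq0 normc_eq0.
by move/eqP.
Qed.

Lemma cdotDl (R : realType) (N : nat) (a b c : 'rV[R[i]]_N) : cdot (a + b) c = cdot a c + cdot b c.
Proof. by rewrite -big_split; apply: eq_bigr => j _; rewrite mxE mulrDl. Qed.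

Lemma cdotZl (R : realType) (N : nat) k (a c : 'rV[R[i]]_N) : cdot (k *: a) c = k * cdot a c.
Proof. by rewrite /cdot mulr_sumr; apply: eq_bigr => j _; rewrite mxE mulrA. Qed.

Lemma cdotC (R : realType) (N : nat) (a b : 'rV[R[i]]_N) : cdot a b = conjc (cdot b a).
Proof. by rewrite rmorph_sum; apply: eq_bigr => j _; rewrite rmorphM/= conjcK mulrC. Qed.

Lemma cdotDr (R : realType) (N : nat) (a b c : 'rV[R[i]]_N) : cdot c (a + b) = cdot c a + cdot c b.
Proof. by rewrite cdotC cdotDl rmorphD /= -!cdotC. Qed.

Lemma cdot_suml (R : realType) (N k : nat) (c : nat -> R[i]) (e : nat -> 'rV[R[i]]_N) (b : 'rV[R[i]]_N) :
  cdot (\sum_(i < k) c i *: e i) b = \sum_(i < k) c i * cdot (e i) b.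
Proof.
elim: k => [|k IH].
  by rewrite !big_ord0 /cdot big1// => j _; rewrite mxE mul0r.
by rewrite !big_ord_recr /= cdotDl IH cdotZl.
Qed.

Definition orthonormal_upto (R : realType) (N k : nat) (e : nat -> 'rV[R[i]]_N) : Prop :=
  forall i j, (i < k)%N -> (j < k)%N -> cdot (e i) (e j) = (i == j)%:R.

Lemma nrm2_orthonormal (R : realType) (N k : nat) (e : nat -> 'rV[R[i]]_N) (c : nat -> R[i]) :
  orthonormal_upto k e -> nrm2 (\sum_(i < k) c i *: e i) = \sum_(i < k) normc (c i) ^+ 2.
Proof.
move=> eo; apply: (@complexI R); rewrite -cdot_nrm2 cdot_suml rmorph_sum /=.
apply: eq_bigr => i _; rewrite -mulcJ cdotC cdot_suml (bigD1 i)//= eo// eqxx mulr1 big1 ?addr0//.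
by move=> j ji; rewrite eo// (negPf (_ : val j != val i))// mulr0.
Qed.

Definition proj (R : realType) (N k : nat) (e : nat -> 'rV[R[i]]_N) (a : 'rV[R[i]]_N) :=
  \sum_(i < k) cdot a (e i) *: e i.

Lemma cdot_proj (R : realType) (N k : nat) (e : nat -> 'rV[R[i]]_N) (a b : 'rV[R[i]]_N) :
  cdot (proj k e a) b = \sum_(i < k) cdot a (e i) * cdot (e i) b.
Proof. exact: (@cdot_suml R N k (fun i => cdot a (e i))). Qed.

Lemma proj_orth (R : realType) (N k : nat) (e : nat -> 'rV[R[i]]_N) (a : 'rV[R[i]]_N) :
  orthonormal_upto k e -> forall j, (j < k)%N -> cdot (a - proj k e a) (e j) = 0.
Proof.
move=> eo j jk; rewrite cdotDl -scaleN1r cdotZl cdot_proj.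
rewrite (bigD1 (Ordinal jk))//= eo// eqxx mulr1 big1 ?addr0 ?mulN1r ?subrr// => l lj.
by rewrite eo// (negPf (_ : val l != j)) ?mulr0.
Qed.

Lemma proj_nrm2 (R : realType) (N k : nat) (e : nat -> 'rV[R[i]]_N) (a : 'rV[R[i]]_N) :
  orthonormal_upto k e -> nrm2 (a - proj k e a) <= nrm2 a.
Proof.
move=> eo; set b := a - proj k e a.
have bp : cdot (proj k e a) b = 0.
  rewrite cdot_proj big1// => i _; rewrite [cdot (e i) b]cdotC proj_orth//.
  by rewrite conjc0 mulr0.
have : (nrm2 a)%:C = (nrm2 b + nrm2 (proj k e a))%:C.
  rewrite rmorphD /= -!cdot_nrm2; have -> : cdot a a = cdot (b + proj k e a) (b + proj k e a).
    by rewrite subrK.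
  rewrite cdotDl (cdotDr b _ b) (cdotDr b _ (proj k e a)).
  by rewrite bp [cdot b (proj _ _ _)]cdotC bp conjc0 add0r addr0.
by move/complexI => ->; rewrite lerDl nrm2_ge0.
Qed.

(** B A is a projection of rank k, so 2 - B A doubles its kernel and fixes its range. Two
    factorizations of one block matrix give the determinant without a change of basis. *)
Lemma det_sylvester (F : fieldType) (N k : nat) (A : 'M[F]_(k, N)) (B : 'M[F]_(N, k)) :
  2 != 0 :> F -> A *m B = 1%:M -> \det (2%:M - B *m A) = 2 ^+ N / 2 ^+ k.
Proof.
move=> two0 AB; transitivity (\det (block_mx 1%:M A B 2%:M)).
  have -> : block_mx 1%:M A B 2%:M =
      block_mx 1%:M 0 B 1%:M *m block_mx 1%:M A 0 (2%:M - B *m A).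
    rewrite mulmx_block !mulmx1 !mul1mx ?mulmx0 ?mul0mx ?addr0 ?mulmx0 ?mul0mx ?addr0.
    by rewrite [B *m A + _]addrC subrK.
  by rewrite det_mulmx det_lblock det_ublock !det1 !mul1r.
have -> : block_mx 1%:M A B 2%:M =
    block_mx (2^-1)%:M (2^-1 *: A) 0 1%:M *m block_mx 1%:M 0 B 2%:M.
  rewrite mulmx_block ?mulmx1 ?mul1mx ?mulmx0 ?mul0mx ?add0r ?mulmx1 ?mul1mx -scalemxAl AB.
  congr block_mx; last 1 first.
    by rewrite mul_mx_scalar scalerA divff// scale1r.
  have h : 2^-1 + 2^-1 = 1 :> F by field.
  by rewrite scalemx1 -raddfD /= h.
by rewrite det_mulmx det_ublock det_lblock !det1 !det_scalar mul1r mulr1 mulrC exprVn.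
Qed.

Definition lincomb (R : realType) (X : normedModType R[i]) (N : nat) (y : 'I_N -> X)
  (a : 'rV[R[i]]_N) : X := \sum_j a 0 j *: y j.

(* [a |-> lincomb y a] is a contraction from l^2 to X. *)
Definition contraction (R : realType) (X : normedModType R[i]) (N : nat) (y : 'I_N -> X) : Prop :=
  forall a : 'rV[R[i]]_N, rnorm (lincomb y a) ^+ 2 <= nrm2 a.

Lemma lincombD (R : realType) (X : normedModType R[i]) (N : nat) (y : 'I_N -> X) a b :
  lincomb y (a + b) = lincomb y a + lincomb y b.
Proof. by rewrite -big_split; apply: eq_bigr => j _; rewrite mxE scalerDl. Qed.

Lemma lincombZ (R : realType) (X : normedModType R[i]) (N : nat) (y : 'I_N -> X) k a :
  lincomb y (k *: a) = k *: lincomb y a.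
Proof. by rewrite scaler_sumr; apply: eq_bigr => j _; rewrite mxE scalerA. Qed.

Lemma lincomb_sum (R : realType) (X : normedModType R[i]) (N k : nat) (y : 'I_N -> X)
    (c : nat -> R[i]) (e : nat -> 'rV[R[i]]_N) :
  lincomb y (\sum_(i < k) c i *: e i) = \sum_(i < k) c i *: lincomb y (e i).
Proof.
elim: k => [|k IH]; last by rewrite !big_ord_recr /= lincombD lincombZ IH.
by rewrite !big_ord0 /lincomb big1// => j _; rewrite mxE scale0r.
Qed.

Lemma nrm2Z (R : realType) (N : nat) k (a : 'rV[R[i]]_N) : nrm2 (k *: a) = normc k ^+ 2 * nrm2 a.
Proof. by rewrite /nrm2 mulr_sumr; apply: eq_bigr => j _; rewrite mxE normcM exprMn. Qed.

Lemma normc_coord (R : realType) (N : nat) (a : 'rV[R[i]]_N) j : normc (a 0 j) ^+ 2 <= nrm2 a.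
Proof. by rewrite /nrm2 (bigD1 j)//= lerDl sumr_ge0// => i _; exact: sqr_ge0. Qed.

Lemma contraction_le1 (R : realType) (X : normedModType R[i]) (N : nat) (y : 'I_N -> X) j :
  contraction y -> rnorm (y j) <= 1.
Proof.
move=> yc; have := yc (delta_mx 0 j).
have -> : lincomb y (delta_mx 0 j) = y j.
  rewrite /lincomb (bigD1 j)//= mxE !eqxx scale1r big1 ?addr0// => i ij.
  by rewrite mxE (negPf ij) andbF scale0r.
have -> : nrm2 (delta_mx 0 j : 'rV[R[i]]_N) = 1.
  rewrite /nrm2 (bigD1 j)//= mxE !eqxx normc1 expr1n big1 ?addr0// => i ij.
  by rewrite mxE (negPf ij) andbF normc0 expr0n.
by rewrite -[leRHS](expr1n R 2) ler_pXn2r ?nnegrE ?rnorm_ge0.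
Qed.

(** A crude bound from the Leibniz expansion; it makes the supremum over contractions finite. *)
Lemma normc_det_le (R : realType) (N : nat) (M : 'M[R[i]]_N) :
  (forall i j, normc (M i j) <= 1) -> normc (\det M) <= #|{: {perm 'I_N}}|%:R.
Proof.
move=> M1; rewrite /determinant -rnormc (le_trans (@rnorm_sum R R[i]^o _ _ _ _))//.
rewrite -sum1_card natr_sum ler_sum// => s _; rewrite rnormc normcM.
have -> : normc ((-1) ^+ s : R[i]) = 1.
  by rewrite normcX -rnormc (@rnormN R R[i]^o) rnormc normc1 expr1n.
rewrite mul1r; elim/big_ind: _ => [|x z xl zl|i _]; [by rewrite normc1| |exact: M1].
by rewrite normcM mulr_ile1 ?normc_ge0.
Qed.

(** D z is |det(f_i(z_j))|, a volume of the image of the unit ball, and s is its supremum over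
    contractions. The supremum need not be attained in X, so y only comes within a factor 2 of
    it. *)
Lemma contraction_maximizer (R : realType) (X : normedModType R[i]) (hX : ~ finite_dimensional X) N :
  exists (D : ('I_N -> X) -> R) (y : 'I_N -> X) (s : R),
  [/\ contraction y, 0 < s, D y > s / 2, forall z, contraction z -> D z <= s
    & forall (T : 'M[R[i]]_N) (z w : 'I_N -> X), (forall j, w j = lincomb z (row j T)) ->
        D w = D z * normc (\det T)].
Proof.
have [e [f [fe fe0 fle]]] := biorthogonal_exists hX N.
pose D (z : 'I_N -> X) := normc (\det (\matrix_(i < N, j < N) (f i (z j) : R[i]))).
have DT (T : 'M[R[i]]_N) (z w : 'I_N -> X) : (forall j, w j = lincomb z (row j T)) ->
    D w = D z * normc (\det T).
  move=> wz; rewrite -normcM -[\det T]det_tr -det_mulmx; congr (normc (\det _)).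
  apply/matrixP => i j; rewrite !mxE wz /lincomb linear_sum /=; apply: eq_bigr => k _.
  by rewrite !mxE linearZ mulrC.
pose V := [set D z | z in @contraction R X N].
have Vub : has_ubound V.
  exists #|{: {perm 'I_N}}|%:R => _ [z zc <-]; apply: normc_det_le => i j; rewrite mxE.
  by rewrite (le_trans (fle _ _ (ltn_ord i)))// contraction_le1.
(* Every coordinate of a is at most the l^2 norm of a, so scaling the e_j by c makes them a
   contraction; it shows that the supremum is positive. *)
pose c := (1 + \sum_(j < N) rnorm (e j))^-1.
have S0 : 0 <= \sum_(j < N) rnorm (e j) by apply: sumr_ge0 => j _; exact: rnorm_ge0.
have c0 : 0 < c by rewrite invr_gt0 ltr_pwDl.
pose y0 (j : 'I_N) := c%:C *: e j.
have y0c : contraction y0.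
  move=> a; have na := nrm2_ge0 a.
  rewrite -[leRHS](sqr_sqrtr na) ler_pXn2r ?nnegrE ?rnorm_ge0 ?sqrtr_ge0//.
  rewrite (le_trans (rnorm_sum _ _ _))//.
  apply: (@le_trans _ _ (\sum_(j < N) c * rnorm (e j) * Num.sqrt (nrm2 a))).
    apply: ler_sum => j _; rewrite !rnormZ normc_real gtr0_norm// mulrC ler_wpM2l//.
      by rewrite mulr_ge0 ?rnorm_ge0// ltW.
    by rewrite -(ger0_norm (normc_ge0 (a 0 j))) -sqrtr_sqr ler_wsqrtr// normc_coord.
  rewrite -mulr_suml -mulr_sumr ler_piMl ?sqrtr_ge0// mulrC ler_pdivrMr ?ltr_pwDl//.
  by rewrite mul1r lerDr.
have D0 : 0 < D y0.
  rewrite normc_gt0 det_trig; last first.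
    apply/is_trig_mxP => i j ij; rewrite !mxE linearZ /=.
    by rewrite fe0 ?scaler0// ij /=.
  apply/prodf_neq0 => i _; rewrite mxE linearZ mulf_neq0 ?fe//.
  by rewrite -normc_eq0 normc_real normr_eq0 gt_eqF.
have s0 : 0 < sup V by rewrite (lt_le_trans D0)// ub_le_sup//; exists y0.
have Vsup : has_sup V by split=> //; exists (D y0), y0.
have [_ [y yc <-] Dy] := sup_adherent (divr_gt0 s0 (ltr0n _ 2)) Vsup.
exists D, y, (sup V); split => //.
- by move: Dy; lra.
- by move=> z zc; apply: ub_le_sup => //; exists z.
Qed.

Lemma lincomb_mul (R : realType) (X : normedModType R[i]) (N : nat) (T : 'M[R[i]]_N)
    (z w : 'I_N -> X) (a : 'rV[R[i]]_N) :
  (forall j, w j = lincomb z (row j T)) -> lincomb w a = lincomb z (a *m T).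
Proof.
move=> wz; rewrite /lincomb; under eq_bigr do rewrite wz /lincomb scaler_sumr.
rewrite exchange_big /=; apply: eq_bigr => k _; rewrite mxE scaler_suml.
by apply: eq_bigr => j _; rewrite mxE scalerA.
Qed.

(* If the contraction were small on the orthogonal complement of e_0, .., e_(k-1),
   doubling it there and renormalizing would increase the determinant. *)
Lemma dvoretzky_rogers_step (R : realType) (X : normedModType R[i]) (n k : nat)
    (D : ('I_(2 * n) -> X) -> R) (y : 'I_(2 * n) -> X) (s : R) (e : nat -> 'rV[R[i]]_(2 * n)) :
  contraction y -> 0 < s -> D y > s / 2 -> (forall z, contraction z -> D z <= s) ->
  (forall (T : 'M[R[i]]_(2 * n)) (z w : 'I_(2 * n) -> X), (forall j, w j = lincomb z (row j T)) ->
        D w = D z * normc (\det T)) ->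
  orthonormal_upto k e -> (k < n)%N ->
  exists b, [/\ cdot b b = 1, forall i, (i < k)%N -> cdot b (e i) = 0
    & 2 / 5 <= rnorm (lincomb y b)].
Proof.
move=> yc s0 Dy Dle DT eo kn; apply: contrapT => H.
have small b : (forall i, (i < k)%N -> cdot b (e i) = 0) ->
    rnorm (lincomb y b) <= 2 / 5 * Num.sqrt (nrm2 b).
  move=> be; have [b0|b0] := eqVneq (nrm2 b) 0.
    rewrite (nrm2_eq0 b0) /lincomb big1 ?rnorm0; last by move=> j _; rewrite mxE scale0r.
    by rewrite mulr_ge0// sqrtr_ge0.
  have bp : 0 < nrm2 b by rewrite lt_def b0 nrm2_ge0.
  have q0 : 0 < Num.sqrt (nrm2 b) by rewrite sqrtr_gt0.
  pose t := (Num.sqrt (nrm2 b))^-1.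
  have t0 : 0 < t by rewrite invr_gt0.
  rewrite leNgt; apply/negP => lt; apply: H; exists (t%:C *: b); split.
  - rewrite cdot_nrm2 nrm2Z normc_real gtr0_norm// /t exprVn sqr_sqrtr ?nrm2_ge0//.
    by rewrite mulVf.
  - by move=> i ik; rewrite cdotZl be// mulr0.
  - by rewrite lincombZ rnormZ normc_real gtr0_norm// [leRHS]mulrC ler_pdivlMr// ltW.
pose A : 'M[R[i]]_(k, 2 * n) := \matrix_(i, j) e i 0 j.
pose B : 'M[R[i]]_(2 * n, k) := \matrix_(j, i) conjc (e i 0 j).
have AB : A *m B = 1%:M.
  apply/matrixP => i l; rewrite !mxE -[RHS](eo i l)//; apply: eq_bigr => j _.
  by rewrite !mxE.
have aT (a : 'rV[R[i]]_(2 * n)) : a *m (2%:M - B *m A) = a + (a - proj k e a).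
  rewrite mulmxBr mul_mx_scalar mulmxA scaler_nat mulr2n -addrA; congr (_ + (_ - _)).
  apply/rowP => j; rewrite mxE summxE; apply: eq_bigr => i _; rewrite !mxE; congr (_ * _).
  by apply: eq_bigr => l _; rewrite mxE.
(* The doubled map has norm at most 1 + 2/5 = 7/5, and c rescales it to a contraction. *)
pose c : R := 5 / 7.
pose T := c%:C *: (2%:M - B *m A).
pose w j := lincomb y (row j T).
have wT a : lincomb w a = c%:C *: (lincomb y a + lincomb y (a - proj k e a)).
  by rewrite (@lincomb_mul _ _ _ T y)// -scalemxAr aT lincombZ lincombD.
have wc : contraction w.
  move=> a; rewrite wT rnormZ normc_real ger0_norm ?divr_ge0//.
  have na := nrm2_ge0 a; rewrite -[leRHS](sqr_sqrtr na).
  rewrite ler_pXn2r ?nnegrE ?mulr_ge0 ?divr_ge0 ?rnorm_ge0 ?sqrtr_ge0//.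
  have h1 : rnorm (lincomb y a) <= Num.sqrt (nrm2 a).
    by rewrite -(@ler_pXn2r _ 2)// ?nnegrE ?rnorm_ge0 ?sqrtr_ge0// sqr_sqrtr.
  have h2 : rnorm (lincomb y (a - proj k e a)) <= 2 / 5 * Num.sqrt (nrm2 a).
    apply: (le_trans (small _ (proj_orth a eo))); rewrite ler_wpM2l ?divr_ge0//.
    by rewrite ler_wsqrtr// proj_nrm2.
  have := rnormD (lincomb y a) (lincomb y (a - proj k e a)).
  by rewrite /c; lra.
have := Dle _ wc; rewrite (DT T y w)// /T detZ normcM normcX normc_real ger0_norm ?divr_ge0//.
rewrite det_sylvester ?pnatr_eq0// normcM normcV !normcX.
have -> : normc (2 : R[i]) = 2 by rewrite -(rmorph_nat (real_complex R)) normc_real ger0_norm.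
rewrite leNgt => /negP; apply.
(* There are 2 n dimensions and k < n: n of the doublings pay for the rescaling, as 2 c^2 = 50/49 >=
   1, and at least one more doubles the determinant. Then D w >= 2 D y > s. *)
have -> : c ^+ (2 * n) * (2 ^+ (2 * n) / 2 ^+ k) = (2 * c ^+ 2) ^+ n * 2 ^+ (n - k).
  have -> : 2 ^+ (2 * n) = 2 ^+ n * 2 ^+ n :> R by rewrite -exprD addnn mul2n.
  have -> : (2 * c ^+ 2) ^+ n = 2 ^+ n * c ^+ (2 * n) by rewrite exprMn_comm ?exprM//; exact: mulrC.
  by rewrite expfB// !mulrA [2 ^+ n * _]mulrC.
have h1 : 1 <= (2 * c ^+ 2) ^+ n by rewrite exprn_ege1// /c; lra.
have h2 : 2 <= 2 ^+ (n - k) :> R.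
  by rewrite -subn_gt0 in kn; rewrite -(prednK kn) exprS ler_peMr// exprn_ege1// ler1n.
have Dp : 0 < D y by rewrite (lt_trans _ Dy)// divr_gt0.
have : 2 <= (2 * c ^+ 2) ^+ n * 2 ^+ (n - k).
  by rewrite (le_trans h2)// ler_peMl// exprn_ge0.
move=> /(ler_wpM2l (ltW Dp)); apply: lt_le_trans; move: Dy; lra.
Qed.

(** A near-maximal contraction on 2 n dimensions has n orthonormal vectors with large images; on
    their span, contractivity is the weak l^2 bound, by Parseval. *)
Lemma dvoretzky_rogers (R : realType) (X : normedModType R[i]) (n : nat) :
  ~ finite_dimensional X -> exists x : 'I_n -> X, (forall i, 2 / 5 <= rnorm (x i)) /\
    (forall a : 'I_n -> R[i], rnorm (\sum_i a i *: x i) ^+ 2 <= \sum_i normc (a i) ^+ 2).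
Proof.
move=> hX; have [D [y [s [yc s0 Dy Dle DT]]]] := contraction_maximizer hX (2 * n).
have [e [eo ex]] : exists e, orthonormal_upto n e /\
    forall i, (i < n)%N -> 2 / 5 <= rnorm (lincomb y (e i)).
  have : forall k, (k <= n)%N -> exists e, orthonormal_upto k e /\
      forall i, (i < k)%N -> 2 / 5 <= rnorm (lincomb y (e i)).
    elim=> [_|k IH kn]; first by exists (fun=> 0).
    have [e [eo ex]] := IH (ltnW kn).
    have [b [bb be bx]] := dvoretzky_rogers_step yc s0 Dy Dle DT eo kn.
    exists (fun i => if i == k then b else e i); split; last first.
      move=> i; rewrite ltnS leq_eqVlt => /predU1P[->|ik]; first by rewrite eqxx.
      by rewrite ltn_eqF// ex.
    move=> i j; rewrite !ltnS (leq_eqVlt i) (leq_eqVlt j) => /predU1P[->|ik] /predU1P[->|jk].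
    - by rewrite !eqxx bb.
    - by rewrite eqxx !(ltn_eqF jk) gtn_eqF// be.
    - by rewrite eqxx !(ltn_eqF ik) cdotC be// conjc0.
    - by rewrite (ltn_eqF ik) (ltn_eqF jk) eo.
  by move=> /(_ n (leqnn n)).
exists (fun i => lincomb y (e i)); split=> [i|a]; first exact: ex.
pose a' k := if insub k is Some i then a i else 0.
have a'E (i : 'I_n) : a i = a' i by rewrite /a' valK.
under eq_bigr do rewrite a'E; under [leRHS]eq_bigr do rewrite a'E.
by rewrite -lincomb_sum -(nrm2_orthonormal _ eo); exact: yc.
Qed.

(** * Integrals of bumps against boundary weights *)

(** The mean value point c is within 1/2 of x, so 1 + c^2 <= 2 (1 + x^2). A bump is thus compared
    with an increment of its primitive, for telescoping. *)
Lemma atan_increment (R : realType) (x h : R) : 0 < h -> h <= 2^-1 ->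
  (1 + x ^+ 2)^-1 <= 2 / h * (atan (x + h) - atan x).
Proof.
move=> h0 h1; have xh : x < x + h by rewrite ltrDl.
have ca : {within `[x, x + h], continuous (@atan R)}.
  by apply: continuous_subspaceT => y; exact: continuous_atan.
have [c cI ->] := @MVT R (@atan R) (fun x => (1 + x ^+ 2)^-1) x (x + h) xh
  (fun y _ => is_derive1_atan y) ca.
move: cI; rewrite in_itv/= => /andP[xc ch].
have c2 : 0 < 1 + c ^+ 2 by rewrite ltr_pwDl// sqr_ge0.
have x2 : 0 < 1 + x ^+ 2 by rewrite ltr_pwDl// sqr_ge0.
rewrite addrAC subrr add0r.
have -> : 2 / h * ((1 + c ^+ 2)^-1 * h) = 2 / (1 + c ^+ 2) by field; rewrite !gt_eqF.
rewrite ler_pdivlMr// mulrC ler_pdivrMr//.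
have : (c - x) ^+ 2 <= 2^-1 ^+ 2 by rewrite ler_pXn2r ?nnegrE ?subr_ge0 ?(ltW xc)//; lra.
by have := sqr_ge0 (c - 2 * x); clear; nra.
Qed.

(** For step 1/8 the factor of [atan_increment] is 16, and atan varies by less than pi < 4, whatever
    n and t are. *)
Lemma grid_sum (R : realType) (n : nat) (t : R) :
  \sum_(k < n) (1 + (t - k%:R / 8) ^+ 2)^-1 <= 64.
Proof.
have H m : \sum_(k < m) (1 + (t - k%:R / 8) ^+ 2)^-1 <= 16 * (atan (- t + m%:R / 8) - atan (- t)).
  elim: m => [|m IH]; first by rewrite big_ord0 mul0r addr0 subrr mulr0.
  rewrite big_ord_recr /=.
  have := @atan_increment R (- t + m%:R / 8) 8^-1.
  have -> : - t + m%:R / 8 + 8^-1 = - t + m.+1%:R / 8 by rewrite -addrA -[m.+1%:R]natr1 [(_ + 1) / 8]mulrDl mul1r.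
  have -> : (- t + m%:R / 8) ^+ 2 = (t - m%:R / 8) ^+ 2 by ring.
  have h8 : (0 : R) < 8^-1 by rewrite invr_gt0.
  have h2 : (8^-1 : R) <= 2^-1 by rewrite lef_pV2 ?posrE// ler_nat.
  by move=> /(_ h8 h2); rewrite invrK; move: IH; lra.
apply: (le_trans (H n)).
have := @atan_ltpi2 R (- t + n%:R / 8); have := @atan_gtNpi2 R (- t).
have := @pihalf_lt2 R.
by lra.
Qed.

Lemma is_derive_atan_scaled (R : realType) (eta a x : R) : eta != 0 ->
  is_derive x (1 : R) (fun x => eta * atan ((x - a) / eta)) ((1 + ((x - a) / eta) ^+ 2)^-1).
Proof.
move=> e0.
have d1 : is_derive x (1 : R) (fun x => (x - a) / eta) eta^-1.
  by apply: is_derive_eq; rewrite ?scaler0 ?addr0 ?subr0 ?add0r ?scale1r ?/GRing.scale/= ?mulr1.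
have d2 : is_derive x (1 : R) (fun x => atan ((x - a) / eta)) (eta^-1 * (1 + ((x - a) / eta) ^+ 2)^-1).
  by apply: is_derive_eq; rewrite /GRing.scale /= mulrC.
by apply: is_derive_eq; rewrite /GRing.scale /= ?mulr0 ?addr0 ?add0r mulrA divff ?mul1r.
Qed.

Definition poisson_bump (R : realType) (eta u : R) : R := (1 + (u / eta) ^+ 2)^-1.

Lemma poisson_bump_ge0 (R : realType) (eta u : R) : 0 <= poisson_bump eta u.
Proof. by rewrite invr_ge0 addr_ge0// sqr_ge0. Qed.

Lemma poisson_bump_le1 (R : realType) (eta u : R) : poisson_bump eta u <= 1.
Proof. by rewrite invf_le1 ?ltr_pwDl ?sqr_ge0// lerDl sqr_ge0. Qed.

Lemma continuous_bump (R : realType) (eta a : R) : continuous (fun x : R => poisson_bump eta (x - a)).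
Proof.
move=> x; apply: cvgV; first by rewrite gt_eqF// ltr_pwDl// sqr_ge0.
apply: cvgD; first exact: cvg_cst.
by apply: cvgM; apply: cvgM; (try exact: cvg_cst); apply: cvgB; [exact: cvg_id|exact: cvg_cst|exact: cvg_id|exact: cvg_cst].
Qed.

Lemma integral_FTC2 (R : realType) (f F : R -> R) (a b : R) : a < b -> 
  (forall x, a <= x <= b -> {for x, continuous f}) ->
  (forall x, a <= x <= b -> is_derive x (1 : R) F (f x)) ->
  (\int[lebesgue_measure]_(x in `[a, b]) (f x)%:E = (F b - F a)%:E)%E.
Proof.
move=> ab cf dF; rewrite (continuous_FTC2 (F := F))//.
- by apply: continuous_in_subspaceT => x; rewrite inE/= in_itv/=; exact: cf.
- have cF x : a <= x <= b -> {for x, continuous F}.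
    by move=> xI; apply/differentiable_continuous/derivable1_diffP; case: (dF x xI).
  have [aI bI] : a <= a <= b /\ a <= b <= b by rewrite !lexx ltW.
  split.
  - by move=> x /[!in_itv]/= /andP[? ?]; have [] := dF x; rewrite ?ltW.
  - by apply: cvg_at_right_filter; exact: cF.
  - by apply: cvg_at_left_filter; exact: cF.
- move=> x /[!in_itv]/= /andP[? ?]; rewrite derive1E.
  by apply: derive_val; apply: dF; rewrite !ltW.
Qed.

Lemma int_bump (R : realType) (eta a : R) : 0 < eta ->
  (\int[lebesgue_measure]_(x in `[(- 1)%R, 1%R]) (poisson_bump eta (x - a))%:E <= (4 * eta)%:E)%E.
Proof.
move=> e0; have e0' : eta != 0 by rewrite gt_eqF.
have ab : - 1 < 1 :> R by lra.
have -> := integral_FTC2 ab (fun x _ => @continuous_bump R eta a x)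
  (fun x _ => is_derive_atan_scaled a x e0').
rewrite lee_fin -mulrBr mulrC ler_pM2r//.
have := @atan_ltpi2 R ((1 - a) / eta); have := @atan_gtNpi2 R ((- 1 - a) / eta).
by have := @pihalf_lt2 R; lra.
Qed.

(** The singularity |u|^(-1/2), made continuous by eps; the integral bounds below are uniform in
    eps. *)
Definition sqrt_weight (R : realType) (eps u : R) : R := (Num.sqrt (`|u| + eps))^-1.

Lemma sqrt_weight_ge0 (R : realType) (eps u : R) : 0 <= sqrt_weight eps u.
Proof. by rewrite invr_ge0 sqrtr_ge0. Qed.

Lemma continuous_sqrt_weight (R : realType) (eps : R) : 0 < eps -> continuous (@sqrt_weight R eps).
Proof.
move=> e0 x; apply: cvgV; first by rewrite gt_eqF// sqrtr_gt0 ltr_wpDl.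
apply: (@continuous_comp _ _ _ (fun u : R => `|u| + eps) (@Num.sqrt R)); last exact: sqrt_continuous.
by apply: cvgD; [exact: norm_continuous|exact: cvg_cst].
Qed.

Lemma int_sqrt_weight_r (R : realType) (eps c eta : R) : 0 < eps -> 0 < eta ->
  (\int[lebesgue_measure]_(x in `[c, (c + eta)%R]) (sqrt_weight eps (x - c))%:E
     <= (2 * Num.sqrt eta)%:E)%E.
Proof.
move=> e0 n0.
have -> : (\int[lebesgue_measure]_(x in `[c, (c + eta)%R]) (sqrt_weight eps (x - c))%:E =
   \int[lebesgue_measure]_(x in `[c, (c + eta)%R]) ((Num.sqrt (x - c + eps))^-1)%:E)%E.
  apply: eq_integral => x; rewrite inE/= in_itv/= => /andP[cx _].
  by rewrite /sqrt_weight ger0_norm// subr_ge0.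
have pos x : c <= x <= c + eta -> 0 < x - c + eps.
  by move=> /andP[cx _]; rewrite ltr_wpDl// subr_ge0.
have cv x : c <= x <= c + eta -> {for x, continuous (fun x => (Num.sqrt (x - c + eps))^-1)}.
  move=> xI; apply: cvgV; first by rewrite gt_eqF// sqrtr_gt0 pos.
  apply: (@continuous_comp _ _ _ (fun u : R => u - c + eps) (@Num.sqrt R)); last exact: sqrt_continuous.
  by apply: cvgD; [apply: cvgB; [exact: cvg_id|exact: cvg_cst]|exact: cvg_cst].
have dv x : c <= x <= c + eta ->
    is_derive x (1 : R) (fun x => 2 * Num.sqrt (x - c + eps)) (Num.sqrt (x - c + eps))^-1.
  move=> xI; have d1 := is_derive1_sqrt (pos x xI).
  have d2 : is_derive x (1 : R) (fun x => x - c + eps) 1.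
    by apply: is_derive_eq; rewrite ?subr0 ?addr0.
  have d3 : is_derive x (1 : R) (fun x => Num.sqrt (x - c + eps)) (2 * Num.sqrt (x - c + eps))^-1.
    by apply: is_derive_eq; rewrite /GRing.scale /= mulr1.
  by apply: is_derive_eq; rewrite /GRing.scale /= ?mulr0 ?addr0 ?add0r invfM mulrA divff ?mul1r.
have ab : c < c + eta by rewrite ltrDl.
have -> := integral_FTC2 ab cv dv.
rewrite lee_fin -mulrBr ler_pM2l//.
have -> : c + eta - c + eps = eta + eps by ring.
rewrite subrr add0r lerBlDr -(@ler_pXn2r _ 2)// ?nnegrE ?addr_ge0 ?sqrtr_ge0//.
rewrite sqrrD !sqr_sqrtr ?addr_ge0 ?(ltW e0) ?(ltW n0)// addrAC lerDl.
by rewrite mulrn_wge0// mulr_ge0 ?sqrtr_ge0.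
Qed.

Lemma int_sqrt_weight_l (R : realType) (eps c eta : R) : 0 < eps -> 0 < eta ->
  (\int[lebesgue_measure]_(x in `[(c - eta)%R, c]) (sqrt_weight eps (x - c))%:E
     <= (2 * Num.sqrt eta)%:E)%E.
Proof.
move=> e0 n0.
have -> : (\int[lebesgue_measure]_(x in `[(c - eta)%R, c]) (sqrt_weight eps (x - c))%:E =
   \int[lebesgue_measure]_(x in `[(c - eta)%R, c]) ((Num.sqrt (c - x + eps))^-1)%:E)%E.
  apply: eq_integral => x; rewrite inE/= in_itv/= => /andP[_ cx].
  by rewrite /sqrt_weight distrC ger0_norm// subr_ge0.
have pos x : c - eta <= x <= c -> 0 < c - x + eps.
  by move=> /andP[_ cx]; rewrite ltr_wpDl// subr_ge0.
have cv x : c - eta <= x <= c -> {for x, continuous (fun x => (Num.sqrt (c - x + eps))^-1)}.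
  move=> xI; apply: cvgV; first by rewrite gt_eqF// sqrtr_gt0 pos.
  apply: (@continuous_comp _ _ _ (fun u : R => c - u + eps) (@Num.sqrt R)); last exact: sqrt_continuous.
  by apply: cvgD; [apply: cvgB; [exact: cvg_cst|exact: cvg_id]|exact: cvg_cst].
have dv x : c - eta <= x <= c ->
    is_derive x (1 : R) (fun x => (- 2) * Num.sqrt (c - x + eps)) (Num.sqrt (c - x + eps))^-1.
  move=> xI; have d1 := is_derive1_sqrt (pos x xI).
  have d2 : is_derive x (1 : R) (fun x => c - x + eps) (- 1).
    by apply: is_derive_eq; rewrite add0r mul1r addr0.
  have d3 : is_derive x (1 : R) (fun x => Num.sqrt (c - x + eps)) (- (2 * Num.sqrt (c - x + eps))^-1).
    by apply: is_derive_eq; rewrite /GRing.scale /= mulrN1.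
  by apply: is_derive_eq; rewrite /GRing.scale /= ?mulr0 ?addr0 ?add0r mulrNN invfM mulrA divff ?mul1r.
have ab : c - eta < c by rewrite ltrBlDr ltrDl.
have -> := integral_FTC2 ab cv dv.
rewrite lee_fin !mulNr opprK addrC -mulrBr ler_pM2l//.
have -> : c - (c - eta) + eps = eta + eps by ring.
rewrite subrr add0r lerBlDr -(@ler_pXn2r _ 2)// ?nnegrE ?addr_ge0 ?sqrtr_ge0//.
rewrite sqrrD !sqr_sqrtr ?addr_ge0 ?(ltW e0) ?(ltW n0)// addrAC lerDl.
by rewrite mulrn_wge0// mulr_ge0 ?sqrtr_ge0.
Qed.

(** At distance at least eta from c the weight is at most eta^(-1/2), and the bump has integral at
    most 4 eta. Closer to c the bump is at most 1, and the weight integrates to at most 2 sqrt(eta)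
    on each side. This gives 4 + 2 + 2 = 8. *)
Lemma int_bump_sqrt_weight (R : realType) (eps c a eta : R) : 0 < eps -> 0 < eta ->
  (\int[lebesgue_measure]_(x in `[(- 1)%R, 1%R])
     (poisson_bump eta (x - a) * sqrt_weight eps (x - c))%:E <= (8 * Num.sqrt eta)%:E)%E.
Proof.
move=> e0 n0; have s0 : 0 < Num.sqrt eta by rewrite sqrtr_gt0.
pose A x := poisson_bump eta (x - a); pose g x := sqrt_weight eps (x - c).
have mA : measurable_fun setT A by apply: continuous_measurable_fun; exact: continuous_bump.
have mg : measurable_fun setT g.
  apply: continuous_measurable_fun => x.
  apply: (@continuous_comp _ _ _ (fun u : R => u - c) (@sqrt_weight R eps)).
    by apply: cvgB; [exact: cvg_id|exact: cvg_cst].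
  exact: continuous_sqrt_weight.
have g0 x : 0 <= g x by exact: sqrt_weight_ge0.
have A0 x : 0 <= A x by exact: poisson_bump_ge0.
pose I1 : set R := `[c - eta, c]%classic; pose I2 : set R := `[c, c + eta]%classic.
pose gE x := (g x)%:E; have mgE : measurable_fun setT gE by exact/measurable_EFinP.
pose D : set R := `[-1, 1]%classic.
have mD : measurable D by exact: measurable_itv.
have Igl (I : set R) K : measurable I ->
   (\int[lebesgue_measure]_(x in I) gE x <= K%:E)%E ->
   (\int[lebesgue_measure]_(x in D) (gE \_ I) x <= K%:E)%E.
  move=> mI; rewrite -integral_mkcondr; apply: le_trans.
  apply: ge0_subset_integral => //.
  - exact: measurableI.
  - exact: measurable_funTS.
  - by move=> x _; rewrite lee_fin.
have r0 (I : set R) x : (0 <= (gE \_ I) x)%E by apply: erestrict_ge0 => y _; rewrite lee_fin.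
have mr (I : set R) : measurable I -> measurable_fun D (gE \_ I).
  move=> mI; apply: measurable_funTS; apply/(measurable_restrictT _ _).1 => //.
  exact: measurable_funTS.
have mI1 : measurable I1 by exact: measurable_itv.
have mI2 : measurable I2 by exact: measurable_itv.
have mr1 := mr _ mI1; have mr2 := mr _ mI2.
have -> : 8 * Num.sqrt eta = (Num.sqrt eta)^-1 * (4 * eta) + (2 * Num.sqrt eta + 2 * Num.sqrt eta).
  have := sqr_sqrtr (ltW n0); move: s0; generalize (Num.sqrt eta) => s s0 <-.
  by field; rewrite gt_eqF.
rewrite EFinD EFinD EFinM.
apply: (@le_trans _ _ (\int[lebesgue_measure]_(x in D)
    (((Num.sqrt eta)^-1)%:E * (A x)%:E + ((gE \_ I1) x + (gE \_ I2) x)))%E).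
  apply: ge0_le_integral => //.
  - by move=> x _; rewrite lee_fin mulr_ge0 ?poisson_bump_ge0 ?sqrt_weight_ge0.
  - apply: measurable_funTS; apply/measurable_EFinP; exact: measurable_funM.
  - apply: emeasurable_funD; last exact: emeasurable_funD.
    by apply: measurable_funTS; apply/measurable_EFinP; exact: measurable_funM.
  move=> x _; have [xc|xc] := leP eta `|x - c|.
    apply: (@le_trans _ _ (((Num.sqrt eta)^-1)%:E * (A x)%:E)%E); last first.
      by rewrite leeDl// adde_ge0.
    rewrite -EFinM lee_fin [leLHS]mulrC ler_wpM2r ?A0// /sqrt_weight lef_pV2 ?posrE ?sqrtr_gt0 ?ltr_wpDl//.
    by rewrite ler_wsqrtr// (le_trans xc)// lerDl ltW.
  have gx : ((A x * g x)%:E <= gE x)%E.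
    by rewrite lee_fin ler_piMl// poisson_bump_le1.
  have Ag : (0 <= ((Num.sqrt eta)^-1)%:E * (A x)%:E)%E.
    by rewrite -EFinM lee_fin mulr_ge0// invr_ge0 ltW.
  apply: (le_trans gx); move: xc; rewrite ltr_distl => /andP[h1 h2].
  have [cx|cx] := leP c x.
    have -> : (gE \_ I2) x = gE x.
      by rewrite patchE mem_set//= /I2 /= in_itv/= cx ltW// addrC.
    by rewrite addeA leeDr// adde_ge0.
  have -> : (gE \_ I1) x = gE x.
    by rewrite patchE mem_set//= /I1 /= in_itv/= !ltW.
  by rewrite addeCA leeDl// adde_ge0.
rewrite ge0_integralD//; last 4 first.
- by move=> x _; rewrite -EFinM lee_fin mulr_ge0// invr_ge0 ltW.
- by apply: measurable_funTS; apply/measurable_EFinP; exact: measurable_funM.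
- by move=> x _; rewrite adde_ge0.
- exact: emeasurable_funD.
have mAD : measurable_fun D (fun x => (A x)%:E).
  by apply: measurable_funTS; exact/measurable_EFinP.
have A0D x : D x -> (0 <= (A x)%:E)%E by move=> _; rewrite lee_fin.
have s0' : 0 <= (Num.sqrt eta)^-1 by rewrite invr_ge0 ltW.
have EZ := ge0_integralZl_EFin (@lebesgue_measure R) mD A0D mAD s0'.
rewrite /= in EZ; rewrite EZ.
rewrite ge0_integralD//.
apply: leeD; first by rewrite lee_wpmul2l ?lee_fin ?invr_ge0 ?(ltW s0)// int_bump.
by apply: leeD; apply: Igl => //; [exact: int_sqrt_weight_l|exact: int_sqrt_weight_r].
Qed.

Definition unit_square (R : realType) : set (plane R) :=
  `[-1, 1]%classic `*` `[-1, 1]%classic.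

Lemma unit_square_slices (R : realType) (f : plane R -> \bar R) :
  measurable_fun setT f -> (forall xy, 0 <= f xy)%E ->
  (\int[(area R)]_(xy in @unit_square R) f xy =
   \int[lebesgue_measure]_(x in `[(- 1)%R, 1%R])
     \int[lebesgue_measure]_(y in `[(- 1)%R, 1%R]) f (x, y))%E /\
  (\int[(area R)]_(xy in @unit_square R) f xy =
   \int[lebesgue_measure]_(y in `[(- 1)%R, 1%R])
     \int[lebesgue_measure]_(x in `[(- 1)%R, 1%R]) f (x, y))%E.
Proof.
move=> mf f0; pose h := f \_ (@unit_square R).
have mU : measurable (@unit_square R) by exact: measurableX.
have mh : measurable_fun setT h.
  by apply/(measurable_restrictT _ _).1 => //; exact: measurable_funTS.
have h0 xy : (0 <= h xy)%E by apply: erestrict_ge0.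
have -> : (\int[(area R)]_(xy in @unit_square R) f xy =
   \int[(area R)]_xy h xy)%E by exact: integral_mkcond.
split.
  rewrite (@fubini_tonelli1 _ _ _ _ R (@lebesgue_measure R) (@lebesgue_measure R) h mh h0) [RHS]integral_mkcond; apply: eq_integral => x _.
  rewrite /fubini_F patchE; case: ifPn => xI.
    rewrite [RHS]integral_mkcond; apply: eq_integral => y _; rewrite /h !patchE.
    congr (if _ then _ else _); apply/idP/idP => /set_mem H; apply/mem_set; first by case: H.
    by split => //; exact: set_mem xI.
  rewrite integral0_eq// => y _; rewrite /h patchE ifF//; apply/negP => /set_mem[xI' _].
  by move/negP: xI; apply; exact: mem_set.
rewrite (@fubini_tonelli1 _ _ _ _ R (@lebesgue_measure R) (@lebesgue_measure R) h mh h0) (@fubini_tonelli _ _ _ _ R (@lebesgue_measure R) (@lebesgue_measure R) h mh h0) [RHS]integral_mkcond; apply: eq_integral => y _.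
rewrite /fubini_G patchE; case: ifPn => yI.
  rewrite [RHS]integral_mkcond; apply: eq_integral => x _; rewrite /h !patchE.
  congr (if _ then _ else _); apply/idP/idP => /set_mem H; apply/mem_set; first by case: H.
  by split => //; exact: set_mem yI.
rewrite integral0_eq// => x _; rewrite /h patchE ifF//; apply/negP => /set_mem[_ yI'].
by move/negP: yI; apply; exact: mem_set.
Qed.

Lemma measurable_bump (R : realType) (eta a : R) :
  measurable_fun setT (fun x : R => poisson_bump eta (x - a)).
Proof. by apply: continuous_measurable_fun; exact: continuous_bump. Qed.

Lemma measurable_bump2 (R : realType) (eta a b : R) :
  measurable_fun setT (fun xy : plane R =>
    poisson_bump eta (xy.1 - a) * poisson_bump eta (xy.2 - b)).
Proof.
apply: measurable_funM.
  exact: (measurableT_comp (measurable_bump eta a) measurable_fst).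
exact: (measurableT_comp (measurable_bump eta b) measurable_snd).
Qed.

Lemma measurable_sqrt_weight2 (R : realType) (eps : R) (c : R -> R) : 0 < eps -> continuous c ->
  measurable_fun setT (fun xy : plane R => sqrt_weight eps (xy.1 - c xy.2)).
Proof.
move=> e0 cc.
have mw : measurable_fun setT (@sqrt_weight R eps).
  by apply: continuous_measurable_fun; exact: continuous_sqrt_weight.
apply: (measurableT_comp mw); apply: measurable_funB; first exact: measurable_fst.
exact: (measurableT_comp (continuous_measurable_fun cc) measurable_snd).
Qed.

Lemma int_bump_const (R : realType) (eta a K : R) (f : R -> \bar R) : 0 < eta -> 0 <= K ->
  measurable_fun setT f -> (forall x, 0 <= f x)%E ->
  (forall x, f x <= K%:E * (poisson_bump eta (x - a))%:E)%E ->
  (\int[lebesgue_measure]_(x in `[(- 1)%R, 1%R]) f x <= (K * (4 * eta))%:E)%E.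
Proof.
move=> n0 K0 mf f0 fK; have mA := @measurable_bump R eta a.
apply: (@le_trans _ _ (\int[lebesgue_measure]_(x in `[(- 1)%R, 1%R])
    (K%:E * (poisson_bump eta (x - a))%:E))%E).
  apply: ge0_le_integral => //.
  - exact: measurable_funTS.
  - by apply: measurable_funTS; apply/measurable_EFinP; exact: measurable_funM.
rewrite ge0_integralZl_EFin//.
- by rewrite EFinM lee_wpmul2l ?lee_fin// int_bump.
- by move=> x _; rewrite lee_fin poisson_bump_ge0.
- by apply: measurable_funTS; exact/measurable_EFinP.
Qed.

Lemma measurable_slice_x (R : realType) (f : plane R -> \bar R) :
  measurable_fun setT f -> (forall xy, 0 <= f xy)%E ->
  measurable_fun setT (fun x : R => \int[lebesgue_measure]_(y in `[(- 1)%R, 1%R]) f (x, y))%E.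
Proof.
move=> mf f0; pose h := f \_ (setT `*` `[-1, 1]%classic).
have mU : measurable (setT `*` `[-1, 1]%classic : set (plane R)).
  exact: measurableX.
have mh : measurable_fun setT h.
  by apply/(measurable_restrictT _ _).1 => //; exact: measurable_funTS.
have h0 xy : (0 <= h xy)%E by apply: erestrict_ge0.
have mF : measurable_fun setT (fubini_F (@lebesgue_measure R) h).
  exact: measurable_fun_fubini_tonelli_F.
rewrite (_ : (fun x => _) = fubini_F (@lebesgue_measure R) h)//.
apply/funext => x; rewrite /fubini_F [LHS]integral_mkcond; apply: eq_integral => y _.
rewrite /h !patchE; congr (if _ then _ else _).
by apply/idP/idP => /set_mem H; apply/mem_set; [split|case: H].
Qed.

Lemma measurable_slice_y (R : realType) (f : plane R -> \bar R) :
  measurable_fun setT f -> (forall xy, 0 <= f xy)%E ->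
  measurable_fun setT (fun y : R => \int[lebesgue_measure]_(x in `[(- 1)%R, 1%R]) f (x, y))%E.
Proof.
move=> mf f0; pose h := f \_ (`[-1, 1]%classic `*` setT).
have mU : measurable (`[-1, 1]%classic `*` setT : set (plane R)).
  exact: measurableX.
have mh : measurable_fun setT h.
  by apply/(measurable_restrictT _ _).1 => //; exact: measurable_funTS.
have h0 xy : (0 <= h xy)%E by apply: erestrict_ge0.
have mF : measurable_fun setT (fubini_G (@lebesgue_measure R) h).
  exact: measurable_fun_fubini_tonelli_G.
rewrite (_ : (fun y => _) = fubini_G (@lebesgue_measure R) h)//.
apply/funext => y; rewrite /fubini_G [LHS]integral_mkcond; apply: eq_integral => x _.
rewrite /h !patchE; congr (if _ then _ else _).
by apply/idP/idP => /set_mem H; apply/mem_set; [split|case: H].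
Qed.

(* Applied to [g = 1] and to inverse square root weights concentrated on a curve. *)
Lemma int_bump2_weight_x (R : realType) (eta a b K : R) (g : R -> R -> R) : 0 < eta -> 0 <= K ->
  measurable_fun setT (fun xy : plane R => g xy.1 xy.2) ->
  (forall x y, 0 <= g x y) ->
  (forall y, \int[lebesgue_measure]_(x in `[(- 1)%R, 1%R]) (poisson_bump eta (x - a) * g x y)%:E <= K%:E)%E ->
  (\int[(area R)]_(xy in @unit_square R)
    (poisson_bump eta (xy.1 - a) * poisson_bump eta (xy.2 - b) * g xy.1 xy.2)%:E <= (K * (4 * eta))%:E)%E.
Proof.
move=> n0 K0 mg g0 gK.
pose f xy := (poisson_bump eta (xy.1 - a) * poisson_bump eta (xy.2 - b) * g xy.1 xy.2)%:E.
have mf : measurable_fun setT f.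
  by apply/measurable_EFinP; apply: measurable_funM => //; exact: measurable_bump2.
have f0 xy : (0 <= f xy)%E by rewrite lee_fin !mulr_ge0// poisson_bump_ge0.
have [_ ->] := unit_square_slices mf f0.
apply: (@int_bump_const _ eta b) => //; first exact: measurable_slice_y.
  by move=> y; exact: integral_ge0.
move=> y.
have mgy : measurable_fun setT (fun x : R => (poisson_bump eta (x - a) * g x y)%:E).
  apply/measurable_EFinP; apply: measurable_funM; first exact: measurable_bump.
  exact: (measurableT_comp mg (pair2_measurable y)).
have -> : (\int[lebesgue_measure]_(x in `[(- 1)%R, 1%R]) f (x, y) =
  (poisson_bump eta (y - b))%:E * \int[lebesgue_measure]_(x in `[(- 1)%R, 1%R])
     (poisson_bump eta (x - a) * g x y)%:E)%E.
  rewrite -ge0_integralZl_EFin//.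
  - by apply: eq_integral => x _; rewrite /f /= -EFinM; congr (_%:E); ring.
  - by move=> x _; rewrite lee_fin mulr_ge0// poisson_bump_ge0.
  - exact: measurable_funTS.
  - exact: poisson_bump_ge0.
by rewrite muleC lee_wpmul2r// lee_fin poisson_bump_ge0.
Qed.

Lemma int_bump2_weight_y (R : realType) (eta a b K : R) (g : R -> R -> R) : 0 < eta -> 0 <= K ->
  measurable_fun setT (fun xy : plane R => g xy.1 xy.2) ->
  (forall x y, 0 <= g x y) ->
  (forall x, \int[lebesgue_measure]_(y in `[(- 1)%R, 1%R]) (poisson_bump eta (y - b) * g x y)%:E <= K%:E)%E ->
  (\int[(area R)]_(xy in @unit_square R)
    (poisson_bump eta (xy.1 - a) * poisson_bump eta (xy.2 - b) * g xy.1 xy.2)%:E <= (K * (4 * eta))%:E)%E.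
Proof.
move=> n0 K0 mg g0 gK.
pose f xy := (poisson_bump eta (xy.1 - a) * poisson_bump eta (xy.2 - b) * g xy.1 xy.2)%:E.
have mf : measurable_fun setT f.
  by apply/measurable_EFinP; apply: measurable_funM => //; exact: measurable_bump2.
have f0 xy : (0 <= f xy)%E by rewrite lee_fin !mulr_ge0// poisson_bump_ge0.
have [-> _] := unit_square_slices mf f0.
apply: (@int_bump_const _ eta a) => //; first exact: measurable_slice_x.
  by move=> y; exact: integral_ge0.
move=> x.
have mgy : measurable_fun setT (fun y : R => (poisson_bump eta (y - b) * g x y)%:E).
  apply/measurable_EFinP; apply: measurable_funM; first exact: measurable_bump.
  exact: (measurableT_comp mg (pair1_measurable x)).
have -> : (\int[lebesgue_measure]_(y in `[(- 1)%R, 1%R]) f (x, y) =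
  (poisson_bump eta (x - a))%:E * \int[lebesgue_measure]_(y in `[(- 1)%R, 1%R])
     (poisson_bump eta (y - b) * g x y)%:E)%E.
  rewrite -ge0_integralZl_EFin//.
  - by apply: eq_integral => y _; rewrite /f /= -EFinM; congr (_%:E); ring.
  - by move=> y _; rewrite lee_fin mulr_ge0// poisson_bump_ge0.
  - exact: measurable_funTS.
  - exact: poisson_bump_ge0.
by rewrite muleC lee_wpmul2r// lee_fin poisson_bump_ge0.
Qed.

Lemma inv_sqrt_le (R : realType) (P Q : R) : 0 < P -> P / 4 <= Q ->
  (Num.sqrt Q)^-1 <= 2 * (Num.sqrt P)^-1.
Proof.
move=> P0 PQ; have P4 : 0 < P / 4 by rewrite divr_gt0.
have Q0 : 0 < Q by rewrite (lt_le_trans P4).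
rewrite -[2]invrK -invfM lef_pV2 ?posrE ?mulr_gt0 ?sqrtr_gt0//.
rewrite -(@ler_pXn2r _ 2)// ?nnegrE ?mulr_ge0 ?sqrtr_ge0//.
have -> : (2^-1 * Num.sqrt P) ^+ 2 = P / 4.
  by rewrite exprMn sqr_sqrtr ?(ltW P0)// exprVn -natrX mulrC.
by rewrite sqr_sqrtr// ltW.
Qed.

(** On a slice of the disc with half-chord c, 1 - n^2 = (c - |x|) (c + |x|), and |x| >= 1/3 keeps c
    + |x| above 2/3. So 1 - n is at least a multiple of the distance c - |x| to the circle along the
    slice. *)
Lemma inv_sqrt_slice (R : realType) (x c n eps : R) : 0 < eps -> 0 <= n < 1 ->
  c ^+ 2 - x ^+ 2 = 1 - n ^+ 2 -> 0 <= c -> 9^-1 <= x ^+ 2 ->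
  (Num.sqrt (1 - n + eps))^-1 <= 2 * (sqrt_weight eps (x - c) + sqrt_weight eps (x + c)).
Proof.
move=> e0 /andP[n0 n1] E c0 x9.
have key t : 3^-1 <= t -> t ^+ 2 = x ^+ 2 -> (`|t - c| + eps) / 4 <= 1 - n + eps.
  move=> t3 tx; have n2 : n ^+ 2 <= 1 by rewrite expr_le1// ltW.
  have tc : t <= c.
    rewrite -(@ler_pXn2r _ 2)// ?nnegrE// ?(le_trans _ t3)//.
    by rewrite tx; move: E; lra.
  rewrite ler0_norm ?subr_le0//.
  have : (c - t) * (2 / 3) <= (c - t) * (c + t) by rewrite ler_wpM2l ?subr_ge0//; lra.
  have -> : (c - t) * (c + t) = (1 - n) * (1 + n) by move: E; rewrite -tx; lra.
  have : (1 - n) * (1 + n) <= (1 - n) * 2 by rewrite ler_wpM2l ?subr_ge0 ?ltW//; lra.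
  by lra.
have [x0|x0] := leP 0 x.
  rewrite mulrDr -[leLHS]addr0 lerD ?mulr_ge0 ?sqrt_weight_ge0//.
  apply: inv_sqrt_le; first by rewrite ltr_wpDl.
  apply: key => //; rewrite -(@ler_pXn2r _ 2)// ?nnegrE// exprVn.
  by rewrite (_ : 3 ^+ 2 = 9 :> R)// -natrX.
rewrite mulrDr [leRHS]addrC -[leLHS]addr0 lerD ?mulr_ge0 ?sqrt_weight_ge0//.
apply: inv_sqrt_le; first by rewrite ltr_wpDl.
have -> : `|x + c| = `|- x - c| by rewrite -normrN opprD.
apply: key; last by rewrite sqrrN.
rewrite -(@ler_pXn2r _ 2)// ?nnegrE ?oppr_ge0 ?(ltW x0)// sqrrN exprVn.
by rewrite (_ : 3 ^+ 2 = 9 :> R)// -natrX.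
Qed.

(** Up to a factor 2, a majorant of (1 - |z|)^(-1/2) suited to Fubini. The middle terms are singular
    in x on horizontal slices and serve when x^2 >= 1/9, the last ones in y when y^2 >= 1/9; the
    constant serves for |z| < 1/2. *)
Definition boundary_weight (R : realType) (eps x y : R) : R :=
  1 + (sqrt_weight eps (x - Num.sqrt (1 - y ^+ 2)) + sqrt_weight eps (x + Num.sqrt (1 - y ^+ 2)))
    + (sqrt_weight eps (y - Num.sqrt (1 - x ^+ 2)) + sqrt_weight eps (y + Num.sqrt (1 - x ^+ 2))).

Lemma inv_sqrt_boundary (R : realType) (eps x y : R) : 0 < eps -> normc (x +i* y) < 1 ->
  (Num.sqrt (1 - normc (x +i* y) + eps))^-1 <= 2 * boundary_weight eps x y.
Proof.
move=> e0; have := normc_sqr (x +i* y); have := normc_ge0 (x +i* y).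
set n := normc _ => n0 /= nE n1.
have nI : 0 <= n < 1 by rewrite n0.
have s0 u := sqrt_weight_ge0 eps u.
have n2 : n ^+ 2 <= 1 by rewrite expr_le1// ltW.
have [n12|n12] := ltP n 2^-1.
  rewrite /boundary_weight; apply: (@le_trans _ _ (2 * 1)); last first.
    by rewrite ler_wpM2l// -addrA lerDl !addr_ge0.
  have := @inv_sqrt_le R 1 (1 - n + eps) ltr01; rewrite sqrtr1 invr1; apply.
  by move: n12; lra.
have n4 : 4^-1 <= n ^+ 2.
  have -> : 4^-1 = (2^-1) ^+ 2 :> R by rewrite exprVn -natrX.
  by rewrite ler_pXn2r ?nnegrE.
have [x9|x9] := leP 9^-1 (x ^+ 2).
  have x2 : 0 <= x ^+ 2 by exact: sqr_ge0.
  rewrite (le_trans (@inv_sqrt_slice R x (Num.sqrt (1 - y ^+ 2)) n eps e0 nI _ _ x9)) ?sqrtr_ge0//.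
    rewrite sqr_sqrtr ?nE; first by ring.
    by move: n2; rewrite nE; lra.
  by rewrite ler_wpM2l// /boundary_weight addrAC lerDr addr_ge0// addr_ge0.
have y2 : 0 <= y ^+ 2 by exact: sqr_ge0.
have y9 : 9^-1 <= y ^+ 2 by move: n4; rewrite nE; lra.
rewrite (le_trans (@inv_sqrt_slice R y (Num.sqrt (1 - x ^+ 2)) n eps e0 nI _ _ y9)) ?sqrtr_ge0//.
  rewrite sqr_sqrtr ?nE; first by ring.
  by move: n2; rewrite nE; lra.
by rewrite ler_wpM2l// /boundary_weight lerDr addr_ge0// addr_ge0.
Qed.

Lemma continuous_circle (R : realType) : continuous (fun y : R => Num.sqrt (1 - y ^+ 2)).
Proof.
move=> y; apply: (@continuous_comp _ _ _ (fun y : R => 1 - y ^+ 2) (@Num.sqrt R)).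
  by apply: cvgB; [exact: cvg_cst|exact: exprn_continuous].
exact: sqrt_continuous.
Qed.

Lemma discRR_unit_square (R : realType) : @discRR R `<=` @unit_square R.
Proof.
move=> [x y] /discE /= z1; split; rewrite /= in_itv/= -ler_norml.
  by rewrite (le_trans (normc_Re (x +i* y)))// ltW.
by rewrite (le_trans (normc_Im (x +i* y)))// ltW.
Qed.

Lemma measurable_normc (R : realType) :
  measurable_fun setT (fun xy : plane R => normc (xy.1 +i* xy.2)).
Proof.
have ms : measurable_fun setT (@Num.sqrt R).
  by apply: continuous_measurable_fun; exact: sqrt_continuous.
apply: (measurableT_comp ms); apply: measurable_funD; apply: measurable_funX.
  exact: measurable_fst.
exact: measurable_snd.
Qed.

(** Each of the four singular terms contributes 32 eta^(3/2), the constant term 16 eta^2 <= 16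
    eta^(3/2): together 144, doubled by the factor in [inv_sqrt_boundary]. *)
Lemma int_kernel (R : realType) (eta eps a b : R) : 0 < eta -> eta <= 1 -> 0 < eps ->
  (\int[(area R)]_(xy in @discRR R)
    (poisson_bump eta (xy.1 - a) * poisson_bump eta (xy.2 - b) *
      sqrt_weight eps (1 - normc (xy.1 +i* xy.2)))%:E <= (288 * (eta * Num.sqrt eta))%:E)%E.
Proof.
move=> n0 n1 e0.
have s0 : 0 <= Num.sqrt eta by exact: sqrtr_ge0.
pose AA (xy : R * R) := poisson_bump eta (xy.1 - a) * poisson_bump eta (xy.2 - b).
have AA0 xy : 0 <= AA xy by rewrite mulr_ge0// poisson_bump_ge0.
have mAA : measurable_fun setT AA by exact: measurable_bump2.
pose c (y : R) := Num.sqrt (1 - y ^+ 2).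
have cc : continuous c by exact: continuous_circle.
have ccN : continuous (fun y => - c y) by move=> y; apply: cvgN; exact: cc.
pose g1 x y := sqrt_weight eps (x - c y); pose g2 x y := sqrt_weight eps (x - (- c y)).
pose g3 x y := sqrt_weight eps (y - c x); pose g4 x y := sqrt_weight eps (y - (- c x)).
have mswap : measurable_fun setT (fun xy : plane R => (xy.2, xy.1)).
  exact: measurable_swap.
have mg1 : measurable_fun setT (fun xy : plane R => g1 xy.1 xy.2).
  exact: measurable_sqrt_weight2.
have mg2 : measurable_fun setT (fun xy : plane R => g2 xy.1 xy.2).
  exact: (measurable_sqrt_weight2 (c := fun y => - c y)).
have mg3 : measurable_fun setT (fun xy : plane R => g3 xy.1 xy.2).
  exact: (measurableT_comp (measurable_sqrt_weight2 e0 cc) mswap).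
have mg4 : measurable_fun setT (fun xy : plane R => g4 xy.1 xy.2).
  exact: (measurableT_comp (measurable_sqrt_weight2 e0 ccN) mswap).
have g0 u : 0 <= sqrt_weight eps u by exact: sqrt_weight_ge0.
have K8 : 0 <= 8 * Num.sqrt eta by rewrite mulr_ge0.
have I1 : (\int[(area R)]_(xy in @unit_square R)
    (AA xy * g1 xy.1 xy.2)%:E <= (8 * Num.sqrt eta * (4 * eta))%:E)%E.
  by apply: int_bump2_weight_x => // [x y|y]; [exact: g0|exact: int_bump_sqrt_weight].
have I2 : (\int[(area R)]_(xy in @unit_square R)
    (AA xy * g2 xy.1 xy.2)%:E <= (8 * Num.sqrt eta * (4 * eta))%:E)%E.
  by apply: int_bump2_weight_x => // [x y|y]; [exact: g0|exact: int_bump_sqrt_weight].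
have I3 : (\int[(area R)]_(xy in @unit_square R)
    (AA xy * g3 xy.1 xy.2)%:E <= (8 * Num.sqrt eta * (4 * eta))%:E)%E.
  by apply: int_bump2_weight_y => // [x y|y]; [exact: g0|exact: int_bump_sqrt_weight].
have I4 : (\int[(area R)]_(xy in @unit_square R)
    (AA xy * g4 xy.1 xy.2)%:E <= (8 * Num.sqrt eta * (4 * eta))%:E)%E.
  by apply: int_bump2_weight_y => // [x y|y]; [exact: g0|exact: int_bump_sqrt_weight].
have I0 : (\int[(area R)]_(xy in @unit_square R)
    (AA xy * 1)%:E <= (4 * eta * (4 * eta))%:E)%E.
  apply: (@int_bump2_weight_x R eta a b (4 * eta) (fun _ _ => 1)) => //; first by rewrite mulr_ge0// ltW.
  by move=> y; under eq_integral do rewrite mulr1; exact: int_bump.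
pose G (xy : R * R) := ((AA xy * 1)%:E + (AA xy * g1 xy.1 xy.2)%:E + (AA xy * g2 xy.1 xy.2)%:E
  + (AA xy * g3 xy.1 xy.2)%:E + (AA xy * g4 xy.1 xy.2)%:E)%E.
have mE (g : R -> R -> R) (D : set (R * R)) :
    measurable_fun setT (fun xy : plane R => g xy.1 xy.2) ->
    measurable_fun (D : set (plane R)) (fun xy => (AA xy * g xy.1 xy.2)%:E).
  by move=> mg; apply: measurable_funTS; apply/measurable_EFinP; exact: measurable_funM.
have m1 := mE (fun _ _ => 1) (@unit_square R) (measurable_cst _).
have m2 := mE _ (@unit_square R) mg1; have m3 := mE _ (@unit_square R) mg2.
have m4 := mE _ (@unit_square R) mg3; have m5 := mE _ (@unit_square R) mg4.
have mU : measurable (@unit_square R) by exact: measurableX.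
have mG : measurable_fun (@unit_square R) G by do 4 apply: emeasurable_funD => //.
have nn (g : R -> R -> R) xy : (forall x y, 0 <= g x y) -> (0 <= (AA xy * g xy.1 xy.2)%:E)%E.
  by move=> gg; rewrite lee_fin mulr_ge0.
have n1' := nn (fun _ _ => 1) _ (fun _ _ => ler01).
have n2' xy : (0 <= (AA xy * g1 xy.1 xy.2)%:E)%E by apply: nn => x y; exact: g0.
have n3' xy : (0 <= (AA xy * g2 xy.1 xy.2)%:E)%E by apply: nn => x y; exact: g0.
have n4' xy : (0 <= (AA xy * g3 xy.1 xy.2)%:E)%E by apply: nn => x y; exact: g0.
have n5' xy : (0 <= (AA xy * g4 xy.1 xy.2)%:E)%E by apply: nn => x y; exact: g0.
have G0 xy : (0 <= G xy)%E by rewrite /G !adde_ge0.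
have GI : (\int[(area R)]_(xy in @unit_square R) G xy <=
    (144 * (eta * Num.sqrt eta))%:E)%E.
  rewrite /G ge0_integralD//; [|by move=> x _; rewrite !adde_ge0|by do 3 apply: emeasurable_funD => //].
  rewrite ge0_integralD//; [|by move=> x _; rewrite !adde_ge0|by do 2 apply: emeasurable_funD => //].
  rewrite ge0_integralD//; [|by move=> x _; rewrite !adde_ge0|by apply: emeasurable_funD => //].
  rewrite ge0_integralD//.
  apply: (le_trans (leeD (leeD (leeD (leeD I0 I1) I2) I3) I4)).
  rewrite -!EFinD lee_fin.
  have : eta * eta <= eta * Num.sqrt eta.
    rewrite ler_wpM2l ?(ltW n0)// -(@ler_pXn2r _ 2)// ?nnegrE ?(ltW n0)// sqr_sqrtr ?(ltW n0)//.
    by rewrite expr2 ler_piMl// ltW.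
  by lra.
have mG2 : measurable_fun (@unit_square R) (fun xy => 2%:E * G xy)%E by exact: measurable_funeM.
apply: (@le_trans _ _ (\int[(area R)]_(xy in @discRR R)
   (2%:E * G xy))%E).
  apply: ge0_le_integral => //.
  - exact: discRR_measurable.
  - by move=> xy _; rewrite lee_fin mulr_ge0// ?AA0// sqrt_weight_ge0.
  - apply/measurable_EFinP; apply: measurable_funM; first exact: measurable_funTS.
    apply: measurable_funTS.
    have mw : measurable_fun setT (@sqrt_weight R eps).
      by apply: continuous_measurable_fun; exact: continuous_sqrt_weight.
    by apply: (measurableT_comp mw); apply: measurable_funB => //; exact: measurable_normc.
  - exact: (measurable_funS mU (@discRR_unit_square R)).
  - move=> [x y] /discE Dz; rewrite /G -!EFinD -EFinM lee_fin.
    have -> : sqrt_weight eps (1 - normc (x +i* y)) = (Num.sqrt (1 - normc (x +i* y) + eps))^-1.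
      by rewrite /sqrt_weight ger0_norm// subr_ge0 ltW.
    apply: (le_trans (ler_wpM2l (AA0 (x, y)) (inv_sqrt_boundary e0 Dz))).
    rewrite /boundary_weight /g1 /g2 /g3 /g4 /c !opprK /=.
    by rewrite le_eqVlt; apply/orP; left; apply/eqP; ring.
have G20 xy : @unit_square R xy -> (0 <= 2%:E * G xy)%E by move=> _; rewrite mule_ge0.
apply: (@le_trans _ _ (\int[(area R)]_(xy in @unit_square R)
   (2%:E * G xy))%E).
  by apply: ge0_subset_integral => //; [exact: discRR_measurable|exact: discRR_unit_square].
rewrite ge0_integralZl_EFin//.
apply: (le_trans (lee_wpmul2l _ GI)) => //.
by rewrite -EFinM lee_fin mulrA; lra.
Qed.

(** * Test kernels *)

Lemma powR2_gt1 (R : realType) (s : R) : 0 < s -> 0 < 2 `^ s - 1.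
Proof.
move=> s0; rewrite subr_gt0.
have : 1 `^ s < 2 `^ s by apply: gt0_ltr_powR; rewrite ?nnegrE// ltr1n.
by rewrite powR1.
Qed.

(** A primitive, with respect to doubling, for a^s min(4, 9 / a^2): the first term grows by 4 a^s
    when a <= 1, the second by 18 / (2 a) = 9 / a when a > 1, and the minima keep both bounded. *)
Definition scale_potential (R : realType) (s a : R) : R :=
  4 / (2 `^ s - 1) * Num.min a 2 `^ s - 18 * Num.min 1 a^-1.

Lemma scale_term_telescope (R : realType) (s a : R) : 0 < s -> s <= 1 -> 0 < a ->
  a `^ s * Num.min 4 (9 / a ^+ 2) <= scale_potential s (2 * a) - scale_potential s a.
Proof.
move=> s0 s1 a0; pose psi (x : R) := Num.min x 2 `^ s; pose chi (x : R) := - Num.min 1 x^-1.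
have -> : scale_potential s (2 * a) - scale_potential s a =
    4 / (2 `^ s - 1) * (psi (2 * a) - psi a) + 18 * (chi (2 * a) - chi a).
  by rewrite /scale_potential /psi /chi; ring.
have c0 : 0 < 2 `^ s - 1.
  exact: powR2_gt1.
have psi_mono : 0 <= psi (2 * a) - psi a.
  have m0 x : 0 < x -> 0 <= Num.min x 2 :> R by move=> x0; rewrite le_min ltW/=.
  rewrite subr_ge0 /psi; apply: ge0_ler_powR; rewrite ?nnegrE ?m0 ?mulr_gt0 ?(ltW s0)//.
  rewrite le_min !ge_min lexx orbT andbT; apply/orP; left; lra.
have chi_mono : 0 <= chi (2 * a) - chi a.
  rewrite /chi opprK addrC subr_ge0 le_min !ge_min lexx /= lef_pV2 ?posrE ?mulr_gt0//.
  by apply/orP; right; lra.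
have [a1|a1] := leP a 1.
  apply: (@le_trans _ _ (4 / (2 `^ s - 1) * (psi (2 * a) - psi a))); last first.
    by rewrite lerDl mulr_ge0.
  have -> : psi (2 * a) - psi a = (2 `^ s - 1) * a `^ s.
    rewrite /psi !min_l; [|lra|lra].
    by rewrite powRM ?ltW// mulrBl mul1r.
  rewrite mulrA divfK ?gt_eqF// mulrC ler_wpM2r ?powR_ge0//.
  by rewrite ge_min lexx.
apply: (@le_trans _ _ (18 * (chi (2 * a) - chi a))); last first.
  by rewrite lerDr mulr_ge0// divr_ge0// ltW.
have -> : chi (2 * a) - chi a = (2 * a)^-1.
  have h1 : Num.min 1 a^-1 = a^-1 by rewrite min_r// invf_le1// ltW.
  have h2 : Num.min 1 (2 * a)^-1 = (2 * a)^-1 by rewrite min_r// invf_le1 ?mulr_gt0//; lra.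
  by rewrite /chi h1 h2; field; rewrite gt_eqF.
apply: (@le_trans _ _ (a * (9 / a ^+ 2))).
  apply: ler_pM.
  - exact: powR_ge0.
  - by rewrite le_min ler0n divr_ge0// sqr_ge0.
  - by have := ler_powR (ltW a1) s1; rewrite powRr1// ltW.
  - by rewrite ge_min lexx orbT.
by rewrite le_eqVlt; apply/orP; left; apply/eqP; field; rewrite gt_eqF.
Qed.

(** The summands peak where 2^m is about 1 / d, whence d^(-s). In the variable a = 2^m d the sum
    telescopes to a difference of two values of a bounded potential, so C does not depend on M. *)
Lemma scale_sum (R : realType) (s : R) : 0 < s -> s <= 1 -> exists2 C : R, 0 < C &
  forall (d : R) (M : nat), 0 < d ->
    \sum_(m < M) (2 ^+ m) `^ s * Num.min 4 (9 / (2 ^+ m * d) ^+ 2) <= C * d `^ (- s).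
Proof.
move=> s0 s1; have c0 : 0 < 2 `^ s - 1.
  exact: powR2_gt1.
have q0 : 0 < 4 / (2 `^ s - 1) by rewrite divr_gt0.
exists (4 / (2 `^ s - 1) * 2 `^ s + 18).
  by rewrite addr_gt0// mulr_gt0// powR_gt0.
move=> d M d0.
have H n : \sum_(m < n) (2 ^+ m * d) `^ s * Num.min 4 (9 / (2 ^+ m * d) ^+ 2) <=
    scale_potential s (2 ^+ n * d) - scale_potential s d.
  elim: n => [|n IH]; first by rewrite big_ord0 expr0 mul1r subrr.
  rewrite big_ord_recr /=.
  have := @scale_term_telescope R s (2 ^+ n * d) s0 s1.
  rewrite mulr_gt0 ?exprn_gt0// => /(_ isT).
  by rewrite mulrA -exprS; move: IH; lra.
have -> : \sum_(m < M) (2 ^+ m) `^ s * Num.min 4 (9 / (2 ^+ m * d) ^+ 2) =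
   (\sum_(m < M) (2 ^+ m * d) `^ s * Num.min 4 (9 / (2 ^+ m * d) ^+ 2)) * d `^ (- s).
  rewrite mulr_suml; apply: eq_bigr => m _.
  have ds : d `^ s != 0 by rewrite gt_eqF// powR_gt0.
  by rewrite powRM ?exprn_ge0 ?(ltW d0)// powRN mulrAC mulfK.
rewrite ler_wpM2r ?powR_ge0//; apply: (le_trans (H M)).
have pot_le x : 0 < x -> scale_potential s x <= 4 / (2 `^ s - 1) * 2 `^ s.
  move=> x0; rewrite /scale_potential lerBlDr -[leLHS]addr0 lerD ?mulr_ge0 ?le_min ?ler01 ?invr_ge0 ?(ltW x0)//.
  rewrite ler_wpM2l ?(ltW q0)//.
  apply: ge0_ler_powR; rewrite ?nnegrE ?(ltW s0)//.
    by rewrite le_min (ltW x0) ler0n.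
  by rewrite ge_min lexx orbT.
have pot_ge x : 0 < x -> - 18 <= scale_potential s x.
  move=> x0; rewrite /scale_potential.
  have : Num.min 1 x^-1 <= 1 :> R by rewrite ge_min lexx.
  by have := mulr_ge0 (ltW q0) (powR_ge0 (Num.min x 2) s); lra.
have := pot_le (2 ^+ M * d); have := pot_ge d d0.
by rewrite mulr_gt0 ?exprn_gt0// => ? /(_ isT); lra.
Qed.

(** Hoelder's inequality up to 2^p, from [le_powR_young] at l = (V / S)^(1/p), which balances the
    two sums. S = 0 and V = 0, where l degenerates, are treated apart. *)
Lemma weighted_powR_sum (R : realType) (J : finType) (p : R) (c t : J -> R) : 1 <= p ->
  (forall j, 0 <= c j) -> (forall j, 0 <= t j) ->
  (\sum_j c j * t j) `^ p <= 2 `^ p * ((\sum_j c j) `^ (p - 1) * \sum_j c j * t j `^ p).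
Proof.
move=> p1 c0 t0; have p0 : 0 < p by rewrite (lt_le_trans ltr01).
set S := \sum_j c j; set V := \sum_j c j * t j `^ p.
have S0 : 0 <= S by apply: sumr_ge0.
have V0 : 0 <= V by apply: sumr_ge0 => j _; rewrite mulr_ge0// powR_ge0.
have rhs0 : 0 <= 2 `^ p * (S `^ (p - 1) * V) by rewrite !mulr_ge0// powR_ge0.
have [S1|S1] := eqVneq S 0.
  rewrite big1 ?powR0 ?gt_eqF// => j _.
  have /eqP := S1; rewrite psumr_eq0// => /allP/(_ j (mem_index_enum _)) /eqP ->.
  by rewrite mul0r.
have [V1|V1] := eqVneq V 0.
  rewrite big1 ?powR0 ?gt_eqF// => j _.
  have /eqP := V1; rewrite psumr_eq0; last by move=> i _; rewrite mulr_ge0// powR_ge0.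
  move=> /allP/(_ j (mem_index_enum _)); rewrite /= mulf_eq0 => /orP[/eqP ->|].
    by rewrite mul0r.
  by rewrite powR_eq0 => /andP[/eqP -> _]; rewrite mulr0.
have Sp : 0 < S by rewrite lt_def S1.
have Vp : 0 < V by rewrite lt_def V1.
pose l := (V / S) `^ p^-1.
have l0 : 0 < l by rewrite powR_gt0// divr_gt0.
have lp : l `^ p = V / S by rewrite -powRrM mulVf ?gt_eqF// powRr1// divr_ge0.
have le1 : \sum_j c j * t j <= 2 * l * S.
  apply: (@le_trans _ _ (\sum_j (c j * l + l `^ (1 - p) * (c j * t j `^ p)))).
    apply: ler_sum => j _; rewrite mulrCA -mulrDr ler_wpM2l//.
    exact: le_powR_young.
  rewrite big_split /= -mulr_suml -mulr_sumr -/S -/V.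
  have -> : l `^ (1 - p) * V = l * S.
    rewrite powRB; last by rewrite (gt_eqF l0) implybT.
    by rewrite powRr1 ?(ltW l0)// lp; field; rewrite S1 V1.
  by lra.
have s0 : 0 <= \sum_j c j * t j by apply: sumr_ge0 => j _; rewrite mulr_ge0.
apply: (@le_trans _ _ ((2 * l * S) `^ p)).
  by apply: ge0_ler_powR; rewrite ?nnegrE ?(ltW p0)// !mulr_ge0// ltW.
rewrite !powRM ?mulr_ge0 ?(ltW l0)// lp.
rewrite powRB; last by rewrite S1 implybT.
by rewrite powRr1// le_eqVlt; apply/orP; left; apply/eqP; field.
Qed.

(** Used in both directions: the kernel denominator dominates |z - w|, and it is small when w and z
    are close to each other on the scale of their distance to the circle. *)
Lemma kernel_identity (R : realType) (w z : R[i]) :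
  normc (1 - conjc w * z) ^+ 2 =
  normc (z - w) ^+ 2 + (1 - normc w ^+ 2) * (1 - normc z ^+ 2).
Proof.
by rewrite !normc_sqr; case: w => a b; case: z => x y /=; ring.
Qed.

Lemma normc_conjc (R : realType) (w : R[i]) : normc (conjc w) = normc w.
Proof. by case: w => a b /=; rewrite sqrrN. Qed.

Lemma kernel_ge_dist (R : realType) (w z : R[i]) : normc w <= 1 -> normc z <= 1 ->
  normc (z - w) <= normc (1 - conjc w * z).
Proof.
move=> w1 z1; rewrite -(@ler_pXn2r _ 2)// ?nnegrE ?normc_ge0// kernel_identity lerDl.
by rewrite mulr_ge0// subr_ge0 expr_le1 ?normc_ge0.
Qed.

Lemma kernel_ge (R : realType) (w z : R[i]) :
  1 - normc w * normc z <= normc (1 - conjc w * z).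
Proof.
have := @rnorm_lip R R[i]^o 1 (conjc w * z); rewrite !rnormc normc1 normcM normc_conjc.
by apply: le_trans; exact: ler_norm.
Qed.

Lemma kernel_ge_z (R : realType) (w z : R[i]) : normc w <= 1 ->
  1 - normc z <= normc (1 - conjc w * z).
Proof.
move=> w1; apply: le_trans (kernel_ge w z).
by rewrite lerD2l lerN2 ler_piMl ?normc_ge0.
Qed.

Lemma kernel_ge_w (R : realType) (w z : R[i]) : normc z <= 1 ->
  1 - normc w <= normc (1 - conjc w * z).
Proof.
move=> w1; apply: le_trans (kernel_ge w z).
by rewrite lerD2l lerN2 ler_piMr ?normc_ge0.
Qed.

Lemma ratio_le_bump (R : realType) (eta D u : R) : 0 < eta -> eta / 2 <= D -> `|u| <= D ->
  (eta / D) ^+ 2 <= 8 * poisson_bump eta u.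
Proof.
move=> n0 nD uD; have D0 : 0 < D by rewrite (lt_le_trans _ nD)// divr_gt0.
have e2 : 0 < eta ^+ 2 by rewrite exprn_gt0.
have u2 : u ^+ 2 <= D ^+ 2.
  by rewrite -(real_normK (num_real u)) ler_pXn2r ?nnegrE// ltW.
have n2 : (eta / 2) ^+ 2 <= D ^+ 2.
  by rewrite ler_pXn2r ?nnegrE ?divr_ge0 ?(ltW n0) ?(ltW D0).
rewrite /poisson_bump !expr_div_n.
have -> : 8 * (1 + u ^+ 2 / eta ^+ 2)^-1 = 8 * eta ^+ 2 / (eta ^+ 2 + u ^+ 2).
  by field; rewrite !gt_eqF// ltr_pwDl// sqr_ge0.
rewrite ler_pdivlMr ?ltr_pwDl ?sqr_ge0// mulrAC ler_pdivrMr ?exprn_gt0//.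
rewrite [leRHS]mulrAC [leLHS]mulrC ler_wpM2r ?(ltW e2)//.
by move: n2; rewrite expr_div_n (_ : 2 ^+ 2 = 4 :> R) -?natrX//; lra.
Qed.

(* An index is a scale [m < M] together with a point of a grid of step [2^-m / 8]; a point
   too close to the circle for its scale is given the zero kernel. *)
Definition grid_size (M : nat) : nat := (16 * 2 ^ M)%N.

Definition kernel_index (M : nat) : finType := ('I_M * ('I_(grid_size M) * 'I_(grid_size M)))%type.

Definition scale (R : realType) (m : nat) : R := (2 ^+ m)^-1.

(** The offset 2^M does not depend on m, so all scales share one index range; for m <= M the nodes
    step through [-1, 1). *)
Definition grid_coord (R : realType) (M m k : nat) : R := scale R m * (k%:R / 8 - 2 ^+ M).

Definition grid_point (R : realType) (M : nat) (j : kernel_index M) : R[i] :=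
  grid_coord R M j.1 j.2.1 +i* grid_coord R M j.1 j.2.2.

Definition grid_keep (R : realType) (M : nat) (j : kernel_index M) : bool :=
  normc (grid_point R j) <= 1 - scale R j.1 / 2.

(** The first factor normalizes in L^p: a kernel whose grid point is at distance about its scale
    from the circle has size about scale^(-2/p) on an area about scale^2. *)
Definition test_kernel (R : realType) (p : R) (M : nat) (j : kernel_index M) (z : R[i]) : R[i] :=
  if grid_keep R j then
    (scale R j.1 `^ (- (2 / p)))%:C * ((scale R j.1)%:C / (1 - conjc (grid_point R j) * z)) ^+ 6
  else 0.

Definition kernel_size (R : realType) (M : nat) (j : kernel_index M) (z : R[i]) : R :=
  if grid_keep R j then (scale R j.1 / normc (1 - conjc (grid_point R j) * z)) ^+ 6 else 0.

Lemma scale_gt0 (R : realType) (m : nat) : 0 < scale R m.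
Proof. by rewrite invr_gt0 exprn_gt0. Qed.

Lemma scale_le1 (R : realType) (m : nat) : scale R m <= 1.
Proof. by rewrite invf_le1 ?exprn_gt0// exprn_ege1// ler1n. Qed.

Lemma normc_test_kernel (R : realType) (p : R) (M : nat) (j : kernel_index M) (z : R[i]) :
  normc (test_kernel p j z) = scale R j.1 `^ (- (2 / p)) * kernel_size j z.
Proof.
rewrite /test_kernel /kernel_size; case: ifP => _; last by rewrite normc0 mulr0.
rewrite normcM normcX normcM normcV !normc_real !ger0_norm ?powR_ge0//.
exact/ltW/scale_gt0.
Qed.

Lemma kernel_size_ge0 (R : realType) (M : nat) (j : kernel_index M) (z : R[i]) :
  0 <= kernel_size j z.
Proof.
rewrite /kernel_size; case: ifP => // _.
by rewrite exprn_ge0// divr_ge0 ?normc_ge0// ltW// scale_gt0.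
Qed.

Lemma keep_le1 (R : realType) (M : nat) (j : kernel_index M) : grid_keep R j ->
  normc (grid_point R j) < 1.
Proof.
by move=> /le_lt_trans; apply; rewrite gtrBl divr_gt0// scale_gt0.
Qed.

Lemma keep_kernel_gt0 (R : realType) (M : nat) (j : kernel_index M) (z : R[i]) :
  grid_keep R j -> normc z < 1 ->
  scale R j.1 / 2 <= normc (1 - conjc (grid_point R j) * z).
Proof.
move=> kj z1; apply: le_trans (kernel_ge_w _ (ltW z1)).
by move: kj; rewrite /grid_keep; lra.
Qed.

Lemma cdiff_test_kernel (R : realType) (p : R) (M : nat) (j : kernel_index M) (z : R[i]) :
  disc z -> cdiff (test_kernel p j) z.
Proof.
move=> /discE z1; rewrite /test_kernel; case: (boolP (grid_keep R j)) => kj; last exact: cdiff_cst.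
pose f x := (scale R j.1)%:C / (1 - conjc (grid_point R j) * x).
have df : cdiff f z.
  apply: cdiffM; first exact: cdiff_cst.
  apply: cdiffV.
    rewrite -normc_gt0 (lt_le_trans _ (keep_kernel_gt0 kj z1))//.
    by rewrite divr_gt0// scale_gt0.
  apply: cdiffB; first exact: cdiff_cst.
  by apply: cdiffM; [exact: cdiff_cst|exact: cdiff_id].
apply: cdiffM; first exact: cdiff_cst.
rewrite (_ : (fun x => _) = fun x => \prod_(k < 6) f x).
  by apply: (@cdiff_prod R 6 (fun _ => f)).
by apply/funext => x; rewrite prodr_const card_ord.
Qed.

(** Of the three squares in the sixth power, one is bounded by a bump in x, one by a bump in y, and
    one is kept for the sum over scales. The 2^-M added to 1 - |z| is at most half of every scale in
    use, so it does not spoil the third bound. *)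
Lemma kernel_size_le (R : realType) (M : nat) (j : kernel_index M) (x y : R) :
  normc (x +i* y) < 1 ->
  kernel_size j (x +i* y) <=
    64 * (poisson_bump (scale R j.1) (x - grid_coord R M j.1 j.2.1) *
          poisson_bump (scale R j.1) (y - grid_coord R M j.1 j.2.2)) *
    Num.min 4 (9 / (2 ^+ j.1 * (1 - normc (x +i* y) + scale R M)) ^+ 2).
Proof.
move=> z1; rewrite /kernel_size; set w := grid_point R j; set n := scale R j.1.
set A := poisson_bump _ _; set B := poisson_bump _ _; set d := 1 - _ + _.
have A0 : 0 <= A by exact: poisson_bump_ge0.
have B0 : 0 <= B by exact: poisson_bump_ge0.
have n0 : 0 < n by exact: scale_gt0.
have d0 : 0 < d by rewrite ltr_pwDr ?scale_gt0// subr_ge0 ltW.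
have dn : (2 ^+ j.1 * d) = d / n by rewrite /n /scale invrK mulrC.
rewrite dn; have min0 : 0 <= Num.min 4 (9 / (d / n) ^+ 2).
  by rewrite le_min ler0n divr_ge0// sqr_ge0.
case: ifP => kj; last by rewrite mulr_ge0// mulr_ge0// mulr_ge0.
set D := normc _; have nD : n / 2 <= D by exact: keep_kernel_gt0.
have D0 : 0 < D by rewrite (lt_le_trans _ nD)// divr_gt0.
have w1 := ltW (keep_le1 kj).
have zw : normc ((x +i* y) - w) <= D by exact: kernel_ge_dist (ltW z1).
have rA : (n / D) ^+ 2 <= 8 * A.
  by apply: ratio_le_bump => //; exact: le_trans (normc_Re ((x +i* y) - w)) zw.
have rB : (n / D) ^+ 2 <= 8 * B.
  by apply: ratio_le_bump => //; exact: le_trans (normc_Im ((x +i* y) - w)) zw.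
have q0 : 0 <= n / D by rewrite divr_ge0 ?ltW.
have rm : (n / D) ^+ 2 <= Num.min 4 (9 / (d / n) ^+ 2).
  rewrite le_min; apply/andP; split.
    have : n / D <= 2 by rewrite ler_pdivrMr//; move: nD; lra.
    have E4 : 4 = 2 ^+ 2 :> R by rewrite -natrX.
    by move=> q2; rewrite E4 ler_pXn2r ?nnegrE.
  have Mm : scale R M <= n / 2.
    rewrite /n /scale -invfM lef_pV2 ?posrE ?mulr_gt0 ?exprn_gt0// -exprSr.
    by rewrite ler_weXn2l ?ler1n// ltn_ord.
  have dD : d <= 2 * D.
    have := kernel_ge_z (x +i* y) w1; rewrite -/D /d => h.
    by move: h nD Mm; lra.
  have -> : 9 / (d / n) ^+ 2 = 9 * n ^+ 2 / d ^+ 2 by field; rewrite !gt_eqF.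
  rewrite expr_div_n ler_pdivrMr ?exprn_gt0// mulrAC ler_pdivlMr ?exprn_gt0//.
  have -> : 9 * n ^+ 2 * D ^+ 2 = n ^+ 2 * (9 * D ^+ 2) by ring.
  rewrite ler_wpM2l ?sqr_ge0//.
  have : d ^+ 2 <= (2 * D) ^+ 2.
    by rewrite ler_pXn2r ?nnegrE ?mulr_ge0 ?(ltW d0) ?(ltW D0).
  have E4 : 2 ^+ 2 = 4 :> R by rewrite -natrX.
  by rewrite exprMn E4; have := sqr_ge0 D; lra.
have -> : (n / D) ^+ 6 = (n / D) ^+ 2 * (n / D) ^+ 2 * (n / D) ^+ 2 by ring.
have -> : 64 * (A * B) = 8 * A * (8 * B) by ring.
apply: ler_pM => //; [by rewrite mulr_ge0 ?sqr_ge0|exact: sqr_ge0|].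
by apply: ler_pM => //; exact: sqr_ge0.
Qed.

Lemma grid_bump_sum (R : realType) (M m : nat) (x : R) :
  \sum_(k < grid_size M) poisson_bump (scale R m) (x - grid_coord R M m k) <= 64.
Proof.
have s0 := scale_gt0 R m.
rewrite (eq_bigr (fun k : 'I__ => (1 + ((x / scale R m + 2 ^+ M) - k%:R / 8) ^+ 2)^-1)).
  exact: grid_sum.
move=> k _; rewrite /poisson_bump /grid_coord; congr ((1 + _ ^+ 2)^-1).
by field; rewrite gt_eqF.
Qed.

(** At every scale the bumps sum to at most 64 in each grid coordinate; with the factor 64 of
    [kernel_size_le] this leaves 64^3 times the sum over scales. *)
Lemma kernel_weighted_sum (R : realType) (s : R) : 0 < s -> s <= 1 -> exists2 C : R, 0 < C &
  forall (M : nat) (x y : R), normc (x +i* y) < 1 ->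
    \sum_(j : kernel_index M) kernel_size j (x +i* y) * scale R j.1 `^ (- s) <=
      C * (1 - normc (x +i* y) + scale R M) `^ (- s).
Proof.
move=> s0 s1; have [C C0 HC] := scale_sum s0 s1.
exists (64 ^+ 3 * C); first by rewrite mulr_gt0// exprn_gt0.
move=> M x y z1; set d := 1 - _ + _.
have d0 : 0 < d by rewrite ltr_pwDr ?scale_gt0// subr_ge0 ltW.
pose A (m k : nat) := poisson_bump (scale R m) (x - grid_coord R M m k).
pose B (m k : nat) := poisson_bump (scale R m) (y - grid_coord R M m k).
have A0 m k : 0 <= A m k by exact: poisson_bump_ge0.
have B0 m k : 0 <= B m k by exact: poisson_bump_ge0.
pose T (m : nat) := (2 ^+ m) `^ s * Num.min 4 (9 / (2 ^+ m * d) ^+ 2).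
have T0 m : 0 <= T m.
  by rewrite mulr_ge0 ?powR_ge0// le_min ler0n divr_ge0// sqr_ge0.
apply: (@le_trans _ _ (\sum_(j : kernel_index M) 64 * T j.1 * (A j.1 j.2.1 * B j.1 j.2.2))).
  apply: ler_sum => j _.
  apply: (le_trans (ler_wpM2r (powR_ge0 _ _) (kernel_size_le j z1))).
  rewrite -/d -/(A _ _) -/(B _ _) /T.
  have -> : scale R j.1 `^ (- s) = (2 ^+ j.1) `^ s.
    by rewrite /scale -powR_inv1 ?exprn_ge0// -powRrM mulN1r opprK.
  by rewrite le_eqVlt; apply/orP; left; apply/eqP; ring.
rewrite -(pair_bigA _ (fun (m : 'I_M) (kl : 'I_(grid_size M) * 'I_(grid_size M)) =>
   64 * T m * (A m kl.1 * B m kl.2))) /=.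
apply: (@le_trans _ _ (\sum_(m < M) 64 ^+ 3 * T m)); last first.
  by rewrite -mulr_sumr -mulrA ler_wpM2l ?exprn_ge0// HC.
apply: ler_sum => m _; rewrite -mulr_sumr.
rewrite -(pair_bigA _ (fun (k l : 'I_(grid_size M)) => A m k * B m l)) /=.
under eq_bigr do rewrite -mulr_sumr.
rewrite -mulr_suml.
have -> : 64 ^+ 3 * T m = 64 * T m * (64 * 64) by ring.
apply: ler_wpM2l; first by rewrite mulr_ge0// T0.
apply: ler_pM; rewrite ?sumr_ge0//; exact: grid_bump_sum.
Qed.

Lemma normc_sum_le (R : realType) (J : finType) (F : J -> R[i]) :
  normc (\sum_j F j) <= \sum_j normc (F j).
Proof. by have := @rnorm_sum R R[i]^o J (index_enum J) xpredT F. Qed.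

(* Schur's test: Hoelder's inequality with the weights [2^(m s)], [s = 1 / (2 (p - 1))]. *)
Lemma test_kernel_pointwise (R : realType) (p : R) : 2 <= p -> exists2 C : R, 0 < C &
  forall (M : nat) (b : kernel_index M -> R[i]) (x y : R), normc (x +i* y) < 1 ->
    normc (\sum_j b j * test_kernel p j (x +i* y)) `^ p <=
    \sum_j C * normc (b j) `^ p * (scale R j.1 * Num.sqrt (scale R j.1))^-1 *
      (poisson_bump (scale R j.1) (x - grid_coord R M j.1 j.2.1) *
       poisson_bump (scale R j.1) (y - grid_coord R M j.1 j.2.2) *
       sqrt_weight (scale R M) (1 - normc (x +i* y))).
Proof.
move=> p2; have p0 : 0 < p by lra.
have p1 : 1 <= p by lra.
have p10 : 0 < p - 1 by lra.
pose s := (2 * (p - 1))^-1.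
have s0 : 0 < s by rewrite invr_gt0 mulr_gt0.
have s1 : s <= 1 by rewrite invf_le1 ?mulr_gt0//; lra.
have sp : s * (p - 1) = 2^-1 by rewrite /s; field; rewrite gt_eqF.
have [C C0 HC] := kernel_weighted_sum s0 s1.
exists (2 `^ p * C `^ (p - 1) * 256).
  by apply: mulr_gt0; rewrite ?ltr0n// mulr_gt0// powR_gt0.
move=> M b x y z1; set z := x +i* y.
have d0 : 0 < 1 - normc z + scale R M by rewrite ltr_pwDr ?scale_gt0// subr_ge0 ltW.
pose c (j : kernel_index M) := kernel_size j z * scale R j.1 `^ (- s).
(* The product c_j t_j is |b_j k_j|: the Schur weight scale^(-s) put into c_j is compensated
   here. *)
pose t (j : kernel_index M) := normc (b j) * scale R j.1 `^ (s - 2 / p).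
have c0 j : 0 <= c j by rewrite mulr_ge0 ?kernel_size_ge0 ?powR_ge0.
have t0 j : 0 <= t j by rewrite mulr_ge0 ?normc_ge0 ?powR_ge0.
have sj j : scale R j != 0 by rewrite gt_eqF// scale_gt0.
have le1 : normc (\sum_j b j * test_kernel p j z) <= \sum_j c j * t j.
  apply: (le_trans (normc_sum_le _)); apply: ler_sum => j _.
  rewrite normcM normc_test_kernel /c /t.
  have -> : scale R j.1 `^ (- (2 / p)) = scale R j.1 `^ (- s) * scale R j.1 `^ (s - 2 / p).
    by rewrite -powRD ?sj ?implybT//; congr (_ `^ _); ring.
  by rewrite le_eqVlt; apply/orP; left; apply/eqP; ring.
have st0 : 0 <= \sum_j c j * t j by apply: sumr_ge0 => j _; rewrite mulr_ge0.
apply: (@le_trans _ _ ((\sum_j c j * t j) `^ p)).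
  by apply: ge0_ler_powR; rewrite ?nnegrE ?normc_ge0 ?(ltW p0).
apply: (le_trans (weighted_powR_sum p1 c0 t0)).
have Sle : (\sum_j c j) `^ (p - 1) <= C `^ (p - 1) * sqrt_weight (scale R M) (1 - normc z).
  apply: (@le_trans _ _ ((C * (1 - normc z + scale R M) `^ (- s)) `^ (p - 1))).
    apply: ge0_ler_powR; rewrite ?nnegrE ?(ltW p10) ?sumr_ge0 ?mulr_ge0 ?powR_ge0 ?(ltW C0)//.
    exact: HC.
  rewrite powRM ?(ltW C0) ?powR_ge0// -powRrM mulNr sp powRN powR12_sqrt ?(ltW d0)//.
  by rewrite /sqrt_weight ger0_norm// subr_ge0 ltW.
set W := sqrt_weight _ _ in Sle *.
have W0 : 0 <= W by exact: sqrt_weight_ge0.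
have V0 : 0 <= \sum_j c j * t j `^ p by apply: sumr_ge0 => j _; rewrite mulr_ge0// powR_ge0.
apply: (@le_trans _ _ (2 `^ p * (C `^ (p - 1) * W * \sum_j c j * t j `^ p))).
  by rewrite ler_wpM2l ?powR_ge0// ler_wpM2r.
rewrite mulr_sumr mulr_sumr; apply: ler_sum => j _.
have -> : c j * t j `^ p = kernel_size j z * (normc (b j) `^ p * (scale R j.1 * Num.sqrt (scale R j.1))^-1).
  have e0 := scale_gt0 R j.1.
  rewrite /c /t powRM ?normc_ge0 ?powR_ge0// -powRrM -!mulrA; congr (_ * _).
  rewrite mulrCA -powRD ?sj ?implybT//; congr (_ * _).
  (* The total exponent of the scale is -3/2, which the eta^(3/2) of [int_kernel] will cancel. *)
  have -> : - s + (s - 2 / p) * p = - 1 + - 2^-1.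
    have : s * p = s + 2^-1 by rewrite -sp; ring.
    by move=> sp'; rewrite mulrBl sp'; field; rewrite gt_eqF.
  by rewrite powRD ?sj ?implybT// powR_inv1 ?(ltW e0)// powRN powR12_sqrt ?(ltW e0)// invfM.
set P := normc (b j) `^ p; set Q := (_ * _)^-1; set A := poisson_bump _ _; set B := poisson_bump _ _.
have P0 : 0 <= P by exact: powR_ge0.
have Q0 : 0 <= Q by rewrite invr_ge0 mulr_ge0 ?sqrtr_ge0// ltW// scale_gt0.
(* The minimum is bounded by 4 here, as the decay across scales has already been spent in [Sle]. *)
have kAB : kernel_size j z <= 256 * (A * B).
  apply: (le_trans (kernel_size_le j z1)); rewrite -/A -/B.
  have AB0 : 0 <= A * B by rewrite mulr_ge0// poisson_bump_ge0.
  apply: (@le_trans _ _ (64 * (A * B) * 4)); last by lra.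
  by apply: ler_wpM2l; [rewrite pmulr_rge0|rewrite ge_min lexx].
have -> : 2 `^ p * C `^ (p - 1) * 256 * P * Q * (A * B * W) =
  2 `^ p * (C `^ (p - 1) * W * (256 * (A * B) * (P * Q))) by ring.
rewrite ler_wpM2l ?powR_ge0// ler_wpM2l ?mulr_ge0 ?powR_ge0//.
by rewrite ler_wpM2r// mulr_ge0.
Qed.

Lemma cdiff_sum (R : realType) (J : finType) (F : J -> R[i] -> R[i]) (z : R[i]) :
  (forall j, cdiff (F j) z) -> cdiff (fun x => \sum_j F j x) z.
Proof.
move=> dF; elim: (index_enum J) => [|j l IH].
  rewrite (_ : (fun x => _) = fun=> 0); first exact: cdiff_cst.
  by apply/funext => x; rewrite big_nil.
have -> : (fun x => \sum_(i <- j :: l) F i x) = (fun x => F j x + \sum_(i <- l) F i x).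
  by apply/funext => x; rewrite big_cons.
exact: (@cdiffD R (F j) (fun x => \sum_(i <- l) F i x) z (dF j) IH).
Qed.

(** After the cancellation of the powers of the scale, the j-th term of the pointwise bound
    integrates to at most 288 C |b_j|^p, independently of M. *)
Lemma test_kernel_norm (R : realType) (p : R) : 2 <= p -> exists2 C : R, 0 < C &
  forall (M : nat) (b : kernel_index M -> R[i]), \sum_j normc (b j) `^ p <= 1 ->
    (\int[(area R)]_(xy in @discRR R)
      (normc (\sum_j b j * test_kernel p j (xy.1 +i* xy.2)) `^ p)%:E <= C%:E)%E.
Proof.
move=> p2; have [C C0 HC] := test_kernel_pointwise p2.
exists (C * 288); first by apply: mulr_gt0; rewrite ?ltr0n.
move=> M b b1.
have mD : measurable (@discRR R) by exact: discRR_measurable.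
pose e (j : kernel_index M) := scale R j.1.
have e0 j : 0 < e j by exact: scale_gt0.
pose K j := C * normc (b j) `^ p * (e j * Num.sqrt (e j))^-1.
have K0 j : 0 <= K j.
  by rewrite !mulr_ge0 ?powR_ge0 ?(ltW C0)// invr_ge0 mulr_ge0 ?sqrtr_ge0// ltW.
pose F (j : kernel_index M) (xy : R * R) := poisson_bump (e j) (xy.1 - grid_coord R M j.1 j.2.1) *
   poisson_bump (e j) (xy.2 - grid_coord R M j.1 j.2.2) *
   sqrt_weight (scale R M) (1 - normc (xy.1 +i* xy.2)).
have F0 j xy : 0 <= F j xy by rewrite !mulr_ge0 ?poisson_bump_ge0 ?sqrt_weight_ge0.
have mF j : measurable_fun (@discRR R) (fun xy => (F j xy)%:E).
  apply: measurable_funTS; apply/measurable_EFinP; apply: measurable_funM.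
    exact: measurable_bump2.
  have mw : measurable_fun setT (@sqrt_weight R (scale R M)).
    by apply: continuous_measurable_fun; apply: continuous_sqrt_weight; exact: scale_gt0.
  by apply: (measurableT_comp mw); apply: measurable_funB => //; exact: measurable_normc.
have dk z : disc z -> cdiff (fun z => \sum_j b j * test_kernel p j z) z.
  move=> Dz; apply: cdiff_sum => j; apply: cdiffM; first exact: cdiff_cst.
  exact: cdiff_test_kernel.
have mk : measurable_fun (@discRR R) (fun xy : plane R =>
    (normc (\sum_j b j * test_kernel p j (xy.1 +i* xy.2)) `^ p)%:E).
  apply/measurable_EFinP.
  exact: (measurableT_comp (measurable_powR p)
    (disc_continuous_measurable (cdiff_normc_continuous dk))).
have mKF j : measurable_fun (@discRR R) (fun xy => ((K j)%:E * (F j xy)%:E)%E).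
  exact: measurable_funeM.
pose S (xy : plane R) := (\sum_j (K j)%:E * (F j xy)%:E)%E.
apply: (@le_trans _ _ (\int[(area R)]_(xy in @discRR R) S xy)%E).
  apply: ge0_le_integral => //.
  - by move=> xy _; rewrite lee_fin powR_ge0.
  - exact: emeasurable_sum.
  - move=> [x y] /discE Dz; rewrite /S; have -> : (\sum_j (K j)%:E * (F j (x, y))%:E = \sum_j (K j * F j (x, y))%:E)%E by [].
    by rewrite sumEFin lee_fin; exact: HC.
rewrite /S ge0_integral_sum//; last by move=> j xy _; rewrite -EFinM lee_fin mulr_ge0.
apply: (@le_trans _ _ (\sum_j (C * 288 * normc (b j) `^ p)%:E)%E).
  apply: lee_sum => j _; rewrite ge0_integralZl_EFin//; last by move=> xy _; rewrite lee_fin.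
  apply: (le_trans (lee_wpmul2l _ (@int_kernel R (e j) (scale R M) (grid_coord R M j.1 j.2.1)
    (grid_coord R M j.1 j.2.2) (e0 j) (scale_le1 R _) (scale_gt0 R _)))); first by rewrite lee_fin.
  rewrite -EFinM lee_fin /K le_eqVlt; apply/orP; left; apply/eqP; field.
  by rewrite !gt_eqF// ?sqrtr_gt0.
rewrite sumEFin lee_fin -mulr_sumr.
by apply: ler_piMr => //; apply: mulr_ge0; rewrite ?ler0n// ltW.
Qed.

Lemma grid_approx (R : realType) (M m : nat) (x : R) : (m <= M)%N -> `|x| < 1 ->
  exists k : 'I_(grid_size M), `|x - grid_coord R M m k| <= scale R m / 8.
Proof.
move=> mM; rewrite ltr_norml => /andP[x1 x2].
have n0 := scale_gt0 R m; pose q : R := x / scale R m.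
have pm : (scale R m)^-1 <= 2 ^+ M by rewrite /scale invrK ler_weXn2l ?ler1n.
have n1 : 0 < (scale R m)^-1 by rewrite invr_gt0.
have q1 : - 2 ^+ M < q.
  by rewrite /q; have : -1 * (scale R m)^-1 < x * (scale R m)^-1 by [rewrite ltr_pM2r]; lra.
have q2 : q < 2 ^+ M.
  by rewrite /q; have : x * (scale R m)^-1 < 1 * (scale R m)^-1 by [rewrite ltr_pM2r]; lra.
have y0 : 0 <= 8 * (q + 2 ^+ M) by rewrite mulr_ge0//; lra.
have /andP[k1 k2] := truncn_itv y0; set k := Num.truncn _ in k1 k2.
have kN : (k < grid_size M)%N.
  by rewrite -(ltr_nat R) /grid_size natrM natrX; apply: le_lt_trans k1 _; lra.
exists (Ordinal kN); rewrite /grid_coord /=.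
have -> : x - scale R m * (k%:R / 8 - 2 ^+ M) = scale R m / 8 * (8 * (q + 2 ^+ M) - k%:R).
  by rewrite /q; field; rewrite gt_eqF.
have s8 : 0 <= scale R m / 8 by rewrite divr_ge0// ltW.
rewrite normrM (ger0_norm s8) ler_piMr// ger0_norm ?subr_ge0//.
by move: k2; rewrite -natr1; lra.
Qed.

(** The first scale n below t = 1 - |w| satisfies n < t <= 2 n, and a grid point within n / 4 of w
    has kernel denominator at most 5 n at w; hence the power of 5. The hypothesis on M makes this
    scale one of the available ones. *)
Lemma test_kernel_lower (R : realType) (p : R) (M : nat) (w : R[i]) : 2 <= p ->
  2 * scale R M < 1 - normc w ->
  exists j : kernel_index M,
    (5 ^+ 6)^-1 `^ p / (1 - normc w ^+ 2) ^+ 2 <= normc (test_kernel p j w) `^ p.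
Proof.
move=> p2 wM; have p0 : 0 < p by lra.
set t := 1 - normc w in wM *.
have w0 := normc_ge0 w.
have sM := scale_gt0 R M.
have t0 : 0 < t by lra.
have scaleS n : scale R n = 2 * scale R n.+1.
  by rewrite /scale exprS; field; rewrite expf_neq0.
have exm : exists m, scale R m < t by exists M; lra.
case: (ex_minnP exm) => m mt mmin.
have m_gt0 : (0 < m)%N.
  by case: m mt {mmin} => // ; rewrite /scale expr0 invr1 /t; lra.
have mM : (m < M)%N.
  case: M wM sM => [|M] wM sM; first by move: wM; rewrite /scale expr0 invr1 /t; lra.
  by rewrite ltnS; apply: mmin; rewrite scaleS.
have t2 : t <= 2 * scale R m.
  rewrite -(prednK m_gt0) -scaleS leNgt; apply/negP => /mmin.
  by rewrite -ltnS prednK// ltnn.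
have n0 := scale_gt0 R m; set n := scale R m in mt t2 n0 *.
have w1 : normc w < 1 by move: t0; rewrite /t; lra.
have [k1 Hk1] := @grid_approx R M m (complex.Re w) (ltnW mM) (le_lt_trans (normc_Re w) w1).
have [k2 Hk2] := @grid_approx R M m (complex.Im w) (ltnW mM) (le_lt_trans (normc_Im w) w1).
exists (Ordinal mM, (k1, k2)); set j : kernel_index M := (_, _).
pose wj := grid_point R j.
have jn : scale R j.1 = n by [].
have dw : normc (w - wj) <= n / 4.
  apply: (le_trans (normc_ReIm _)).
  have -> : n / 4 = n / 8 + n / 8 by field.
  rewrite /wj /grid_point; move: Hk1 Hk2; case: w {t w0 w1 wM t0 exm mt mmin t2} => a b /=.
  by move=> h1 h2; apply: lerD.
have dwj : `|normc w - normc wj| <= n / 4.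
  by apply: le_trans dw; have := @rnorm_lip R R[i]^o w wj; rewrite !rnormc.
move: dwj; rewrite ler_norml => /andP[d1 d2].
have keep : grid_keep R j.
  by rewrite /grid_keep -/wj jn; move: d1 mt n0; rewrite /t; lra.
have wj0 := normc_ge0 wj.
pose D := normc (1 - conjc wj * w).
(* By [kernel_identity], D^2 is at most n^2 / 16 + 20 n^2, which is below 25 n^2. *)
have D5 : D <= 5 * n.
  rewrite -(@ler_pXn2r _ 2)// ?nnegrE ?normc_ge0 ?mulr_ge0 ?(ltW n0)// kernel_identity.
  have h1 : normc (w - wj) ^+ 2 <= (n / 4) ^+ 2.
    by rewrite ler_pXn2r ?nnegrE ?normc_ge0 ?divr_ge0 ?(ltW n0).
  have h2 : 1 - normc w ^+ 2 <= 4 * n.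
    have -> : 1 - normc w ^+ 2 = t * (1 + normc w) by rewrite /t; ring.
    have : t * (1 + normc w) <= t * 2 by apply: ler_wpM2l; [exact: ltW|move: w1; lra].
    by lra.
  have h3 : 1 - normc wj ^+ 2 <= 5 * n.
    have -> : 1 - normc wj ^+ 2 = (1 - normc wj) * (1 + normc wj) by ring.
    have a0 : 0 <= 1 - normc wj by move: d1 mt n0; rewrite /t; lra.
    have : (1 - normc wj) * (1 + normc wj) <= (1 - normc wj) * 2.
      by apply: ler_wpM2l => //; move: a0; lra.
    by move: d2 t2; rewrite /t; lra.
  have h4 : (1 - normc wj ^+ 2) * (1 - normc w ^+ 2) <= (5 * n) * (4 * n).
    apply: ler_pM => //; rewrite subr_ge0 expr_le1//.
      by move: d1 mt n0; rewrite /t; lra.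
    exact: ltW.
  have n2 : 0 <= n ^+ 2 by exact: sqr_ge0.
  have -> : (5 * n) ^+ 2 = (n / 4) ^+ 2 + (5 * n) * (4 * n) + 79 / 16 * n ^+ 2 by field.
  by move: h1 h4 n2; lra.
have D0 : 0 < D.
  by apply: lt_le_trans (keep_kernel_gt0 keep w1); rewrite divr_gt0// scale_gt0.
have ks : (5 ^+ 6)^-1 <= kernel_size j w.
  rewrite /kernel_size keep -/wj -/D jn -exprVn.
  rewrite ler_pXn2r ?nnegrE ?invr_ge0 ?divr_ge0 ?(ltW n0) ?(ltW D0)//.
  by rewrite ler_pdivlMr// ler_pdivrMl.
have tq : t <= 1 - normc w ^+ 2.
  by rewrite /t lerD2l lerN2 expr2 ler_piMl// ltW.
have q0 : 0 < 1 - normc w ^+ 2 by exact: lt_le_trans tq.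
rewrite normc_test_kernel jn powRM ?powR_ge0 ?kernel_size_ge0// -powRrM mulNr divfK ?gt_eqF//.
rewrite mulrC; apply: ler_pM.
- by rewrite invr_ge0 sqr_ge0.
- exact: powR_ge0.
- rewrite powRN powR_mulrn ?(ltW n0)// lef_pV2 ?posrE ?exprn_gt0//.
  by rewrite ler_pXn2r ?nnegrE ?(ltW n0) ?(ltW q0)//; exact: le_trans (ltW mt) tq.
by apply: ge0_ler_powR; rewrite ?nnegrE ?kernel_size_ge0 ?invr_ge0 ?exprn_ge0 ?(ltW p0).
Qed.

(** * The two norm estimates *)

Lemma poweR_inv_le (R : realType) (p c : R) (a : \bar R) : 0 < p -> 0 <= c -> (0 <= a)%E ->
  (a `^ p^-1 <= c%:E)%E <-> (a <= (c `^ p)%:E)%E.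
Proof.
move=> p0 c0 a0; have pi0 : 0 <= p^-1 by rewrite invr_ge0 ltW.
split=> h.
  have := @gt0_ler_poweR R p (ltW p0) _ _ _ _ h.
  rewrite -poweRrM mulVf ?gt_eqF// poweRe1// poweR_EFin; apply.
    by rewrite in_itv/= leey andbT poweR_ge0.
  by rewrite in_itv/= leey andbT lee_fin.
have := @gt0_ler_poweR R p^-1 pi0 _ _ _ _ h.
rewrite poweR_EFin -powRrM mulfV ?gt_eqF// powRr1//; apply.
  by rewrite in_itv/= leey andbT.
by rewrite in_itv/= leey andbT lee_fin powR_ge0.
Qed.

Lemma disc_integral_ge0 (R : realType) (g : R[i] -> \bar R) :
  (forall z, disc z -> 0 <= g z)%E -> (0 <= disc_integral g)%E.
Proof.
move=> g0; rewrite mule_ge0 ?lee_fin ?invr_ge0 ?pi_ge0//.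
by apply: integral_ge0 => xy; exact: g0.
Qed.

Lemma A_norm_le (R : realType) (X : normedModType R[i]) (p c : R) (v : R[i] -> R) (f : R[i] -> X) :
  0 < p -> 0 <= c -> (forall z, disc z -> 0 <= v z) ->
  (A_norm p v f <= c%:E)%E <->
  (\int[(area R)]_(xy in @discRR R)
     (rnorm (f (xy.1 +i* xy.2)) `^ p * v (xy.1 +i* xy.2))%:E <= (pi * c `^ p)%:E)%E.
Proof.
move=> p0 c0 v0; rewrite /A_norm poweR_inv_le//; last first.
  by apply: disc_integral_ge0 => z /v0 vz; rewrite lee_fin mulr_ge0// powR_ge0.
by rewrite /disc_integral muleC lee_pdivrMr ?pi_gt0// -EFinM mulrC.
Qed.

Lemma dual_ball_le (R : realType) (X : normedModType R[i]) (xs : {linear X -> R[i]^o}) (x : X) :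
  dual_ball xs -> normc (xs x) <= rnorm x.
Proof.
move=> [_ xs1]; have [->|x0] := eqVneq x 0.
  by rewrite linear0 rnorm0 normc0.
have n0 : 0 < rnorm x by rewrite lt_def rnorm_ge0 rnorm_eq0 x0.
have : ((normc (xs ((rnorm x)^-1%:C *: x)))%:E <= 1)%E.
  apply: le_trans xs1; apply: ereal_sup_ubound => /=.
  exists ((rnorm x)^-1%:C *: x) => //.
  by rewrite /= rnormZ normc_real ger0_norm ?invr_ge0 ?rnorm_ge0// mulVf ?gt_eqF.
rewrite lee_fin linearZ /= normcM normc_real ger0_norm ?invr_ge0 ?rnorm_ge0//.
by rewrite ler_pdivrMl// mulr1.
Qed.

Lemma dual_ball_of_le (R : realType) (X : normedModType R[i]) (xs : {linear X -> R[i]^o}) :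
  (forall x, normc (xs x) <= rnorm x) -> dual_ball xs.
Proof.
move=> H; split; last first.
  by apply: ge_ereal_sup => _ [x x1 <-]; rewrite lee_fin (le_trans (H x)).
move=> x; apply/cvgrPdist_lt => e e0; near=> y.
rewrite -linearB normrc -rnormc; apply: (@le_lt_trans _ _ `|x - y|).
  by rewrite normr_rnorm lecR; exact: H.
by near: y; exact: cvgr_dist_lt.
Unshelve. all: by end_near. Qed.

Lemma cdiff_dual (R : realType) (X : normedModType R[i]) (xs : {linear X -> R[i]^o})
    (f : R[i] -> X) (z : R[i]) :
  dual_ball xs -> derivable (f : R[i]^o -> X) z 1 -> cdiff (xs \o f) z.
Proof.
move=> xs1 /has_cderivP[d H]; apply/has_cderivP; exists (xs d) => e /H[r r0 Hr].
exists r => // h /Hr; apply: le_trans => /=; rewrite -linearB.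
have -> : h *: xs d = xs (h *: d) by rewrite linearZ.
by rewrite -linearB; exact: dual_ball_le.
Qed.

Lemma weight_continuous (R : realType) (v : R[i] -> R) : weight v -> disc_continuous v.
Proof.
move=> [_ _ cv] z Dz e e0.
have /cvgrPdist_lt/(_ _ e0)/nbhs_normc[r r0 Hr] := cv z Dz.
by exists r => // h /Hr; rewrite distrC.
Qed.

Lemma rnorm_continuous (R : realType) (X : normedModType R[i]) (f : R[i] -> X) :
  analytic f -> disc_continuous (fun z => rnorm (f z)).
Proof.
move=> df z Dz e e0; have [s s0 Hs] := derivable_cont (df _ Dz) e0.
by exists s => // k /Hs; apply: le_lt_trans; exact: rnorm_lip.
Qed.

Lemma disc_continuous_comp (R : realType) (F : R[i] -> R) (phi : R[i] -> R[i]) :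
  analytic (phi : R[i] -> R[i]^o) -> (forall z, disc z -> disc (phi z)) ->
  disc_continuous F -> disc_continuous (F \o phi).
Proof.
move=> dphi Dphi cF z Dz e e0; have [r r0 Hr] := cF _ (Dphi _ Dz) _ e0.
have [s s0 Hs] := derivable_cont (dphi _ Dz) r0; exists s => // h /Hs hr /=.
by have := Hr _ hr; rewrite [phi z + _]addrC subrK.
Qed.

Lemma subdisc_square (R : realType) (w1 w2 : R) : disc (w1 +i* w2) ->
  square w1 w2 ((1 - normc (w1 +i* w2)) / 4) `<=` @discRR R.
Proof.
move=> /discE w0 [x y] [/=]; set r := _ / 4.
rewrite !in_itv/= => /andP[x1 x2] /andP[y1 y2]; apply/discE.
rewrite -[_ +i* _]/(x +i* y).
have hx : `|x - w1| <= r by rewrite ler_distl x1.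
have hy : `|y - w2| <= r by rewrite ler_distl y1.
rewrite -(subrK (w1 +i* w2) (x +i* y)) -rnormc (le_lt_trans (rnormD _ _))// !rnormc.
have h := le_trans (normc_pair x y w1 w2) (lerD hx hy).
apply: (le_lt_trans (lerD h (lexx _))).
have key (n : R) : n < 1 -> (1 - n) / 4 + (1 - n) / 4 + n < 1 by lra.
exact: key.
Qed.

Lemma wA_growth (R : realType) (X : normedModType R[i]) (v : R[i] -> R) (mu : R[i] -> R[i]) (p : R) :
  1 <= p -> weight v -> analytic (mu : R[i] -> R[i]^o) -> (forall z, disc z -> mu z != 0) ->
  (forall z, disc z -> v z = rnorm (mu z : R[i]^o)) ->
  forall (f : R[i] -> X) w, analytic f -> (wA_norm p v f <= 1)%E -> disc w ->
    rnorm (f w) `^ p <= 160 `^ p * pi * 64 / ((1 - normc w ^+ 2) ^+ 2 * v w).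
Proof.
move=> p1 hv hmu mu0 vmu f w df fN Dw; have p0 : 0 < p by rewrite (lt_le_trans ltr01).
have [vp _ _] := hv.
have [h [dh hE]] := analytic_root p0 hmu mu0.
have [xs xs1 xsE] := hahn_banach (f w).
have xsB := dual_ball_of_le xs1.
pose g z := xs (f z) * h z.
have dg z : disc z -> cdiff g z.
  by move=> Dz; apply: cdiffM; [exact: (cdiff_dual xsB (df z Dz))|exact: dh].
have gE z : disc z -> normc (g z) `^ p = normc (xs (f z)) `^ p * v z.
  by move=> Dz; rewrite normcM powRM ?normc_ge0// hE// vmu.
have intg : (\int[(area R)]_(xy in @discRR R)
    (normc (g (xy.1 +i* xy.2)) `^ p)%:E <= pi%:E)%E.
  have : (A_norm p v (xs \o f) <= 1)%E.
    by apply: le_trans fN; apply: ereal_sup_ubound; exists xs.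
  move=> /(A_norm_le _ p0 ler01 (fun z Dz => ltW (vp z Dz))).
  rewrite powR1 mulr1; apply: le_trans.
  rewrite le_eqVlt; apply/orP; left; apply/eqP; apply: eq_integral => xy.
  by rewrite inE => Dz; rewrite gE.
have mg : measurable_fun (@discRR R) (fun xy : plane R =>
    (normc (g (xy.1 +i* xy.2)) `^ p)%:E).
  apply/measurable_EFinP.
  exact: (measurableT_comp (measurable_powR p)
    (disc_continuous_measurable (cdiff_normc_continuous dg))).
case: w Dw xsE => w1 w2 Dw xsE.
have /discE w1' := Dw; have sub := subdisc_square Dw; have vw := vp _ Dw.
set w := w1 +i* w2 in Dw xsE w1' sub vw *.
have n0 := normc_ge0 w.
have n2 : normc w ^+ 2 < 1 by rewrite expr_lt1.
pose r := (1 - normc w) / 4.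
have r0 : 0 < r by rewrite divr_gt0// subr_gt0.
have := @submean_Lp R g w1 w2 r p pi r0 (pi_gt0 R) p1 dg sub.
have intQ : (\int[(area R)]_(xy in square w1 w2 r)
    (normc (g (xy.1 +i* xy.2)) `^ p)%:E <= pi%:E)%E.
  apply: le_trans intg; apply: ge0_subset_integral => //.
  - exact: square_measurable.
  - exact: discRR_measurable.
  - by move=> xy _; rewrite lee_fin powR_ge0.
move=> /(_ intQ); rewrite -/w gE// xsE => H.
rewrite ler_pdivlMr ?mulr_gt0 ?exprn_gt0 ?subr_gt0//.
have q0 : 0 <= (1 - normc w ^+ 2) ^+ 2 by exact: sqr_ge0.
(* Origin of the 64: 1 - |w|^2 <= 2 (1 - |w|) = 8 r. *)
have rq : (1 - normc w ^+ 2) ^+ 2 <= 64 * r ^+ 2.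
  have -> : 64 * r ^+ 2 = (8 * r) ^+ 2 by ring.
  have r8 : 0 <= 8 * r by apply: mulr_ge0 => //; exact: ltW.
  rewrite ler_pXn2r ?nnegrE ?subr_ge0 ?(ltW n2)//.
  have -> : 1 - normc w ^+ 2 = (1 - normc w) * (1 + normc w) by ring.
  have : (1 - normc w) * (1 + normc w) <= (1 - normc w) * 2.
    by apply: ler_wpM2l; [rewrite subr_ge0 ltW|move: w1'; lra].
  by rewrite /r; lra.
rewrite [_ ^+ 2 * v w]mulrC mulrA.
have r2 : 0 < r ^+ 2 by rewrite exprn_gt0.
apply: (@le_trans _ _ (160 `^ p * (pi / r ^+ 2) * (64 * r ^+ 2))).
  apply: ler_pM => //.
  by rewrite mulr_ge0 ?powR_ge0// ltW.
by rewrite le_eqVlt; apply/orP; left; apply/eqP; field; rewrite gt_eqF.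
Qed.

(** * Upper estimate of the operator norm *)

Section WeightedComposition.
Variables (R : realType) (X : normedModType R[i]) (p : R) (v v' : R[i] -> R) (u phi : R[i] -> R[i]).
Hypotheses (p1 : 1 <= p) (hv : weight v) (hv' : weight v').
Hypotheses (du : analytic (u : R[i] -> R[i]^o)) (dphi : analytic (phi : R[i] -> R[i]^o)).
Hypothesis Dphi : forall z, disc z -> disc (phi z).

Definition carleson_density (z : R[i]) : R :=
  normc (u z) `^ p * v' z / ((1 - normc (phi z) ^+ 2) ^+ 2 * v (phi z)).

Definition wcomp_density (f : R[i] -> X) (z : R[i]) : R := rnorm (wcomp u phi f z) `^ p * v' z.

Lemma disc_normc_lt1 (z : R[i]) : disc z -> 0 < 1 - normc z ^+ 2.
Proof. by move=> /discE z1; rewrite subr_gt0 expr_lt1// normc_ge0. Qed.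

Lemma carleson_denom_gt0 (z : R[i]) : disc z ->
  0 < (1 - normc (phi z) ^+ 2) ^+ 2 * v (phi z).
Proof.
have [vp _ _] := hv; move=> /Dphi Dz.
by rewrite mulr_gt0 ?vp// exprn_gt0// disc_normc_lt1.
Qed.

Lemma carleson_density_ge0 (z : R[i]) : disc z -> 0 <= carleson_density z.
Proof.
have [vp _ _] := hv'; move=> Dz.
by rewrite divr_ge0 ?(ltW (carleson_denom_gt0 Dz))// mulr_ge0 ?powR_ge0// ltW// vp.
Qed.

Lemma wcomp_density_ge0 (f : R[i] -> X) (z : R[i]) : disc z -> 0 <= wcomp_density f z.
Proof. by have [vp _ _] := hv'; move=> Dz; rewrite mulr_ge0 ?powR_ge0// ltW// vp. Qed.

Lemma measurable_carleson :
  measurable_fun (@discRR R) (fun xy => carleson_density (xy.1 +i* xy.2)).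
Proof.
pose Q z := (1 - normc (phi z) ^+ 2) ^+ 2 * v (phi z).
have mphi : measurable_fun (@discRR R) (fun xy => normc (phi (xy.1 +i* xy.2))).
  exact: (disc_continuous_measurable (@rnorm_continuous R R[i]^o phi dphi)).
have mv : measurable_fun (@discRR R) (fun xy => v (phi (xy.1 +i* xy.2))).
  exact: (disc_continuous_measurable (disc_continuous_comp dphi Dphi (weight_continuous hv))).
have mQ : measurable_fun (@discRR R) (fun xy => Q (xy.1 +i* xy.2)).
  apply: measurable_funM => //; apply: measurable_funX.
  by apply: measurable_funB => //; exact: measurable_funX.
have mu : measurable_fun (@discRR R) (fun xy => normc (u (xy.1 +i* xy.2)) `^ p).
  exact: (measurableT_comp (measurable_powR p)
    (disc_continuous_measurable (@rnorm_continuous R R[i]^o u du))).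
have mv' : measurable_fun (@discRR R) (fun xy => v' (xy.1 +i* xy.2)).
  exact: (disc_continuous_measurable (weight_continuous hv')).
apply: measurable_funM; first exact: measurable_funM.
apply: (@eq_measurable_fun _ _ _ _ _ (fun xy => Q (xy.1 +i* xy.2) `^ (-1))).
  by move=> xy; rewrite inE => Dz; rewrite powR_inv1// ltW// carleson_denom_gt0.
exact: (measurableT_comp (measurable_powR (-1)) mQ).
Qed.

Lemma measurable_wcomp (f : R[i] -> X) : analytic f ->
  measurable_fun (@discRR R) (fun xy => wcomp_density f (xy.1 +i* xy.2)).
Proof.
move=> df; apply: measurable_funM; last first.
  exact: (disc_continuous_measurable (weight_continuous hv')).
rewrite (_ : (fun xy => _) = fun xy => (normc (u (xy.1 +i* xy.2)) *
    rnorm (f (phi (xy.1 +i* xy.2)))) `^ p); last by apply/funext => xy; rewrite rnormZ.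
apply: (measurableT_comp (measurable_powR p)); apply: measurable_funM.
  exact: (disc_continuous_measurable (@rnorm_continuous R R[i]^o u du)).
exact: (disc_continuous_measurable (disc_continuous_comp dphi Dphi (rnorm_continuous df))).
Qed.

Lemma wcomp_norm_le (K : R) : 0 < K ->
  (forall (f : R[i] -> X) w, analytic f -> (wA_norm p v f <= 1)%E -> disc w ->
    rnorm (f w) `^ p <= K / ((1 - normc w ^+ 2) ^+ 2 * v w)) ->
  (wcomp_norm X p v v' u phi <=
     (K `^ p^-1)%:E * disc_integral (fun z => (carleson_density z)%:E) `^ p^-1)%E.
Proof.
move=> K0 HK; have p0 : 0 < p by rewrite (lt_le_trans ltr01).
have K0' : (0 <= K%:E)%E by rewrite lee_fin ltW.
apply: ge_ereal_sup => _ [f [[df _] fN] <-].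
have I0 : (0 <= disc_integral (fun z => (carleson_density z)%:E))%E.
  by apply: disc_integral_ge0 => z Dz; rewrite lee_fin carleson_density_ge0.
rewrite -poweR_EFin -poweRM//.
have J0 : (0 <= disc_integral (fun z => (wcomp_density f z)%:E))%E.
  by apply: disc_integral_ge0 => z Dz; rewrite lee_fin wcomp_density_ge0.
have ip0 : 0 <= p^-1 by rewrite invr_ge0 ltW.
apply: (gt0_ler_poweR ip0).
- by rewrite in_itv/= leey andbT.
- by rewrite in_itv/= leey andbT; exact: mule_ge0.
rewrite /disc_integral muleCA; apply: lee_pmul => //.
- by rewrite lee_fin invr_ge0 pi_ge0.
- by apply: integral_ge0 => xy Dz; rewrite lee_fin wcomp_density_ge0.
have mc : measurable_fun (@discRR R) (fun xy => (carleson_density (xy.1 +i* xy.2))%:E).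
  by apply/measurable_EFinP; exact: measurable_carleson.
have c0 xy : @discRR R xy -> (0 <= (carleson_density (xy.1 +i* xy.2))%:E)%E.
  by move=> Dz; rewrite lee_fin carleson_density_ge0.
have mD : measurable (@discRR R) by exact: discRR_measurable.
have := ge0_integralZl_EFin (area R) mD c0 mc (ltW K0).
rewrite /= => <-.
apply: ge0_le_integral => //.
- by move=> xy Dz; rewrite lee_fin wcomp_density_ge0.
- by apply/measurable_EFinP; exact: measurable_wcomp.
- exact: measurable_funeM.
move=> [x y] Dz; rewrite -EFinM lee_fin /wcomp_density /carleson_density.
have [vp _ _] := hv'.
rewrite rnormZ powRM ?normc_ge0 ?rnorm_ge0//.
set z := x +i* y in Dz *; have := HK f (phi z) df fN (Dphi Dz).
move=> /(ler_wpM2l (powR_ge0 (normc (u z)) p)) /(ler_wpM2r (ltW (vp _ Dz))).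
move=> /le_trans; apply; rewrite le_eqVlt; apply/orP; left; apply/eqP; ring.
Qed.

End WeightedComposition.

(* Flipping the sign at [j0] changes the sum by [2 t_(j0)], so one of the two sums
   has norm at least [|t_(j0)|]. *)
Lemma sign_average (R : realType) (X : normedModType R[i]) (J : finType) (p : R) (t : J -> X) (j0 : J) :
  0 < p ->
  #|{: {ffun J -> bool}}|%:R * rnorm (t j0) `^ p <=
    2 * \sum_(e : {ffun J -> bool}) rnorm (\sum_j (-1) ^+ e j *: t j) `^ p.
Proof.
move=> p0; pose y (e : {ffun J -> bool}) := \sum_j (-1 : R[i]) ^+ e j *: t j.
pose flip (e : {ffun J -> bool}) := [ffun j => (j == j0) (+) e j].
have flipK : involutive flip.
  by move=> e; apply/ffunP => j; rewrite !ffunE addbA addbb.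
have le_sum e : rnorm (t j0) `^ p <= rnorm (y e) `^ p + rnorm (y (flip e)) `^ p.
  have yy : y e - y (flip e) = (2 * (-1) ^+ e j0) *: t j0.
    rewrite /y -sumrB (bigD1 j0)//= big1 ?addr0; last first.
      by move=> j jj; rewrite ffunE (negbTE jj) subrr.
    rewrite ffunE eqxx addTb -scalerBl; congr (_ *: _).
    by case: (e j0); rewrite !(expr0, expr1); ring.
  have n2 : 2 * rnorm (t j0) <= rnorm (y e) + rnorm (y (flip e)).
    have := rnormD (y e) (- y (flip e)); rewrite yy rnormN rnormZ normcM normcX normcN normc1 expr1n mulr1.
    have -> : normc (2 : R[i]) = 2 by rewrite -[2 : R[i]](rmorph_nat (@real_complex R)) normc_real ger0_norm.
    by [].
  have [h|h] := leP (rnorm (t j0)) (rnorm (y e)).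
    rewrite -[leLHS]addr0 lerD ?powR_ge0//.
    by apply: ge0_ler_powR; rewrite ?nnegrE ?rnorm_ge0 ?(ltW p0).
  rewrite -[leLHS]add0r lerD ?powR_ge0//.
  by apply: ge0_ler_powR; rewrite ?nnegrE ?rnorm_ge0 ?(ltW p0)//; lra.
have flipE : \sum_e rnorm (y (flip e)) `^ p = \sum_e rnorm (y e) `^ p.
  by rewrite [RHS](reindex_inj (inv_inj flipK)).
apply: (@le_trans _ _ (\sum_(e : {ffun J -> bool}) rnorm (t j0) `^ p)).
  by rewrite sumr_const mulr_natl.
apply: (le_trans (ler_sum _ (fun e _ => le_sum e))).
by rewrite big_split /= flipE mulr_natl mulr2n.
Qed.

(* Test the hypothesis on [a_j = conj (xs x_j)]. *)
Lemma dual_weak_l2 (R : realType) (X : normedModType R[i]) (J : finType) (x : J -> X)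
    (xs : {linear X -> R[i]^o}) :
  (forall a : J -> R[i], rnorm (\sum_j a j *: x j) ^+ 2 <= \sum_j normc (a j) ^+ 2) ->
  dual_ball xs -> \sum_j normc (xs (x j)) ^+ 2 <= 1.
Proof.
move=> Hx xs1; pose S := \sum_j normc (xs (x j)) ^+ 2.
have S0 : 0 <= S by apply: sumr_ge0 => j _; exact: sqr_ge0.
have := Hx (fun j => conjc (xs (x j))).
under [X in _ <= X]eq_bigr do rewrite normc_conjc; rewrite -/S.
set y := \sum_j _ => yS.
have xy : xs y = S%:C.
  rewrite /y /S linear_sum rmorph_sum /=; apply: eq_bigr => j _.
  by rewrite linearZ -mulcJ mulrC.
have := dual_ball_le y xs1; rewrite xy normc_real ger0_norm// => Sy.
have : S ^+ 2 <= S.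
  by apply: le_trans yS; rewrite ler_pXn2r ?nnegrE ?rnorm_ge0.
rewrite -/S; have [->//|Sn] := eqVneq S 0.
have Sp : 0 < S by rewrite lt_def Sn.
by move=> SS; rewrite -(ler_pM2l Sp) mulr1 -expr2.
Qed.

Lemma derivable_combination (R : realType) (X : normedModType R[i]) (J : finType)
    (a : J -> R[i] -> R[i]) (x : J -> X) (z : R[i]) :
  (forall j, cdiff (a j) z) ->
  derivable ((fun z => \sum_j a j z *: x j) : R[i]^o -> X) z 1.
Proof.
move=> da; elim: (index_enum J) => [|j l IH].
  have -> : (fun z => \sum_(j <- [::]) a j z *: x j) = (fun=> 0 : X).
    by apply/funext => w; rewrite big_nil.
  exact: derivable_cst.
have -> : (fun z => \sum_(i <- j :: l) a i z *: x i) =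
   (fun z => a j z *: x j + \sum_(i <- l) a i z *: x i).
  by apply/funext => w; rewrite big_cons.
apply: (@derivableD R[i] R[i]^o X (fun z => a j z *: x j) (fun z => \sum_(i <- l) a i z *: x i) z 1) => //.
have /has_cderivP[d Hd] := da j; apply/has_cderivP; exists (d *: x j) => e e0.
have xp : 0 < rnorm (x j) + 1 by rewrite ltr_pwDr// rnorm_ge0.
have [r r0 Hr] := Hd (e / (rnorm (x j) + 1)) (divr_gt0 e0 xp); exists r => // h /Hr {Hr}.
rewrite scalerA -!scalerBl rnormZ -[h *: _]/(h * _) => H.
apply: (@le_trans _ _ (e / (rnorm (x j) + 1) * normc h * (rnorm (x j) + 1))).
  apply: ler_pM => //; [exact: normc_ge0|exact: rnorm_ge0|].
  by rewrite lerDl.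
by rewrite mulrAC divfK// gt_eqF.
Qed.

(** * Random test functions from a Dvoretzky-Rogers system *)

Section TestFunctions.
Variables (R : realType) (X : normedModType R[i]) (p : R) (v : R[i] -> R) (h : R[i] -> R[i]).
Variables (C : R) (M : nat) (x : kernel_index M -> X).
Hypotheses (p2 : 2 <= p) (hv : weight v) (C0 : 0 < C).
Hypothesis HC : forall b : kernel_index M -> R[i], \sum_j normc (b j) `^ p <= 1 ->
  (\int[(area R)]_(xy in @discRR R)
    (normc (\sum_j b j * test_kernel p j (xy.1 +i* xy.2)) `^ p)%:E <= C%:E)%E.
Hypothesis dh : forall z, disc z -> cdiff h z.
Hypothesis hE : forall z, disc z -> normc (h z) `^ p = v z.
Hypothesis x_large : forall j, 2 / 5 <= rnorm (x j).
Hypothesis x_weak_l2 : forall a : kernel_index M -> R[i],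
  rnorm (\sum_j a j *: x j) ^+ 2 <= \sum_j normc (a j) ^+ 2.

Let p0 : 0 < p. Proof. by move: p2; lra. Qed.

(** Division by h turns the weight v = |h|^p into 1, and division by C^(1/p) places the signed sums
    in the unit ball. *)
Definition test_term (j : kernel_index M) (z : R[i]) : X :=
  (test_kernel p j z / ((C `^ p^-1)%:C * h z)) *: x j.

Definition test_fun (e : {ffun kernel_index M -> bool}) (z : R[i]) : X :=
  \sum_j (-1) ^+ e j *: test_term j z.

Let c0 : 0 < C `^ p^-1. Proof. exact: powR_gt0. Qed.

Let cp : (C `^ p^-1) `^ p = C.
Proof. by rewrite -powRrM mulVf ?gt_eqF// powRr1// ltW. Qed.

Let cpV : (C `^ p^-1)^-1 `^ p = C^-1.
Proof. by rewrite -powR_inv1 ?(ltW c0)// powRAC cp powR_inv1// ltW. Qed.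

Let h_neq0 z : disc z -> h z != 0.
Proof.
have [vp _ _] := hv; move=> Dz; apply/eqP => h0.
by have := vp _ Dz; rewrite -hE// h0 normc0 powR0 ?ltxx// gt_eqF.
Qed.

Let ch_neq0 z : disc z -> (C `^ p^-1)%:C * h z != 0.
Proof.
move=> Dz; rewrite mulf_neq0 ?h_neq0// -normc_gt0 normc_real gtr0_norm//.
Qed.

Lemma test_fun_analytic e : analytic (test_fun e).
Proof.
move=> z Dz; pose a j z := (-1) ^+ e j * (test_kernel p j z / ((C `^ p^-1)%:C * h z)).
have -> : test_fun e = fun z => \sum_j a j z *: x j.
  by apply/funext => w; apply: eq_bigr => j _; rewrite scalerA.
apply: derivable_combination => j; apply: cdiffM; first exact: cdiff_cst.
apply: cdiffM; first exact: cdiff_test_kernel.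
apply: cdiffV; first exact: ch_neq0.
by apply: cdiffM; [exact: cdiff_cst|exact: dh].
Qed.

(** A functional turns the test function into a scalar kernel sum with coefficients b_j equal to xs
    (x_j) up to sign; [HC] is uniform in these b, hence in xs and in the signs. *)
Lemma test_fun_wA_norm e : (wA_norm p v (test_fun e) <= 1)%E.
Proof.
have [vp _ _] := hv.
apply: ge_ereal_sup => _ [xs xs1 <-].
apply/(A_norm_le _ p0 ler01 (fun z Dz => ltW (vp z Dz))); rewrite powR1 mulr1.
pose b j := (-1) ^+ e j * xs (x j).
(* Here p >= 2 is used: all |xs (x_j)| are at most 1, so their p-th powers are at most their
   squares. *)
have b1 : \sum_j normc (b j) `^ p <= 1.
  apply: le_trans (dual_weak_l2 x_weak_l2 xs1); apply: ler_sum => j _.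
  have bj : normc (b j) = normc (xs (x j)).
    by rewrite /b normcM normcX normcN normc1 expr1n mul1r.
  rewrite bj -powR_mulrn ?normc_ge0//.
  have [->|n0] := eqVneq (normc (xs (x j))) 0; first by rewrite powR0 ?gt_eqF// powR_ge0.
  apply: ger_powR => //; rewrite lt_def n0 normc_ge0 /=.
  have le1 : normc (xs (x j)) ^+ 2 <= 1.
    apply: le_trans (dual_weak_l2 x_weak_l2 xs1).
    by rewrite (bigD1 j)//= lerDl sumr_ge0// => i _; exact: sqr_ge0.
  by rewrite -(@ler_pXn2r _ 2)// ?nnegrE ?normc_ge0// expr1n.
pose F (xy : plane R) :=
  normc (\sum_j b j * test_kernel p j (xy.1 +i* xy.2)) `^ p.
have FE z : disc z -> rnorm ((xs \o test_fun e) z : R[i]^o) `^ p * v z =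
    C^-1 * normc (\sum_j b j * test_kernel p j z) `^ p.
  move=> Dz; have -> : (xs \o test_fun e) z =
      (\sum_j b j * test_kernel p j z) / ((C `^ p^-1)%:C * h z).
    rewrite /= /test_fun linear_sum mulr_suml; apply: eq_bigr => j _.
    have -> : xs ((-1) ^+ e j *: test_term j z) =
        (-1) ^+ e j * (test_kernel p j z / ((C `^ p^-1)%:C * h z) * xs (x j)).
      by rewrite linearZ; congr (_ * _); rewrite linearZ.
    rewrite /b -!mulrA; congr (_ * _).
    by rewrite mulrA mulrC.
  rewrite -hE// rnormc -powRM ?normc_ge0// normcM normcV normcM normc_real gtr0_norm// invfM -mulrA.
  rewrite mulfVK; last by rewrite normc_eq0 h_neq0.
  by rewrite mulrC powRM ?normc_ge0 ?invr_ge0 ?(ltW c0)// cpV.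
have mF : measurable_fun (@discRR R) (fun xy => (F xy)%:E).
  apply/measurable_EFinP.
  apply: (measurableT_comp (measurable_powR p)).
  apply: (@disc_continuous_measurable R (fun z => normc (\sum_j b j * test_kernel p j z))).
  apply: cdiff_normc_continuous => z Dz; apply: cdiff_sum => j.
  by apply: cdiffM; [exact: cdiff_cst|exact: cdiff_test_kernel].
have mD : measurable (@discRR R) by exact: discRR_measurable.
have F0 xy : @discRR R xy -> (0 <= (F xy)%:E)%E by rewrite lee_fin powR_ge0.
have Ci : 0 <= C^-1 by rewrite invr_ge0 ltW.
have E := ge0_integralZl_EFin (area R) mD F0 mF Ci.
rewrite /= in E.
(* Written with unnormalized area, the unit ball condition is a bound by pi; the integral is even at
   most 1. *)
apply: (@le_trans _ _ (C^-1%:E * C%:E)%E); last first.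
  by rewrite -EFinM mulVf ?gt_eqF// lee_fin (le_trans _ (pi_ge2 R))// ler1n.
apply: (@le_trans _ _ (C^-1%:E * \int[(area R)]_(xy in @discRR R) (F xy)%:E)%E).
  rewrite -E le_eqVlt; apply/orP; left; apply/eqP; apply: eq_integral => xy.
  by rewrite inE => Dz; rewrite FE.
by apply: lee_wpmul2l; [rewrite lee_fin|exact: HC].
Qed.

(** One kernel is large at w by [test_kernel_lower], and averaging over signs keeps its term alone;
    5^-6 comes from the kernel and 2/5 from the norm of x_j. *)
Lemma test_fun_average (w : R[i]) : disc w -> 2 * scale R M < 1 - normc w ->
  #|{: {ffun kernel_index M -> bool}}|%:R *
    (((5 ^+ 6)^-1 `^ p * (2 / 5) `^ p / C) / ((1 - normc w ^+ 2) ^+ 2 * v w)) <=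
  2 * \sum_e rnorm (test_fun e w) `^ p.
Proof.
move=> Dw wM; have [j Hj] := test_kernel_lower p2 wM.
apply: le_trans (sign_average (test_term ^~ w) j p0).
rewrite ler_wpM2l ?ler0n//.
have q0 : 0 < 1 - normc w ^+ 2.
  by move: Dw => /discE w1; rewrite subr_gt0 expr_lt1// normc_ge0.
have [vp _ _] := hv; have vw := vp _ Dw.
have tE : rnorm (test_term j w) `^ p =
    normc (test_kernel p j w) `^ p * (C * v w)^-1 * rnorm (x j) `^ p.
  rewrite /test_term rnormZ normcM normcV normcM normc_real (gtr0_norm c0).
  rewrite powRM ?mulr_ge0 ?invr_ge0 ?mulr_ge0 ?normc_ge0 ?rnorm_ge0 ?(ltW c0)//.
  rewrite powRM ?invr_ge0 ?mulr_ge0 ?normc_ge0 ?(ltW c0)// invfM.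
  rewrite powRM ?invr_ge0 ?normc_ge0 ?(ltW c0)// cpV -(hE Dw) invfM.
  by rewrite -(powR_inv1 (normc_ge0 (h w))) powRAC powR_inv1 ?powR_ge0.
rewrite tE.
have -> : (5 ^+ 6)^-1 `^ p * (2 / 5) `^ p / C / ((1 - normc w ^+ 2) ^+ 2 * v w) =
   (5 ^+ 6)^-1 `^ p / (1 - normc w ^+ 2) ^+ 2 * (C * v w)^-1 * (2 / 5) `^ p.
  by field; rewrite !gt_eqF.
have Cv : 0 <= (C * v w)^-1 by rewrite invr_ge0 mulr_ge0// ltW.
apply: ler_pM.
- by rewrite mulr_ge0// divr_ge0 ?powR_ge0// sqr_ge0.
- exact: powR_ge0.
- by rewrite ler_wpM2r.
by apply: ge0_ler_powR; rewrite ?nnegrE ?rnorm_ge0 ?(ltW p0).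
Qed.

End TestFunctions.

Lemma scale_small (R : realType) (e : R) : 0 < e -> exists M, 2 * scale R M < e.
Proof.
move=> e0; pose n := (Num.truncn (2 / e)).+1; exists n.
have h : 2 / e < n%:R by exact: truncnS_gt.
rewrite /scale ltr_pdivrMr ?exprn_gt0// -ltr_pdivrMl// mulrC.
by rewrite (lt_le_trans h)// -natrX ler_nat ltnW// ltn_expl.
Qed.

Lemma dvoretzky_rogers_fin (R : realType) (X : normedModType R[i]) (J : finType) :
  ~ finite_dimensional X -> exists x : J -> X, (forall j, 2 / 5 <= rnorm (x j)) /\
    (forall a : J -> R[i], rnorm (\sum_j a j *: x j) ^+ 2 <= \sum_j normc (a j) ^+ 2).
Proof.
move=> /(@dvoretzky_rogers R X #|J|)[x [x1 x2]].
exists (x \o enum_rank); split=> [j|a]; first exact: x1.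
have := x2 (a \o enum_val).
rewrite (reindex _ (onW_bij _ (@enum_rank_bij J))) [X in _ <= X](reindex _ (onW_bij _ (@enum_rank_bij J))) /=.
by under eq_bigr do rewrite enum_rankK; under [X in _ <= X]eq_bigr do rewrite enum_rankK.
Qed.

(** * Lower estimate of the operator norm *)

Section LowerBound.
Variables (R : realType) (X : normedModType R[i]) (p : R) (v v' : R[i] -> R) (u phi : R[i] -> R[i]).
Hypotheses (p1 : 1 <= p) (hv : weight v) (hv' : weight v').
Hypotheses (du : analytic (u : R[i] -> R[i]^o)) (dphi : analytic (phi : R[i] -> R[i]^o)).
Hypothesis Dphi : forall z, disc z -> disc (phi z).
Variables (kappa n : R).
Hypotheses (kappa0 : 0 < kappa) (n0 : 0 <= n).
Hypothesis Hn : (wcomp_norm X p v v' u phi <= n%:E)%E.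

Let p0 : 0 < p. Proof. by rewrite (lt_le_trans ltr01). Qed.

(** This is all that the operator estimate needs from the test functions: a finite family in the
    unit ball whose average p-th power at w reaches, up to kappa / 2, the order of the growth bound
    of the unit ball, except near the circle. *)
Definition averaging (M : nat) (E : finType) (F : E -> R[i] -> X) : Prop :=
  [/\ (0 < #|E|)%N, forall e, analytic (F e), forall e, (wA_norm p v (F e) <= 1)%E &
   forall w, disc w -> 2 * scale R M < 1 - normc w ->
     #|E|%:R * (kappa / ((1 - normc w ^+ 2) ^+ 2 * v w)) <= 2 * \sum_e rnorm (F e w) `^ p].

Definition inner_disc (M : nat) : set (plane R) :=
  [set xy | discRR xy /\ 2 * scale R M < 1 - normc (phi (xy.1 +i* xy.2))].

Let mD : measurable (@discRR R). Proof. exact: discRR_measurable. Qed.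

Lemma inner_disc_measurable M : measurable (inner_disc M).
Proof.
have mphi : measurable_fun (@discRR R) (fun xy => 1 - normc (phi (xy.1 +i* xy.2))).
  apply: measurable_funB => //.
  exact: (disc_continuous_measurable (@rnorm_continuous R R[i]^o phi dphi)).
have := mphi mD `]2 * scale R M, +oo[%classic (measurable_itv _).
congr (measurable _); apply/seteqP; split=> xy [Dxy] /=; rewrite in_itv/= andbT => H; split => //.
Qed.

Lemma wcomp_density_int (f : R[i] -> X) : analytic f -> (wA_norm p v f <= 1)%E ->
  (\int[(area R)]_(xy in @discRR R)
    (wcomp_density p v' u phi f (xy.1 +i* xy.2))%:E <= (pi * n `^ p)%:E)%E.
Proof.
have [vp' _ _] := hv'.
move=> df fN; apply/(A_norm_le _ p0 n0 (fun z Dz => ltW (vp' z Dz))).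
apply: le_trans Hn; apply: ereal_sup_ubound; exists f => //; split => //; split => //.
by rewrite (le_lt_trans fN)// ltry.
Qed.

Lemma carleson_inner (M : nat) (E : finType) (F : E -> R[i] -> X) : averaging M F ->
  (\int[(area R)]_(xy in inner_disc M)
    (carleson_density p v v' u phi (xy.1 +i* xy.2))%:E <= (2 / kappa * (pi * n `^ p))%:E)%E.
Proof.
move=> [E0 dF FN HF]; have [vp' _ _] := hv'.
have En : 0 < #|E|%:R :> R by rewrite ltr0n.
(* With this k the density is at most k times the sum over e; the |E| integrals, each at most pi
   n^p, give k |E| = 2 / kappa, so the size of the family cancels. *)
pose k := 2 / (kappa * #|E|%:R).
have k0 : 0 <= k by rewrite divr_ge0// mulr_ge0 ?ler0n// ltW.
pose D e (xy : plane R) :=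
  (wcomp_density p v' u phi (F e) (xy.1 +i* xy.2))%:E.
have D0 e xy : @discRR R xy -> (0 <= D e xy)%E.
  by move=> Dxy; rewrite lee_fin; exact: wcomp_density_ge0.
have mDe e : measurable_fun (@discRR R) (D e).
  by apply/measurable_EFinP; exact: measurable_wcomp.
have mkD e : measurable_fun (@discRR R) (fun xy => (k%:E * D e xy)%E).
  exact: measurable_funeM.
have mS : measurable_fun (@discRR R) (fun xy => (\sum_e k%:E * D e xy)%E).
  exact: emeasurable_sum.
have kD0 e xy : @discRR R xy -> (0 <= k%:E * D e xy)%E.
  by move=> Dxy; rewrite mule_ge0 ?D0.
have sub : inner_disc M `<=` @discRR R by move=> xy [].
have mI := inner_disc_measurable M.
apply: (@le_trans _ _ (\int[(area R)]_(xy in @discRR R)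
   (\sum_e k%:E * D e xy)%E)%E); last first.
  rewrite ge0_integral_sum//.
  apply: (@le_trans _ _ (\sum_(e : E) (k * (pi * n `^ p))%:E)%E).
    apply: lee_sum => e _.
    have := ge0_integralZl_EFin (area R) mD (D0 e) (mDe e) k0.
    rewrite /= => ->; rewrite (EFinM k); apply: lee_wpmul2l; first by rewrite lee_fin.
    exact: wcomp_density_int.
  rewrite sumEFin lee_fin sumr_const -mulr_natl le_eqVlt; apply/orP; left; apply/eqP.
  by rewrite /k; field; rewrite !gt_eqF.
apply: (@le_trans _ _ (\int[(area R)]_(xy in inner_disc M)
   (\sum_e k%:E * D e xy)%E)%E); last first.
  by apply: ge0_subset_integral => // xy Dxy; apply: sume_ge0 => e _; exact: kD0.
apply: ge0_le_integral => //.
- by move=> xy /sub Dxy; rewrite lee_fin; exact: carleson_density_ge0.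
- apply: (measurable_funS mD sub); apply/measurable_EFinP.
  exact: measurable_carleson.
- exact: (measurable_funS mD sub).
move=> [x y] [Dz wM]; rewrite /D.
set z := x +i* y in Dz wM *.
have -> : (\sum_e k%:E * (wcomp_density p v' u phi (F e) z)%:E)%E =
   (\sum_e k * wcomp_density p v' u phi (F e) z)%:E by rewrite -sumEFin.
rewrite lee_fin -mulr_sumr /wcomp_density /carleson_density.
have -> : \sum_e rnorm (wcomp u phi (F e) z) `^ p * v' z =
    normc (u z) `^ p * v' z * \sum_e rnorm (F e (phi z)) `^ p.
  rewrite mulr_sumr; apply: eq_bigr => e _.
  by rewrite rnormZ powRM ?normc_ge0 ?rnorm_ge0// mulrAC.
have := HF _ (Dphi Dz) wM; set S := \sum_e _; set Q := _ * v _ => HS.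
have Q0 : 0 < Q by exact: (carleson_denom_gt0 hv Dphi).
have A0 : 0 <= normc (u z) `^ p * v' z by rewrite mulr_ge0 ?powR_ge0// ltW// vp'.
rewrite mulrCA; apply: ler_wpM2l => //.
have kE : 0 < kappa * #|E|%:R by rewrite mulr_gt0.
rewrite /k mulrAC ler_pdivlMr//; apply: le_trans HS.
by rewrite le_eqVlt; apply/orP; left; apply/eqP; ring.
Qed.

(** As kappa does not depend on M, the bounds on the increasing sets [inner_disc] pass to their
    union, the whole disc, by monotone convergence. *)
Lemma carleson_le : (forall M, exists (E : finType) (F : E -> R[i] -> X), averaging M F) ->
  (\int[(area R)]_(xy in @discRR R)
    (carleson_density p v v' u phi (xy.1 +i* xy.2))%:E <= (2 / kappa * (pi * n `^ p))%:E)%E.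
Proof.
move=> HA.
have sub M : inner_disc M `<=` @discRR R by move=> xy [].
have mc M : measurable_fun (inner_disc M) (fun xy => (carleson_density p v v' u phi (xy.1 +i* xy.2))%:E).
  apply: (measurable_funS mD (@sub M)); apply/measurable_EFinP.
  exact: measurable_carleson.
have c0 M xy : inner_disc M xy -> (0 <= (carleson_density p v v' u phi (xy.1 +i* xy.2))%:E)%E.
  by move=> /sub Dxy; rewrite lee_fin; exact: carleson_density_ge0.
have nd : nondecreasing_seq inner_disc.
  apply/nondecreasing_seqP => M; apply/subsetPset => xy [Dxy wM]; split => //.
  apply: le_lt_trans wM; rewrite ler_wpM2l// /scale lef_pV2 ?posrE ?exprn_gt0//.
  by rewrite ler_weXn2l// ler1n.
have UD : \bigcup_M inner_disc M = @discRR R.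
  apply/seteqP; split=> [xy [M _ []]//|xy Dxy].
  have /discE w1 := Dphi Dxy; have [|M HM] := @scale_small R (1 - normc (phi (xy.1 +i* xy.2))).
    by rewrite subr_gt0.
  by exists M.
have := ge0_nondecreasing_set_cvg_integral (mu := (area R))
  nd inner_disc_measurable mc c0.
rewrite UD => cv; rewrite -(cvg_lim _ cv)//; apply: lime_le; first by apply/cvg_ex; eexists; exact: cv.
by apply: nearW => M; have [E [F HF]] := HA M; exact: carleson_inner HF.
Qed.

End LowerBound.

Lemma averaging_exists (R : realType) (X : normedModType R[i]) (p : R) (v : R[i] -> R)
    (mu : R[i] -> R[i]) : ~ finite_dimensional X -> 2 <= p -> weight v ->
  analytic (mu : R[i] -> R[i]^o) -> (forall z, disc z -> mu z != 0) ->
  (forall z, disc z -> v z = rnorm (mu z : R[i]^o)) ->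
  exists2 kappa : R, 0 < kappa &
    forall M, exists (E : finType) (F : E -> R[i] -> X), averaging p v kappa M F.
Proof.
move=> hX p2 hv hmu mu0 vmu; have p0 : 0 < p by lra.
have [h [dh hE]] := analytic_root p0 hmu mu0.
have hv' z : disc z -> normc (h z) `^ p = v z by move=> Dz; rewrite hE// vmu.
have [C C0 HC] := test_kernel_norm p2.
exists ((5 ^+ 6)^-1 `^ p * (2 / 5) `^ p / C).
  by rewrite divr_gt0// mulr_gt0// powR_gt0// ?invr_gt0 ?exprn_gt0 ?divr_gt0.
move=> M; have [x [x1 x2]] := dvoretzky_rogers_fin (kernel_index M) hX.
exists {ffun kernel_index M -> bool}, (test_fun p h C x); split.
- by apply/card_gt0P; exists [ffun=> false].
- by move=> e; exact: (test_fun_analytic p2 hv C0 dh hv').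
- by move=> e; exact: (test_fun_wA_norm p2 hv C0 (@HC M) hv' x2).
- by move=> w Dw wM; exact: (test_fun_average p2 hv C0 hv' x1).
Qed.

Unset Implicit Arguments.
Set Strict Implicit.

Theorem theorem2p3 (R : realType) (X : completeNormedModType R[i])
    (hX : ~ finite_dimensional X)
    (v v' : R[i] -> R) (mu : R[i] -> R[i]) (p : R)
    (hv : weight v) (hmu : analytic (mu : R[i] -> R[i]^o))
    (hmu0 : forall z, disc z -> mu z != 0)
    (hvmu : forall z, disc z -> v z = rnorm (mu z : R[i]^o))
    (hv' : weight v') (hp : 2 <= p) :
  exists c1 c2 : R, [/\ 0 < c1, 0 < c2 &
    forall phi u : R[i] -> R[i],
      analytic (phi : R[i] -> R[i]^o) ->
      (forall z, disc z -> disc (phi z)) ->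
      analytic (u : R[i] -> R[i]^o) ->
      let N := wcomp_norm X p v v' u phi in
      let I := (disc_integral (fun z =>
        (rnorm (u z : R[i]^o) `^ p * v' z /
          ((1 - rnorm (phi z : R[i]^o) ^+ 2) ^+ 2 * v (phi z)))%:E) `^ p^-1)%E in
      (c1%:E * N <= I)%E /\ (I <= c2%:E * N)%E].
Proof.
have p0 : 0 < p by lra.
have p1 : 1 <= p by lra.
pose K : R := 160 `^ p * pi * 64.
have K0 : 0 < K by rewrite !mulr_gt0 ?powR_gt0 ?pi_gt0.
have k0 : 0 < K `^ p^-1 by exact: powR_gt0.
have [kappa kappa0 HE] := averaging_exists hX hp hv hmu hmu0 hvmu.
have c20 : 0 < (2 / kappa) `^ p^-1 by rewrite powR_gt0// divr_gt0.
(* K is the constant of [wA_growth], and 2 / kappa that of [carleson_le]; both bound p-th powers. *)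
exists (K `^ p^-1)^-1, ((2 / kappa) `^ p^-1); split => //; first by rewrite invr_gt0.
move=> phi u dphi Dphi du N I.
have NI : (N <= (K `^ p^-1)%:E * I)%E.
  apply: (wcomp_norm_le p1 hv hv' du dphi Dphi K0) => f w df fN Dw.
  exact: (wA_growth p1 hv hmu hmu0 hvmu).
split; first by rewrite muleC lee_pdivrMr// muleC.
(* A supremum over no function would be -oo; any member of an averaging family lies in the unit ball
   and shows that N is nonnegative. *)
have N0 : (0 <= N)%E.
  have [E [F [/card_gt0P[e _] dF FN _]]] := HE 0%N.
  apply: (@le_trans _ _ (A_norm p v' (wcomp u phi (F e)))); first exact: poweR_ge0.
  apply: ereal_sup_ubound; exists (F e) => //; split => //; split => //.
  by rewrite (le_lt_trans (FN e))// ltry.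
have [->|Ny] := eqVneq N +oo%E; first by rewrite gt0_muley ?lte_fin// leey.
have Nn : N = (fine N)%:E by rewrite fineK// ge0_fin_numE// ltey.
have n0 : 0 <= fine N by exact: fine_ge0.
rewrite Nn -EFinM /I poweR_inv_le//.
- rewrite powRM ?(ltW c20)// -powRrM mulVf ?gt_eqF// powRr1; last by rewrite divr_ge0// ltW.
  rewrite /disc_integral muleC lee_pdivrMr ?pi_gt0// -EFinM.
  have -> : 2 / kappa * fine N `^ p * pi = 2 / kappa * (pi * fine N `^ p) by ring.
  have Hn : (wcomp_norm X p v v' u phi <= (fine N)%:E)%E by rewrite -Nn.
  exact: (carleson_le p1 hv hv' du dphi Dphi kappa0 n0 Hn HE).
- by rewrite mulr_ge0// ltW.
- apply: disc_integral_ge0 => z Dz; rewrite lee_fin.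
  exact: (carleson_density_ge0 p u hv hv' Dphi Dz).
Qed.
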